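(* Let $n\ge1$ be an integer and let $\psi\in L^2(\mathbb{R}^{2n},\mathbb{H})$ be a nonzero admissible quaternion shearlet such that, for $u,v,t\in\mathbb{R}^n$, $$\mathcal{F}_Q(\psi)(u,v)e^{-2j\pi v\cdot t}=e^{-2j\pi v\cdot t}\mathcal{F}_Q(\psi)(u,v)\quad\text{and}\quad \mathcal{F}_Q(j\psi)(u,v)e^{-2j\pi v\cdot t}=j\,e^{-2j\pi v\cdot t}\mathcal{F}_Q(\psi)(u,v).$$ Then $\mathcal{SH}_\psi^Q(L^2(\mathbb{R}^{2n},\mathbb{H}))$ is a reproducing kernel Hilbert space in $L^2(d\mu)$, with kernel $$\mathcal{K}_\psi((a,s,t),(a',s',t'))=\frac1{C_\psi}\langle\psi_{a,s,t},\psi_{a',s',t'}\rangle_Q .$$ Moreover the kernel is pointwise bounded: for all $(a,s,t),(a',s',t')\in\mathbb{R}^*\times\mathbb{R}^{2n-1}\times\mathbb{R}^{2n}$, $$|\mathcal{K}_\psi((a,s,t),(a',s',t'))|\le\frac{\|\psi\|_2^2}{C_\psi}.$$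
   Context: $\mathbb{H}$ is the real quaternion algebra with units $i,j,k$, conjugation $\overline{q}$ and modulus $|q|$. For $f,g\in L^2(\mathbb{R}^{2n},\mathbb{H})$, $\|f\|_2=(\int_{\mathbb{R}^{2n}}|f(x)|^2dx)^{1/2}$ and $\langle f,g\rangle_Q=\int_{\mathbb{R}^{2n}}f(x)\overline{g(x)}\,dx$ (quaternion-valued). $\mathbb{R}^*=\mathbb{R}\setminus\{0\}$. The (two-sided) quaternion Fourier transform of $f\in L^1\cap L^2(\mathbb{R}^{2n},\mathbb{H})$ is $\mathcal{F}_Q(f)(u,v)=\int_{\mathbb{R}^{2n}}e^{-2i\pi u\cdot x}f(x,y)e^{-2j\pi v\cdot y}\,dx\,dy$ with $x,y,u,v\in\mathbb{R}^n$; it extends to a norm-preserving operator on $L^2(\mathbb{R}^{2n},\mathbb{H})$. For $a\in\mathbb{R}^*$, $s\in\mathbb{R}^{2n-1}$: $A_a=\begin{pmatrix} a & 0^T\\ 0 & \mathrm{sg}(a)|a|^{\frac1{2n}}I_{2n-1}\end{pmatrix}$ ($\mathrm{sg}$ is the sign) and $S_s=\begin{pmatrix}1 & s^T\\ 0 & I_{2n-1}\end{pmatrix}$, both $2n\times 2n$. For $t\in\mathbb{R}^{2n}$, $\psi_{a,s,t}(x)=|a|^{\frac1{4n}-1}\psi(A_a^{-1}S_s^{-1}(x-t))$. Put $\psi^*(x)=\overline{\psi(-x)}$. A function $\psi\in L^2(\mathbb{R}^{2n},\mathbb{H})$ is an admissible quaternion shearlet iff $C_\psi:=\int_{\mathbb{R}^{2n}}\frac{|\mathcal{F}_Q(\psi^*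 )(\lambda)|^2}{|\lambda_1|^{2n}}\,d\lambda<\infty$, where $\lambda=(\lambda_1,\dots,\lambda_{2n})$. The continuous quaternion shearlet transform is $\mathcal{SH}_\psi^Q(f)(a,s,t)=\langle f,\psi_{a,s,t}\rangle_Q$. $\mu$ is the measure $d\mu(a,s,t)=\frac{da\,ds\,dt}{|a|^{2n+1}}$ on $\mathbb{R}^*\times\mathbb{R}^{2n-1}\times\mathbb{R}^{2n}$; $L^2(d\mu)$ consists of $\mathbb{H}$-valued square-integrable functions. That a subspace $\mathcal{V}\subseteq L^2(d\mu)$ of functions is a reproducing kernel Hilbert space with kernel $\mathcal{K}$ means: $\mathcal V$ is complete in the $L^2(d\mu)$ norm, $\mathcal{K}((a,s,t),\cdot)\in\mathcal{V}$ for every $(a,s,t)$, and $F(a,s,t)=\int F(a',s',t')\,\overline{\mathcal{K}((a,s,t),(a',s',t'))}\,d\mu(a',s',t')$ for all $F\in\mathcal{V}$ and all $(a,s,t)$. *)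

(* Defs.v *)
(* MathComp-Analysis over an abstract [R : realType]. *)
From HB Require Import structures.
From mathcomp Require Import all_boot all_order all_algebra ring.
From mathcomp Require Import all_classical all_reals all_analysis.
From mathcomp Require Import measurable_realfun.

Set Implicit Arguments.
Unset Strict Implicit.
Unset Printing Implicit Defensive.
Import Order.TTheory GRing.Theory Num.Theory.
Import numFieldNormedType.Exports.

Local Open Scope classical_set_scope.
Local Open Scope ring_scope.

(* Quat a b c d is a + b i + c j + d k. *)
Record quat (R : Type) := Quat { qre : R; qim_i : R; qim_j : R; qim_k : R }.

Section QuatStructure.
Context {R : realType}.
Local Notation H := (quat R).
Implicit Types p q : H.

Lemma quatP p q :
  p = q <-> [/\ qre p = qre q, qim_i p = qim_i q, qim_j p = qim_j q
              & qim_k p = qim_k q].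
Proof.
split=> [-> //|]; case: p => a b c d; case: q => a' b' c' d' /=.
by case=> -> -> -> ->.
Qed.

Let tup_of_quat q := (qre q, qim_i q, qim_j q, qim_k q).
Let quat_of_tup (t : R * R * R * R) := Quat t.1.1.1 t.1.1.2 t.1.2 t.2.
Let tup_of_quatK : cancel tup_of_quat quat_of_tup.
Proof. by case. Qed.

HB.instance Definition _ := Choice.copy H (can_type tup_of_quatK).

Definition addq p q :=
  Quat (qre p + qre q) (qim_i p + qim_i q) (qim_j p + qim_j q)
       (qim_k p + qim_k q).
Definition oppq p := Quat (- qre p) (- qim_i p) (- qim_j p) (- qim_k p).

Let addqA : associative addq.
Proof. by move=> p q r; apply/quatP; split=> /=; ring. Qed.
Let addqC : commutative addq.
Proof. by move=> p q; apply/quatP; split=> /=; ring. Qed.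
Let add0q : left_id (Quat 0 0 0 0) addq.
Proof. by move=> p; apply/quatP; split=> /=; ring. Qed.
Let addNq : left_inverse (Quat 0 0 0 0) oppq addq.
Proof. by move=> p; apply/quatP; split=> /=; ring. Qed.

HB.instance Definition _ := GRing.isZmodule.Build H addqA addqC add0q addNq.

Definition mulq p q :=
  let: Quat a b c d := p in let: Quat a' b' c' d' := q in
  Quat (a * a' - b * b' - c * c' - d * d')
       (a * b' + b * a' + c * d' - d * c')
       (a * c' - b * d' + c * a' + d * b')
       (a * d' + b * c' - c * b' + d * a').

Let mulqA : associative mulq.
Proof. by case=> ? ? ? ? [? ? ? ?] [? ? ? ?]; apply/quatP; split=> /=; ring. Qed.
Let mul1q : left_id (Quat 1 0 0 0) mulq.
Proof. by case=> ? ? ? ?; apply/quatP; split=> /=; ring. Qed.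
Let mulq1 : right_id (Quat 1 0 0 0) mulq.
Proof. by case=> ? ? ? ?; apply/quatP; split=> /=; ring. Qed.
Let mulqDl : left_distributive mulq +%R.
Proof. by case=> ? ? ? ? [? ? ? ?] [? ? ? ?]; apply/quatP; split=> /=; ring. Qed.
Let mulqDr : right_distributive mulq +%R.
Proof. by case=> ? ? ? ? [? ? ? ?] [? ? ? ?]; apply/quatP; split=> /=; ring. Qed.
Let oneq_neq0 : Quat 1 0 0 0 != 0 :> H.
Proof. by apply/eqP => /quatP[/= /eqP]; rewrite oner_eq0. Qed.

HB.instance Definition _ :=
  GRing.Zmodule_isNzRing.Build H mulqA mul1q mulq1 mulqDl mulqDr oneq_neq0.

Definition scaleq (x : R) q :=
  Quat (x * qre q) (x * qim_i q) (x * qim_j q) (x * qim_k q).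

Let scaleqA x y q : scaleq x (scaleq y q) = scaleq (x * y) q.
Proof. by apply/quatP; split=> /=; ring. Qed.
Let scale1q : left_id 1 scaleq.
Proof. by move=> q; apply/quatP; split=> /=; ring. Qed.
Let scaleqDr : right_distributive scaleq +%R.
Proof. by move=> x p q; apply/quatP; split=> /=; ring. Qed.
Let scaleqDl q : {morph scaleq^~ q : x y / x + y}.
Proof. by move=> x y; apply/quatP; split=> /=; ring. Qed.

HB.instance Definition _ :=
  GRing.Zmodule_isLmodule.Build R H scaleqA scale1q scaleqDr scaleqDl.

Definition conjq q := Quat (qre q) (- qim_i q) (- qim_j q) (- qim_k q).

Definition modq q : R :=
  Num.sqrt (qre q ^+ 2 + qim_i q ^+ 2 + qim_j q ^+ 2 + qim_k q ^+ 2).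

Definition unit_j : H := Quat 0 0 1 0.

Definition exp_i (x : R) : H := Quat (cos x) (sin x) 0 0.
Definition exp_j (x : R) : H := Quat (cos x) 0 (sin x) 0.

End QuatStructure.

(* R^d is the type of column vectors, with the product of the Borel
   sigma-algebras of the coordinates. *)
Definition cV_display (R : realType) (d : nat) : measure_display.
Proof. exact. Qed.

Section MeasurableColumn.
Context {R : realType} {d : nat}.

Let coord (i : 'I_d) (x : 'cV[R]_d) : measurableTypeR R := x i 0.

Let cV_set0 : g_sigma_preimage coord set0.
Proof. exact: sigma_algebra0. Qed.
Let cV_setC A : g_sigma_preimage coord A -> g_sigma_preimage coord (~` A).
Proof. exact: sigma_algebraC. Qed.
Let cV_bigcup (F : (set 'cV[R]_d)^nat) :
  (forall i, g_sigma_preimage coord (F i)) ->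
  g_sigma_preimage coord (\bigcup_i (F i)).
Proof. exact: sigma_algebra_bigcup. Qed.

HB.instance Definition _ := @isMeasurable.Build (cV_display R d)
  'cV[R]_d (g_sigma_preimage coord) cV_set0 cV_setC cV_bigcup.

End MeasurableColumn.


(* The library's canonical instance for this fact is shadowed by the one for
   products of subprobabilities, so it is not inferred. *)
Lemma sigma_finite_product d1 d2 (T1 : measurableType d1)
    (T2 : measurableType d2) (R : realType)
    (m1 : {sigma_finite_measure set T1 -> \bar R})
    (m2 : {sigma_finite_measure set T2 -> \bar R}) :
  sigma_finite setT (m1 \x m2)%E.
Proof.
have /sigma_finiteP[F [TF ndF Foo]] := sigma_finiteT m1.
have /sigma_finiteP[G [TG ndG Goo]] := sigma_finiteT m2.
exists (fun n => F n `*` G n).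
  rewrite -setXTT TF TG predeqE => -[x y]; split.
    move=> [/= [n _ Fnx] [k _ Gky]]; exists (maxn n k) => //; split.
    - by move: x Fnx; exact/subsetPset/ndF/leq_maxl.
    - by move: y Gky; exact/subsetPset/ndG/leq_maxr.
  by move=> [n _ []/= ? ?]; split; exists n.
move=> k; have [? ?] := Foo k; have [? ?] := Goo k.
split; first exact: measurableX.
by rewrite product_measure1E// lte_mul_pinfty// ge0_fin_numE.
Qed.

Section LebesgueMeasure.
Context {R : realType}.

Definition cons_cV (d : nat) (p : measurableTypeR R * 'cV[R]_d) : 'cV[R]_d.+1 :=
  col_mx (const_mx p.1 : 'cV[R]_1) p.2.

Lemma measurable_coord_cV d (i : 'I_d) :
  measurable_fun [set: 'cV[R]_d] (fun x => x i 0 : measurableTypeR R).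
Proof.
move=> _ Y mY; rewrite setTI; apply: sub_sigma_algebra => /=.
rewrite -bigcup_seq/=; exists i => /=; first by rewrite mem_index_enum.
by exists Y => //; rewrite setTI.
Qed.

Lemma measurable_cVP d' (T : measurableType d') d (f : T -> 'cV[R]_d) :
  (forall i, measurable_fun [set: T] (fun t => f t i 0 : measurableTypeR R)) ->
  measurable_fun [set: T] f.
Proof.
move=> mf _ Y mY; rewrite setTI.
suff: g_sigma_preimage (fun i t => f t i 0 : measurableTypeR R) `<=` measurable.
  apply; rewrite (g_sigma_preimage_comp (fun i (x : 'cV[R]_d) =>
    x i 0 : measurableTypeR R) f).
  by exists Y => //; rewrite setTI.
apply: smallest_sub; first exact: sigma_algebra_measurable.
rewrite -bigcup_seq; apply: bigcup_sub => i _ A [B mB <-].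
exact: mf.
Qed.

Lemma measurable_cons_cV d : measurable_fun setT (@cons_cV d).
Proof.
apply: measurable_cVP => i.
case: (split_ordP (i : 'I_(1 + d))) => j ->.
  rewrite [X in measurable_fun _ X](_ : _ = fst)//.
  by apply/funext => p; rewrite /cons_cV (col_mxEu (const_mx p.1 : 'cV_1)) mxE.
rewrite [X in measurable_fun _ X](_ : _ =
    (fun x : 'cV[R]_d => x j 0 : measurableTypeR R) \o snd).
  exact: (measurableT_comp (measurable_coord_cV j) measurable_snd).
by apply/funext => p; rewrite /cons_cV (col_mxEd (const_mx p.1 : 'cV_1)).
Qed.

Definition uncons_cV (d : nat) (x : 'cV[R]_d.+1) : measurableTypeR R * 'cV[R]_d :=
  ((usubmx (x : 'cV[R]_(1 + d))) 0 0, dsubmx (x : 'cV[R]_(1 + d))).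

Lemma cons_cVK d : cancel (@cons_cV d) (@uncons_cV d).
Proof.
by case=> a x; rewrite /uncons_cV /cons_cV col_mxKu col_mxKd mxE.
Qed.

Lemma measurable_uncons_cV d : measurable_fun setT (@uncons_cV d).
Proof.
apply/measurable_fun_pairP; split => /=.
  rewrite [X in measurable_fun _ X](_ : _ =
      (fun x : 'cV[R]_d.+1 => x (lshift d (0 : 'I_1)) 0)).
    exact: (measurable_coord_cV (lshift d (0 : 'I_1) : 'I_d.+1)).
  by apply/funext => x /=; rewrite !mxE.
apply: measurable_cVP => i.
rewrite [X in measurable_fun _ X](_ : _ =
    (fun x : 'cV[R]_d.+1 => x (rshift 1 i) 0)).
  exact: (measurable_coord_cV (rshift 1 i : 'I_d.+1)).
by apply/funext => x /=; rewrite !mxE.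
Qed.

Section OneMoreCoordinate.
Context (d : nat) (m : {sigma_finite_measure set 'cV[R]_d -> \bar R}).

Definition cons_measure : set 'cV[R]_d.+1 -> \bar R :=
  pushforward (lebesgue_measure \x m)%E (@cons_cV d).

Let cons_measure0 : cons_measure set0 = 0%E.
Proof. by rewrite /cons_measure /pushforward preimage_set0 measure0. Qed.

Let cons_measure_ge0 A : (0 <= cons_measure A)%E.
Proof. by rewrite /cons_measure /pushforward; exact: measure_ge0. Qed.

Let cons_measure_sigma_additive : semi_sigma_additive cons_measure.
Proof.
move=> F mF tF mUF; rewrite /cons_measure /pushforward preimage_bigcup.
apply: measure_semi_sigma_additive.
- by move=> n; rewrite -[X in measurable X]setTI; exact: measurable_cons_cV.
- apply/trivIsetP => /= i j _ _ ij; rewrite -preimage_setI.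
  by move/trivIsetP : tF => /(_ _ _ _ _ ij) ->//; rewrite preimage_set0.
- rewrite -preimage_bigcup -[X in measurable X]setTI.
  exact: measurable_cons_cV.
Qed.

HB.instance Definition _ := isMeasure.Build _ _ _ cons_measure
  cons_measure0 cons_measure_ge0 cons_measure_sigma_additive.

Let cons_measure_sigma_finite : sigma_finite setT cons_measure.
Proof.
have [F FT Foo] := sigma_finite_product lebesgue_measure m.
exists (fun k => @uncons_cV d @^-1` F k).
  by rewrite -preimage_bigcup -FT preimage_setT.
move=> k; have [mF Fk] := Foo k; split.
  by rewrite -[X in measurable X]setTI; exact: measurable_uncons_cV.
rewrite /cons_measure /pushforward -comp_preimage.
rewrite (_ : @uncons_cV d \o @cons_cV d = id)//.
by apply/funext => p; exact: cons_cVK.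
Qed.

HB.instance Definition _ := Measure_isSigmaFinite.Build _ _ _ cons_measure
  cons_measure_sigma_finite.

End OneMoreCoordinate.

Fixpoint lebesgue_cV (d : nat) : {sigma_finite_measure set 'cV[R]_d -> \bar R} :=
  if d is d'.+1 then cons_measure (lebesgue_cV d') else \d_(0 : 'cV[R]_0).

End LebesgueMeasure.

Section QuaternionL2.
Context {R : realType} d (T : measurableType d).
Variables (mu : {measure set T -> \bar R}) (D : set T).
Implicit Types f g : T -> quat R.

Definition measurable_quat f :=
  [/\ measurable_fun D (fun x => qre (f x)), measurable_fun D (fun x => qim_i (f x)),
      measurable_fun D (fun x => qim_j (f x)) & measurable_fun D (fun x => qim_k (f x))].

Definition integral_quat f : quat R :=
  Quat (\int[mu]_(x in D) qre (f x)) (\int[mu]_(x in D) qim_i (f x))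
       (\int[mu]_(x in D) qim_j (f x)) (\int[mu]_(x in D) qim_k (f x)).

Definition L1_quat f :=
  measurable_quat f /\ (\int[mu]_(x in D) (modq (f x))%:E < +oo)%E.

Definition L2norm f : \bar R :=
  sqrte (\int[mu]_(x in D) (modq (f x) ^+ 2)%:E)%E.

Definition L2_quat f := measurable_quat f /\ (L2norm f < +oo)%E.

Definition L2_converges (f_ : nat -> T -> quat R) f :=
  L2norm (fun x => f_ k x - f x) @[k --> \oo] --> 0%E.

Definition L2_cauchy (f_ : nat -> T -> quat R) :=
  forall e : R, 0 < e -> exists N, forall k l, (N <= k)%N -> (N <= l)%N ->
    (L2norm (fun x => f_ k x - f_ l x)%R < e%:E)%E.

Definition inner_quat f g : quat R := integral_quat (fun x => f x * conjq (g x)).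

(* Scalars act on the left: inner_quat is left linear in its first argument.
   Elements of V are total functions on T, but only their restrictions to D
   matter. *)
Definition is_rkhs (V : set (T -> quat R)) (K : T -> T -> quat R) :=
  [/\ [/\ V `<=` L2_quat, V (fun=> 0),
          (forall F G, V F -> V G -> V (fun p => F p + G p)) &
          (forall q F, V F -> V (fun p => q * F p))],
      (forall F_ : nat -> T -> quat R, (forall k, V (F_ k)) -> L2_cauchy F_ ->
         exists2 F, V F & L2_converges F_ F),
      (forall p, D p -> V (K p)) &
      (forall F, V F -> forall p, D p -> F p = inner_quat F (K p))].

End QuaternionL2.

Section FourierTransform.
Context {R : realType} (n : nat).
Implicit Types (f g : 'cV[R]_(n + n) -> quat R) (w : 'cV[R]_(n + n)).
Local Notation leb := (lebesgue_cV (n + n)).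

Definition dotv (d : nat) (u v : 'cV[R]_d) : R := \sum_i u i 0 * v i 0.

Definition wave_i (u x : 'cV[R]_n) : quat R := exp_i (- (2 * pi * dotv u x)).
Definition wave_j (v y : 'cV[R]_n) : quat R := exp_j (- (2 * pi * dotv v y)).

(* A point (u, v) of R^n x R^n is the column w with usubmx w = u and
   dsubmx w = v. *)
Definition qft_int f w : quat R :=
  integral_quat leb setT (fun z =>
    wave_i (usubmx w) (usubmx z) * f z * wave_j (dsubmx w) (dsubmx z)).

(* Graph of the continuous extension of qft_int from the intersection of L^1
   and L^2 to L^2. *)
Definition is_qft f g :=
  L2_quat leb setT g /\
  exists f_ : nat -> 'cV[R]_(n + n) -> quat R,
    [/\ forall k, L1_quat leb setT (f_ k) /\ L2_quat leb setT (f_ k),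
        L2_converges leb setT f_ f &
        L2_converges leb setT (fun k => qft_int (f_ k)) g].

(* The transform of f in L^2 is a class modulo equality almost everywhere; qft f
   is a representative of it. *)
Definition qft f : 'cV[R]_(n + n) -> quat R := xget (fun=> 0) (is_qft f).

End FourierTransform.

(* Shearlets on R^{2N} for N = n.+1 >= 1; the dimension N + N is convertible to
   1 + (n + n.+1), which gives the block decompositions below, and n + n.+1 is
   2N - 1. *)
Section Shearlets.
Context {R : realType} (n : nat).
Local Notation dim := (n.+1 + n.+1)%N.
Local Notation leb := (lebesgue_cV dim).
Implicit Types (a : R) (s : 'cV[R]_(n + n.+1)) (t x : 'cV[R]_dim).
Implicit Types psi f : 'cV[R]_dim -> quat R.

Definition dilation a : 'M[R]_dim :=
  block_mx (a%:M : 'M[R]_1) 0 0 (Num.sg a * `|a| `^ (dim%:R^-1))%:M.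

Definition shear s : 'M[R]_dim := block_mx (1%:M : 'M[R]_1) s^T 0 1%:M.

(* Parameters (a, s, t); only those in shear_domain, where a <> 0, are
   meaningful. *)
Local Notation params := (measurableTypeR R * 'cV[R]_(n + n.+1) * 'cV[R]_dim)%type.

Definition shear_domain : set params := [set p | p.1.1 != 0].

Let base_measure : {measure set params -> \bar R} :=
  ((lebesgue_measure \x lebesgue_cV (n + n.+1)) \x leb)%E.

(* The set a = 0, where the density is 0 by convention, is negligible. *)
Definition shear_measure (A : set params) : \bar R :=
  (\int[base_measure]_(p in A) (`|p.1.1 : R| ^- dim.+1)%:E)%E.

Let shear_measure0 : shear_measure set0 = 0%E.
Proof. by rewrite /shear_measure integral_set0. Qed.

Let shear_measure_ge0 A : (0 <= shear_measure A)%E.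
Proof. by apply: integral_ge0 => p _; rewrite lee_fin invr_ge0 exprn_ge0. Qed.

Let shear_measure_sigma_additive : semi_sigma_additive shear_measure.
Proof.
apply: semi_sigma_additive_nng_induced; last first.
  by move=> p; rewrite lee_fin invr_ge0 exprn_ge0.
apply/measurable_EFinP.
rewrite (_ : (fun p : params => _) =
    (fun x : R => `|x| `^ (- dim.+1%:R)) \o (fst \o fst)); last first.
  by apply/funext => p /=; rewrite powRN powR_mulrn.
apply: measurableT_comp; last exact: measurableT_comp.
by apply: (measurableT_comp (measurable_powR _)); exact: normr_measurable.
Qed.

HB.instance Definition _ := isMeasure.Build _ _ _ shear_measure
  shear_measure0 shear_measure_ge0 shear_measure_sigma_additive.

Definition shearlet_at psi (p : params) x : quat R :=
  let: (a, s, t) := p in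
  `|a| `^ ((4 * n.+1)%:R^-1 - 1) *:
    psi (invmx (dilation a) *m (invmx (shear s) *m (x - t))).

Definition involution psi x : quat R := conjq (psi (- x)).

Definition coord1 (w : 'cV[R]_dim) : R := w (lshift n.+1 ord0) 0.

(* On the negligible set where the first coordinate is 0 the integrand is 0 by
   convention. *)
Definition admissibility_integral psi : \bar R :=
  (\int[leb]_w (modq (qft (involution psi) w) ^+ 2 / `|coord1 w| ^+ dim)%:E)%E.

Definition admissible psi :=
  L2_quat leb setT psi /\ (admissibility_integral psi < +oo)%E.

Definition admissibility_const psi : R := fine (admissibility_integral psi).

Definition shearlet_transform psi f (p : params) : quat R :=
  inner_quat leb setT f (shearlet_at psi p).

Definition shearlet_range psi : set (params -> quat R) :=
  [set F | exists2 f, L2_quat leb setT f &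
             forall p, shear_domain p -> F p = shearlet_transform psi f p].

Definition shearlet_kernel psi (p q : params) : quat R :=
  (admissibility_const psi)^-1 *:
    inner_quat leb setT (shearlet_at psi p) (shearlet_at psi q).

End Shearlets.

Arguments shear_measure R n A : clear implicits.
Arguments shear_domain R n p : clear implicits.

(* Main.v *)
Require Import Defs.
From HB Require Import structures.
From mathcomp Require Import all_boot all_order all_algebra ring lra.
From mathcomp Require Import all_classical all_reals all_analysis.
From mathcomp Require Import measurable_realfun.

Set Implicit Arguments.
Unset Strict Implicit.
Unset Printing Implicit Defensive.
Import Order.TTheory GRing.Theory Num.Theory.
Import numFieldNormedType.Exports.
Local Open Scope classical_set_scope.
Local Open Scope ring_scope.

(** The transform [f |-> SH f] is, up to the factor [sqrt C], an isometry from
    the square-integrable functions on R^2N to those of the measure [da ds dt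
    / |a|^(2N+1)]. Everything follows from this: the range is complete because
    it is the image of a complete space ([L2_complete], [shearlet_isometry]),
    and polarization ([polarization]) gives [<SH f, SH h> = C <f, h>], which
    for [h = psi_p / C] is the reproducing formula, since [SH f p = <f,
    psi_p>] and the kernel at [p] is [SH h]. The bound on the kernel is the
    Cauchy-Schwarz inequality, all shearlets having the norm of [psi]. The
    constant [C] is not 0 because [psi] is not negligible
    ([admissibility_const_gt0]).

    The isometry is classical once a Fourier transform [F] is available that
    is linear for multiplication by quaternions on the left, satisfies
    Parseval's identity for the quaternion-valued inner product, and turns
    translations into waves that commute with the transform of [psi]. With [M]
    the matrix of [(a, s)] and [g = F psi], Parseval's identity then reads [SH
    f (a, s, t) = K * int (F f) (w) conj (g (M^T w)) e_j (2 pi w.t) dw], which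
    is a Fourier transform in [t] ([sht_fourier]). By Plancherel's identity
    the integral over [t] of its squared modulus is the integral over [w] of
    [K^2 nq (F f w) nq (g (M^T w))], and for a fixed frequency [w] outside a
    hyperplane, integrating over [a] and [s] gives the constant [C] after two
    substitutions ([integral_orbit], [sht_isometry]).

    The two-sided transform does not have these properties, but the one with
    all exponentials on the right has them ([parseval], [is_FT_affine]). The
    hypotheses on [psi] make the two interchangeable for [psi]: the transform
    of [psi] takes its values in the complex line of [1] and [j] and is even
    in the first half of the variables ([commuting_transform]). The projection
    onto the functions of this kind commutes with the two-sided transform
    ([qF_evenj]), hence [psi] is a limit of integrable functions of this kind,
    on which both transforms agree ([qF_even]).

    Both transforms are instances of one, [qF I], whose left exponentials
    carry the coordinates in [I]. Its Plancherel identity ([plancherel]) is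
    proved directly on integrable and square-integrable functions: damping [nq
    (qF I f)] by [exp (- 2 pi e |w_1| - ... - 2 pi e |w_d|)] and integrating
    produces the Poisson kernel, and the result is the square norm of [f]
    minus half the mean square variation of [f] at scale [e]
    ([integral_damp_nq_qF]). That variation tends to 0 with [e]
    ([shift_continuous_sqint]): this holds for the indicators of intersections
    of open cubes with open half-spaces, the sets for which it holds form a
    sigma-algebra, and linear combinations are dense. *)

(** * Quaternion algebra *)

Section QuaternionAlgebra.
Context {R : realType}.
Implicit Types p q c : quat R.

(** The squared modulus; being polynomial in the components, it lets [ring]
    prove what would need square roots for [modq]. *)
Definition nq q : R := qre q ^+ 2 + qim_i q ^+ 2 + qim_j q ^+ 2 + qim_k q ^+ 2.

Lemma nq_ge0 q : 0 <= nq q.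
Proof. by rewrite /nq !addr_ge0 ?sqr_ge0. Qed.

Lemma modq_ge0 q : 0 <= modq q. Proof. exact: sqrtr_ge0. Qed.

Lemma modq_sqr q : modq q ^+ 2 = nq q.
Proof. by rewrite sqr_sqrtr// nq_ge0. Qed.

Lemma mulqE p q : p * q =
  Quat (qre p * qre q - qim_i p * qim_i q - qim_j p * qim_j q - qim_k p * qim_k q)
       (qre p * qim_i q + qim_i p * qre q + qim_j p * qim_k q - qim_k p * qim_j q)
       (qre p * qim_j q - qim_i p * qim_k q + qim_j p * qre q + qim_k p * qim_i q)
       (qre p * qim_k q + qim_i p * qim_j q - qim_j p * qim_i q + qim_k p * qre q).
Proof. by case: p; case: q. Qed.

Lemma qreMC p q : qre (p * q) = qre (q * p).
Proof. by rewrite !mulqE /=; ring. Qed.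

Lemma qre_conj q : qre (conjq q) = qre q. Proof. by []. Qed.

Lemma qreD p q : qre (p + q) = qre p + qre q. Proof. by []. Qed.
Lemma qreN q : qre (- q) = - qre q. Proof. by []. Qed.

Lemma qreZ (x : R) q : qre (x *: q) = x * qre q. Proof. by []. Qed.

Lemma scaleqAl (x : R) p q : x *: p * q = x *: (p * q).
Proof. by rewrite !mulqE; apply/quatP; split=> /=; ring. Qed.

Lemma scaleqAr (x : R) p q : p * (x *: q) = x *: (p * q).
Proof. by rewrite !mulqE; apply/quatP; split=> /=; ring. Qed.

(** Testing against real parts of products turns every identity between
    quaternion integrals into one between real integrals. *)
Lemma quat_ext p q : (forall c, qre (p * c) = qre (q * c)) -> p = q.
Proof.
move=> h; apply/quatP; split.
- by have := h 1; rewrite !mulr1.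
- by have := h (Quat 0 (-1) 0 0); rewrite !mulqE /= => h'; lra.
- by have := h (Quat 0 0 (-1) 0); rewrite !mulqE /= => h'; lra.
- by have := h (Quat 0 0 0 (-1)); rewrite !mulqE /= => h'; lra.
Qed.

Lemma qre_mulE p c : qre (p * c) =
  qre p * qre c - qim_i p * qim_i c - qim_j p * qim_j c - qim_k p * qim_k c.
Proof. by rewrite mulqE. Qed.

Lemma conjqM p q : conjq (p * q) = conjq q * conjq p.
Proof. by rewrite !mulqE; apply/quatP; split=> /=; ring. Qed.
Lemma conjqD p q : conjq (p + q) = conjq p + conjq q.
Proof. by apply/quatP; split=> /=; ring. Qed.
Lemma conjqN p : conjq (- p) = - conjq p.
Proof. by apply/quatP; split=> /=; ring. Qed.
Lemma conjqB p q : conjq (p - q) = conjq p - conjq q.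
Proof. by rewrite conjqD conjqN. Qed.
Lemma conjqK : involutive (@conjq R).
Proof. by move=> q; apply/quatP; split=> /=; ring. Qed.
Lemma conjqZ (x : R) q : conjq (x *: q) = x *: conjq q.
Proof. by apply/quatP; split=> /=; ring. Qed.

Lemma nqM p q : nq (p * q) = nq p * nq q.
Proof. by rewrite !mulqE /nq /=; ring. Qed.
Lemma nq_conj q : nq (conjq q) = nq q.
Proof. by rewrite /nq /=; ring. Qed.
Lemma nqN q : nq (- q) = nq q.
Proof. by rewrite /nq /=; ring. Qed.
Lemma nqZ (x : R) q : nq (x *: q) = x ^+ 2 * nq q.
Proof. by rewrite /nq /=; ring. Qed.
Lemma nq0 : nq (0 : quat R) = 0.
Proof. by rewrite /nq /= !expr0n /= !addr0. Qed.
Lemma nqD p q : nq (p + q) = nq p + nq q + 2 * qre (p * conjq q).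
Proof. by rewrite /nq !mulqE /=; ring. Qed.
Lemma qre_mul_conj q : qre (q * conjq q) = nq q.
Proof. by rewrite /nq !mulqE /=; ring. Qed.
Lemma nqB p q : nq (p - q) = nq (q - p).
Proof. by rewrite -nqN opprB. Qed.
Lemma nqD_le p q : nq (p + q) <= 2 * (nq p + nq q).
Proof.
have := nq_ge0 (p - q); rewrite !nqD !nqN conjqN mulrN qreN.
by move=> h; lra.
Qed.
Lemma nq_eq0 q : nq q = 0 -> q = 0.
Proof.
rewrite /nq => h; apply/quatP; split=> /=; apply/eqP; rewrite -sqrf_eq0;
  apply/eqP; have h1 := sqr_ge0 (qre q); have h2 := sqr_ge0 (qim_i q);
  have h3 := sqr_ge0 (qim_j q); have h4 := sqr_ge0 (qim_k q); lra.
Qed.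

Lemma modqM p q : modq (p * q) = modq p * modq q.
Proof. by rewrite /modq -/(nq p) -/(nq q) -/(nq _) nqM sqrtrM// nq_ge0. Qed.
Lemma modq_conj q : modq (conjq q) = modq q.
Proof. by rewrite /modq -!/(nq _) nq_conj. Qed.
Lemma modqZ (x : R) q : modq (x *: q) = `|x| * modq q.
Proof. by rewrite /modq -!/(nq _) nqZ sqrtrM ?sqr_ge0// sqrtr_sqr. Qed.
Lemma qre_le_modq q : `|qre q| <= modq q.
Proof.
rewrite -(ler_pXn2r (n := 2)) ?nnegrE ?modq_ge0// modq_sqr real_normK ?num_real//.
by rewrite /nq -!addrA lerDl !addr_ge0 ?sqr_ge0.
Qed.
Lemma qreM_le p c : `|qre (p * c)| <= modq p * modq c.
Proof. by rewrite -modqM qre_le_modq. Qed.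

Lemma modq_le_abs q :
  modq q <= `|qre q| + `|qim_i q| + `|qim_j q| + `|qim_k q|.
Proof.
rewrite -(ler_pXn2r (n := 2)) ?nnegrE ?addr_ge0 ?modq_ge0// modq_sqr /nq.
rewrite -(real_normK (num_real (qre q))) -(real_normK (num_real (qim_i q))).
rewrite -(real_normK (num_real (qim_j q))) -(real_normK (num_real (qim_k q))).
have := normr_ge0 (qre q); have := normr_ge0 (qim_i q).
have := normr_ge0 (qim_j q); have := normr_ge0 (qim_k q).
by nra.
Qed.

Lemma nq_exp_i (x : R) : nq (exp_i x) = 1.
Proof. by rewrite /nq /= expr0n /= !addr0 cos2Dsin2. Qed.
Lemma nq_exp_j (x : R) : nq (exp_j x) = 1.
Proof. by rewrite /nq /= expr0n /= !addr0 cos2Dsin2. Qed.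
Lemma modq_exp_i (x : R) : modq (exp_i x) = 1.
Proof. by rewrite /modq -/(nq _) nq_exp_i sqrtr1. Qed.
Lemma modq_exp_j (x : R) : modq (exp_j x) = 1.
Proof. by rewrite /modq -/(nq _) nq_exp_j sqrtr1. Qed.
Lemma exp_iD (x y : R) : exp_i (x + y) = exp_i x * exp_i y.
Proof. by rewrite mulqE /exp_i /= cosD sinD; apply/quatP; split=> /=; ring. Qed.
Lemma exp_jD (x y : R) : exp_j (x + y) = exp_j x * exp_j y.
Proof. by rewrite mulqE /exp_j /= cosD sinD; apply/quatP; split=> /=; ring. Qed.
Lemma conj_exp_i (x : R) : conjq (exp_i x) = exp_i (- x).
Proof. by rewrite /conjq /exp_i /= cosN sinN oppr0. Qed.
Lemma conj_exp_j (x : R) : conjq (exp_j x) = exp_j (- x).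
Proof. by rewrite /conjq /exp_j /= cosN sinN oppr0. Qed.
Lemma exp_i0 : exp_i (0 : R) = 1. Proof. by rewrite /exp_i cos0 sin0. Qed.
Lemma exp_j0 : exp_j (0 : R) = 1. Proof. by rewrite /exp_j cos0 sin0. Qed.

End QuaternionAlgebra.

(** * Integration of quaternion-valued functions *)

Section QuaternionMeasurability.
Context {R : realType} d (T : measurableType d) (D : set T).
Implicit Types f g : T -> quat R.

Lemma measurable_quatP f : measurable_quat D f <->
  forall c, measurable_fun D (fun x => qre (f x * c)).
Proof.
split=> [[m0 m1 m2 m3] c|h].
  under eq_fun do rewrite qre_mulE.
  by do 3 (apply: measurable_funB; last exact: measurable_funM); exact: measurable_funM.
split.
- by have := h 1; under eq_fun do rewrite mulr1.
- have := h (Quat 0 (-1) 0 0); apply: eq_measurable_fun => x _.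
  by rewrite qre_mulE /=; ring.
- have := h (Quat 0 0 (-1) 0); apply: eq_measurable_fun => x _.
  by rewrite qre_mulE /=; ring.
- have := h (Quat 0 0 0 (-1)); apply: eq_measurable_fun => x _.
  by rewrite qre_mulE /=; ring.
Qed.

Lemma measurable_quat_cst (c : quat R) : measurable_quat D (fun=> c).
Proof. by split. Qed.

Lemma measurable_quatD f g : measurable_quat D f -> measurable_quat D g ->
  measurable_quat D (fun x => f x + g x).
Proof. by move=> [? ? ? ?] [? ? ? ?]; split=> /=; exact: measurable_funD. Qed.

Lemma measurable_quatM f g : measurable_quat D f -> measurable_quat D g ->
  measurable_quat D (fun x => f x * g x).
Proof.
move=> [f0 f1 f2 f3] [g0 g1 g2 g3].
split; (under eq_fun do rewrite mulqE /=);
  repeat first [exact: measurable_funM|apply: measurable_funB|apply: measurable_funD].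
Qed.

Lemma measurable_quatN f : measurable_quat D f ->
  measurable_quat D (fun x => - f x).
Proof. by move=> [? ? ? ?]; split=> /=; exact: measurableT_comp. Qed.

Lemma measurable_quatB f g : measurable_quat D f -> measurable_quat D g ->
  measurable_quat D (fun x => f x - g x).
Proof. by move=> mf mg; apply: measurable_quatD => //; exact: measurable_quatN. Qed.

Lemma measurable_quatZ (r : T -> R) f : measurable_fun D r -> measurable_quat D f ->
  measurable_quat D (fun x => r x *: f x).
Proof. by move=> mr [? ? ? ?]; split=> /=; exact: measurable_funM. Qed.

Lemma measurable_quat_conj f : measurable_quat D f ->
  measurable_quat D (fun x => conjq (f x)).
Proof. by move=> [? ? ? ?]; split=> //=; exact: measurableT_comp. Qed.

Lemma measurable_exp_i (r : T -> R) : measurable_fun D r ->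
  measurable_quat D (fun x => exp_i (r x)).
Proof.
move=> mr; split=> //=.
- by apply: measurableT_comp => //; apply: continuous_measurable_fun; exact: continuous_cos.
- by apply: measurableT_comp => //; apply: continuous_measurable_fun; exact: continuous_sin.
Qed.

Lemma measurable_exp_j (r : T -> R) : measurable_fun D r ->
  measurable_quat D (fun x => exp_j (r x)).
Proof.
move=> mr; split=> //=.
- by apply: measurableT_comp => //; apply: continuous_measurable_fun; exact: continuous_cos.
- by apply: measurableT_comp => //; apply: continuous_measurable_fun; exact: continuous_sin.
Qed.

Lemma measurable_nq f : measurable_quat D f -> measurable_fun D (fun x => nq (f x)).
Proof.
move=> [f0 f1 f2 f3]; rewrite /nq.
by do 3 (apply: measurable_funD; last exact: measurable_funX); exact: measurable_funX.
Qed.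

Lemma measurable_modq f : measurable_quat D f -> measurable_fun D (fun x => modq (f x)).
Proof.
move=> mf; rewrite /modq; apply: measurableT_comp (measurable_nq mf).
by apply: continuous_measurable_fun; exact: sqrt_continuous.
Qed.

End QuaternionMeasurability.

Lemma measurable_quat_comp (R : realType) d1 d2 (T1 : measurableType d1)
    (T2 : measurableType d2) (D : set T1) (phi : T1 -> T2) (f : T2 -> quat R) :
  measurable_fun D phi -> measurable_quat setT f ->
  measurable_quat D (f \o phi).
Proof.
move=> mphi [f0 f1 f2 f3]; split.
- exact: (measurableT_comp f0).
- exact: (measurableT_comp f1).
- exact: (measurableT_comp f2).
- exact: (measurableT_comp f3).
Qed.

Section QuaternionIntegral.
Context {R : realType} d (T : measurableType d).
Variables (mu : {measure set T -> \bar R}) (D : set T) (mD : measurable D).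
Implicit Types f g : T -> quat R.
Local Notation int := (integral_quat mu D).

(** Integrability of the real part after every right multiplication: linearity
    and multiplication by constants are then inherited from real integrals
    without looking at components. *)
Definition iq f := forall c, mu.-integrable D (EFin \o (fun x => qre (f x * c))).

Lemma iq_measurable f : iq f -> measurable_quat D f.
Proof.
move=> h; apply/measurable_quatP => c.
by have /measurable_int/measurable_EFinP := h c.
Qed.

Lemma integrable_ge0P (g : T -> R) : measurable_fun D g ->
  (forall x, D x -> 0 <= g x) ->
  mu.-integrable D (EFin \o g) <-> (\int[mu]_(x in D) (g x)%:E < +oo)%E.
Proof.
move=> mg g0.
have eg : (\int[mu]_(x in D) `|(EFin \o g) x| = \int[mu]_(x in D) (g x)%:E)%E.
  by apply: eq_integral => x /[!inE] Dx /=; rewrite ger0_norm// g0.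
split=> [/integrableP[_]|h]; first by rewrite eg.
by apply/integrableP; rewrite eg; split => //; exact/measurable_EFinP.
Qed.

(** Links the test against all constants with absolute integrability: the four
    components are obtained from the constants [1], [-i], [-j], [-k]. *)
Lemma iqP f : iq f <-> measurable_quat D f /\
  (\int[mu]_(x in D) (modq (f x))%:E < +oo)%E.
Proof.
split=> [h|[mf h] c].
  have mf := iq_measurable h; split => //.
  have h4 c : mu.-integrable D (EFin \o (fun x => `|qre (f x * c)|)).
    by have /integrable_abse := h c; apply: eq_integrable.
  pose c1 := Quat 0 (-1) 0 (0:R); pose c2 := Quat 0 0 (-1) (0:R).
  pose c3 := Quat 0 0 0 (-1:R).
  have h5 := integrableD mD (integrableD mD (h4 1) (h4 c1)) (integrableD mD (h4 c2) (h4 c3)).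
  apply/(integrable_ge0P (measurable_modq mf) (fun x _ => modq_ge0 _)).
  apply: (le_integrable mD _ _ h5).
    by apply/measurable_EFinP; exact: measurable_modq.
  move=> x _ /=; rewrite lee_fin (ger0_norm (modq_ge0 _)).
  rewrite [leRHS]ger0_norm; last by rewrite !addr_ge0.
  apply: (le_trans (modq_le_abs _)).
  rewrite mulr1 !qre_mulE /= !mulr0 !subr0 !sub0r !mulrN1 !opprK.
  by rewrite ?subr0 ?add0r ?oppr0 ?add0r !addrA.
have mfc : measurable_fun D (fun x => qre (f x * c)).
  by move: c; apply/measurable_quatP.
have hm : mu.-integrable D (EFin \o (fun x => modq (f x))).
  exact/(integrable_ge0P (measurable_modq mf) (fun x _ => modq_ge0 _)).
apply: (le_integrable mD _ _ (integrableZl mD (modq c) hm)).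
  by apply/measurable_EFinP.
move=> x _ /=; rewrite lee_fin !normrM !(ger0_norm (modq_ge0 _)).
rewrite mulrC.
exact: qreM_le.
Qed.

Lemma iq_modq f : iq f -> mu.-integrable D (EFin \o (fun x => modq (f x))).
Proof.
move=> /iqP[mf h].
exact/(integrable_ge0P (measurable_modq mf) (fun x _ => modq_ge0 _)).
Qed.

Lemma le_iq f (g : T -> R) : measurable_quat D f ->
  mu.-integrable D (EFin \o g) -> (forall x, D x -> modq (f x) <= g x) -> iq f.
Proof.
move=> mf ig fg; apply/iqP; split => //.
apply/(integrable_ge0P (measurable_modq mf) (fun x _ => modq_ge0 _)).
apply: (le_integrable mD _ _ ig).
  by apply/measurable_EFinP; exact: measurable_modq.
move=> x Dx /=; rewrite lee_fin ger0_norm ?modq_ge0//.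
by rewrite (le_trans (fg _ Dx))// ler_norm.
Qed.

Lemma iqD f g : iq f -> iq g -> iq (fun x => f x + g x).
Proof.
move=> hf hg c; have := integrableD mD (hf c) (hg c).
by apply: eq_integrable => // x _ /=; rewrite mulrDl qreD EFinD.
Qed.

Lemma iqMl q f : iq f -> iq (fun x => q * f x).
Proof.
move=> hf c; have := hf (c * q).
by apply: eq_integrable => // x _ /=; rewrite -[in RHS]mulrA [in RHS]qreMC -!mulrA.
Qed.

Lemma iqMr q f : iq f -> iq (fun x => f x * q).
Proof.
move=> hf c; have := hf (q * c).
by apply: eq_integrable => // x _ /=; rewrite mulrA.
Qed.

Lemma iqN f : iq f -> iq (fun x => - f x).
Proof.
by move=> hf c; have := iqMl (-1) hf c; apply: eq_integrable => // x _ /=; rewrite mulN1r.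
Qed.

Lemma iqB f g : iq f -> iq g -> iq (fun x => f x - g x).
Proof. by move=> hf hg; apply: iqD => //; exact: iqN. Qed.

Lemma iq_conj f : iq f -> iq (fun x => conjq (f x)).
Proof.
move=> hf c; have := hf (conjq c); apply: eq_integrable => // x _ /=.
by rewrite -qre_conj conjqM conjqK qreMC.
Qed.

Lemma eq_integral_quat f g : {in D, f =1 g} -> int f = int g.
Proof.
by move=> fg; congr Quat; apply: eq_Rintegral => x xD; rewrite fg.
Qed.

Lemma qre_int f c : iq f -> qre (int f * c) = \int[mu]_(x in D) qre (f x * c).
Proof.
move=> h.
have i1 : mu.-integrable D (EFin \o (fun x => qre (f x))).
  by have := h 1; apply: eq_integrable => // x _ /=; rewrite mulr1.
have i2 : mu.-integrable D (EFin \o (fun x => qim_i (f x))).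
  have := h (Quat 0 (-1) 0 0); apply: eq_integrable => // x _ /=.
  by rewrite qre_mulE /=; congr EFin; ring.
have i3 : mu.-integrable D (EFin \o (fun x => qim_j (f x))).
  have := h (Quat 0 0 (-1) 0); apply: eq_integrable => // x _ /=.
  by rewrite qre_mulE /=; congr EFin; ring.
have i4 : mu.-integrable D (EFin \o (fun x => qim_k (f x))).
  have := h (Quat 0 0 0 (-1)); apply: eq_integrable => // x _ /=.
  by rewrite qre_mulE /=; congr EFin; ring.
have j1 k (u : T -> R) : mu.-integrable D (EFin \o u) ->
    mu.-integrable D (EFin \o (fun x => u x * k)).
  by move=> iu; have := integrableZr mD k iu; apply: eq_integrable.
under eq_Rintegral do rewrite qre_mulE.
rewrite !RintegralB ?RintegralZr//; do ?exact: j1.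
  by rewrite qre_mulE.
- by have := integrableB mD (j1 (qre c) _ i1) (j1 (qim_i c) _ i2); apply: eq_integrable.
- have := integrableB mD (integrableB mD (j1 (qre c) _ i1) (j1 (qim_i c) _ i2))
    (j1 (qim_j c) _ i3); exact: eq_integrable.
Qed.

Lemma integral_quatD f g : iq f -> iq g ->
  int (fun x => f x + g x) = int f + int g.
Proof.
move=> hf hg; apply: quat_ext => c; rewrite mulrDl qreD !qre_int//; last exact: iqD.
rewrite -RintegralD//.
by apply: eq_Rintegral => x _; rewrite mulrDl.
Qed.

Lemma integral_quatMl q f : iq f -> int (fun x => q * f x) = q * int f.
Proof.
move=> hf; apply: quat_ext => c.
rewrite qre_int; last exact: iqMl.
rewrite -mulrA qreMC -mulrA qre_int//.
by apply: eq_Rintegral => x _; rewrite -mulrA qreMC -mulrA.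
Qed.

Lemma integral_quatMr q f : iq f -> int (fun x => f x * q) = int f * q.
Proof.
move=> hf; apply: quat_ext => c.
rewrite qre_int; last exact: iqMr.
rewrite -mulrA qre_int//.
by apply: eq_Rintegral => x _; rewrite -mulrA.
Qed.

Lemma integral_quatN f : iq f -> int (fun x => - f x) = - int f.
Proof.
move=> hf; rewrite -[RHS]mulN1r -integral_quatMl//.
by apply: eq_integral_quat => x _; rewrite mulN1r.
Qed.

Lemma integral_quatB f g : iq f -> iq g ->
  int (fun x => f x - g x) = int f - int g.
Proof. by move=> hf hg; rewrite integral_quatD ?integral_quatN//; exact: iqN. Qed.

Lemma integral_quat_conj f : iq f -> int (fun x => conjq (f x)) = conjq (int f).
Proof.
move=> hf; apply: quat_ext => c; rewrite qre_int; last exact: iq_conj.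
rewrite -(conjqK c) -conjqM qre_conj qreMC qre_int//.
by apply: eq_Rintegral => x _; rewrite -conjqM qre_conj qreMC.
Qed.

Lemma integral_quatZ (r : R) f : iq f -> int (fun x => r *: f x) = r *: int f.
Proof.
move=> hf; rewrite -[int f]mul1r -scaleqAl -integral_quatMl//.
by apply: eq_integral_quat => x _; rewrite scaleqAl mul1r.
Qed.

End QuaternionIntegral.

(** * Square-integrable quaternion-valued functions *)

Section SquareIntegrable.
Context {R : realType} d (T : measurableType d).
Variables (mu : {measure set T -> \bar R}) (D : set T) (mD : measurable D).
Implicit Types f g h : T -> quat R.

(** The squared norm is kept extended here and made real by [sqN], so that
    finiteness is proved separately from identities. *)
Definition sqn f : \bar R := (\int[mu]_(x in D) (nq (f x))%:E)%E.
Definition sqint f := measurable_quat D f /\ (sqn f < +oo)%E.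
Definition sqN f : R := fine (sqn f).

Lemma sqn_ge0 f : (0 <= sqn f)%E.
Proof. by apply: integral_ge0 => x _; rewrite lee_fin nq_ge0. Qed.

Lemma sqN_ge0 f : 0 <= sqN f.
Proof. by rewrite fine_ge0// sqn_ge0. Qed.

Lemma sqnE f : sqint f -> sqn f = (sqN f)%:E.
Proof. by move=> [_ h]; rewrite /sqN fineK// ge0_fin_numE ?sqn_ge0. Qed.

Lemma L2normE f : L2norm mu D f = sqrte (sqn f).
Proof.
by rewrite /L2norm /sqn; congr sqrte; apply: eq_integral => x _; rewrite modq_sqr.
Qed.

Lemma L2_quatP f : L2_quat mu D f <-> sqint f.
Proof.
have h : (sqrte (sqn f) < +oo)%E <-> (sqn f < +oo)%E.
  rewrite -!ge0_fin_numE ?sqn_ge0 ?sqrte_ge0// sqrte_fin_num ?sqn_ge0//.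
by rewrite /L2_quat /sqint L2normE; split=> -[? ?]; split=> //; exact/h.
Qed.

Lemma L2norm_sqN f : sqint f -> L2norm mu D f = (Num.sqrt (sqN f))%:E.
Proof. by move=> h; rewrite L2normE sqnE. Qed.

Lemma eq_sqn f g : {in D, f =1 g} -> sqn f = sqn g.
Proof. by move=> fg; apply: eq_integral => x xD; rewrite fg. Qed.

Lemma eq_sqN f g : {in D, f =1 g} -> sqN f = sqN g.
Proof. by move=> /eq_sqn; rewrite /sqN => ->. Qed.

Lemma ae_eq_sqn f g : measurable_quat D f -> measurable_quat D g ->
  {ae mu, forall x, D x -> f x = g x} -> sqn f = sqn g.
Proof.
move=> mf mg fg; apply: ge0_ae_eq_integral => //.
- exact/measurable_EFinP/measurable_nq.
- exact/measurable_EFinP/measurable_nq.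
- by move=> x _; rewrite lee_fin nq_ge0.
- by move=> x _; rewrite lee_fin nq_ge0.
- by apply: filterS fg => x h Dx; rewrite h.
Qed.

Lemma sqint_integrable f : sqint f ->
  mu.-integrable D (EFin \o (fun x => nq (f x))).
Proof.
move=> [mf h].
exact/(integrable_ge0P mu (measurable_nq mf) (fun x _ => nq_ge0 _)).
Qed.

Lemma sqintP f : sqint f <-> measurable_quat D f /\
  mu.-integrable D (EFin \o (fun x => nq (f x))).
Proof.
split=> [h|[mf h]]; first by split; [case: h|exact: sqint_integrable].
split=> //.
by apply/(integrable_ge0P mu (measurable_nq mf) (fun x _ => nq_ge0 _)).
Qed.

Lemma le_sqint f (g : T -> R) : measurable_quat D f ->
  mu.-integrable D (EFin \o g) -> (forall x, D x -> nq (f x) <= g x) -> sqint f.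
Proof.
move=> mf ig fg; apply/sqintP; split => //; apply: le_integrable ig => //.
  exact/measurable_EFinP/measurable_nq.
move=> x Dx /=; rewrite lee_fin ger0_norm ?nq_ge0//.
exact: le_trans (fg x Dx) (ler_norm _).
Qed.

Lemma sqint0 : sqint (fun=> 0).
Proof.
split; first exact: measurable_quat_cst.
rewrite /sqn (eq_integral (cst 0%E)) ?integral0// => x _.
by rewrite nq0.
Qed.

Lemma sqintD f g : sqint f -> sqint g -> sqint (fun x => f x + g x).
Proof.
move=> hf hg; have /sqintP[mf If] := hf; have /sqintP[mg Ig] := hg.
have := integrableZl mD 2 (integrableD mD If Ig).
move=> /(le_sqint (f := fun x => f x + g x)); apply.
  exact: measurable_quatD.
by move=> x _ /=; exact: nqD_le.
Qed.

Lemma sqintMl q f : sqint f -> sqint (fun x => q * f x).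
Proof.
move=> hf; have /sqintP[mf If] := hf.
have := integrableZl mD (nq q) If.
move=> /(le_sqint (f := fun x => q * f x)); apply.
  by apply: measurable_quatM => //; exact: measurable_quat_cst.
by move=> x _ /=; rewrite nqM.
Qed.

Lemma sqintN f : sqint f -> sqint (fun x => - f x).
Proof.
move=> hf; rewrite (_ : (fun x => - f x) = fun x => -1 * f x); first exact: sqintMl.
by apply/funext => x; rewrite mulN1r.
Qed.

Lemma sqintB f g : sqint f -> sqint g -> sqint (fun x => f x - g x).
Proof. by move=> hf hg; apply: sqintD => //; exact: sqintN. Qed.

Lemma iq_mul_conj f g : sqint f -> sqint g -> iq mu D (fun x => f x * conjq (g x)).
Proof.
move=> hf hg; have /sqintP[mf If] := hf; have /sqintP[mg Ig] := hg.
have := integrableD mD If Ig.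
move=> /(le_iq mD (f := fun x => f x * conjq (g x))); apply.
  by apply: measurable_quatM => //; exact: measurable_quat_conj.
move=> x _ /=; rewrite modqM modq_conj -!modq_sqr.
have := modq_ge0 (f x); have := modq_ge0 (g x).
have := sqr_ge0 (modq (f x) - modq (g x)); nra.
Qed.

Local Notation ip := (inner_quat mu D).

Lemma qre_ip f g : sqint f -> sqint g ->
  qre (ip f g) = \int[mu]_(x in D) qre (f x * conjq (g x)).
Proof. by []. Qed.

Lemma sqN_R f : sqN f = \int[mu]_(x in D) nq (f x).
Proof. by []. Qed.

Lemma ipDl f g h : sqint f -> sqint g -> sqint h ->
  ip (fun x => f x + g x) h = ip f h + ip g h.
Proof.
move=> hf hg hh; rewrite /inner_quat -integral_quatD//; do ?exact: iq_mul_conj.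
by apply: eq_integral_quat => x _; rewrite mulrDl.
Qed.

Lemma ipMl q f g : sqint f -> sqint g ->
  ip (fun x => q * f x) g = q * ip f g.
Proof.
move=> hf hg; rewrite /inner_quat -integral_quatMl//; do ?exact: iq_mul_conj.
by apply: eq_integral_quat => x _; rewrite mulrA.
Qed.

Lemma ip_conj f g : sqint f -> sqint g -> ip g f = conjq (ip f g).
Proof.
move=> hf hg; rewrite /inner_quat -integral_quat_conj//; do ?exact: iq_mul_conj.
by apply: eq_integral_quat => x _; rewrite conjqM conjqK.
Qed.

Lemma sqND f g : sqint f -> sqint g ->
  sqN (fun x => f x + g x) = sqN f + sqN g + 2 * qre (ip f g).
Proof.
move=> hf hg; rewrite !sqN_R (qre_ip hf hg).
have If := sqint_integrable hf; have Ig := sqint_integrable hg.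
have Ifg : mu.-integrable D (EFin \o (fun x => qre (f x * conjq (g x)))).
  have := iq_mul_conj hf hg 1.
  by apply: eq_integrable => // x _ /=; rewrite mulr1.
rewrite -RintegralZl// -RintegralD// -RintegralD//.
- by apply: eq_Rintegral => x _; rewrite nqD.
- by have := integrableD mD If Ig; apply: eq_integrable.
- by have := integrableZl mD 2 Ifg; apply: eq_integrable.
Qed.

Lemma sqNMl q f : sqint f -> sqN (fun x => q * f x) = nq q * sqN f.
Proof.
move=> hf; rewrite !sqN_R -RintegralZl//; last exact: sqint_integrable.
by apply: eq_Rintegral => x _; rewrite nqM.
Qed.

Lemma sqNBC f g : sqN (fun x => f x - g x) = sqN (fun x => g x - f x).
Proof. by rewrite !sqN_R; apply: eq_Rintegral => x _; rewrite nqB. Qed.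

(** The square norm of [f - t <f,g> g] is a nonnegative quadratic polynomial
    in the real number [t]. *)
Lemma cauchy_schwarz f g : sqint f -> sqint g -> nq (ip f g) <= sqN f * sqN g.
Proof.
move=> hf hg; set Q := ip f g.
have key (t : R) : 0 <= sqN f - 2 * t * nq Q + t ^+ 2 * nq Q * sqN g.
  have hQ := sqintMl ((- t) *: Q) hg.
  have := sqN_ge0 (fun x => f x + (- t) *: Q * g x).
  rewrite sqND// sqNMl// nqZ.
  have -> : ip f (fun x => (- t) *: Q * g x) = Q * conjq ((- t) *: Q).
    by rewrite ip_conj// ipMl// conjqM -ip_conj.
  rewrite conjqZ scaleqAr qreZ qre_mul_conj => h.
  by apply: (le_trans h); rewrite le_eqVlt; apply/orP; left; apply/eqP; ring.
have Q0 := nq_ge0 Q; have g0 := sqN_ge0 g; have f0 := sqN_ge0 f.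
have [B0|B0] := eqVneq (sqN g) 0.
  rewrite B0 mulr0 leNgt; apply/negP => Qp.
  (* With [sqN g = 0] the polynomial is affine, and this value of [t] would
     make it equal to -1. *)
  have := key ((sqN f + 1) / (2 * nq Q)); rewrite B0 mulr0 addr0.
  rewrite (_ : 2 * _ * _ = sqN f + 1); first by lra.
  by field; rewrite gt_eqF.
(* The minimum of the polynomial. *)
have := key (sqN g)^-1.
rewrite (_ : _ + _ = sqN f - nq Q / sqN g); last by field.
by rewrite subr_ge0 ler_pdivrMr// lt0r B0.
Qed.

(** The quadratic triangle inequality, in the form that needs no square
    root. *)
Lemma sqNB_le f g h : sqint f -> sqint g -> sqint h ->
  sqN (fun x => f x - h x) <=
  2 * (sqN (fun x => f x - g x) + sqN (fun x => g x - h x)).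
Proof.
move=> hf hg hh; have h1 := sqintB hf hg; have h2 := sqintB hg hh.
rewrite !sqN_R -RintegralD//; try exact: sqint_integrable.
have I1 := sqint_integrable h1; have I2 := sqint_integrable h2.
have I12 : mu.-integrable D (EFin \o (fun x => nq (f x - g x) + nq (g x - h x))).
  by have := integrableD mD I1 I2; apply: eq_integrable.
rewrite -RintegralZl//; apply: le_Rintegral => //.
- exact/sqint_integrable/sqintB.
- by have := integrableZl mD 2 I12; apply: eq_integrable.
- by move=> x _; rewrite -[f x - h x](subrKA (g x)); exact: nqD_le.
Qed.

Lemma sqNB_cvg_sqN (g_ : nat -> T -> quat R) g :
  (forall k, sqint (g_ k)) -> sqint g ->
  sqN (fun x => g_ k x - g x) @[k --> \oo] --> (0:R) ->
  sqN (g_ k) @[k --> \oo] --> sqN g.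
Proof.
move=> hg_ hg h; have hb k := sqintB (hg_ k) hg.
have e k : sqN (g_ k) = sqN (fun x => g_ k x - g x) + sqN g +
    2 * qre (ip (fun x => g_ k x - g x) g).
  rewrite -sqND//; apply: eq_sqN => x _; by rewrite subrK.
have -> : (fun k => sqN (g_ k)) = (fun k => sqN (fun x => g_ k x - g x) + sqN g +
    2 * qre (ip (fun x => g_ k x - g x) g)) by apply/funext => k; exact: e.
suff hr : qre (ip (fun x => g_ k x - g x) g) @[k --> \oo] --> (0:R).
  have := cvgD (cvgD h (cvg_cst (sqN g))) (cvgM (cvg_cst (2 : R)) hr).
  by rewrite add0r mulr0 addr0; apply.
have hs : Num.sqrt (sqN (fun x => g_ k x - g x) * sqN g) @[k --> \oo] --> (0:R).
  have h0 : sqN (fun x => g_ k x - g x) * sqN g @[k --> \oo] --> (0:R).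
    by rewrite -(mul0r (sqN g)); apply: cvgM => //; exact: cvg_cst.
  by have := cvg_comp _ _ h0 (@sqrt_continuous R _); rewrite sqrtr0; apply.
apply/norm_cvg0P.
apply: (squeeze_cvgr (f := fun=> 0) _ (cvg_cst 0) hs).
near=> k; apply/andP; split; first exact: normr_ge0.
apply: (le_trans (qre_le_modq _)); rewrite /modq -/(nq _) ler_wsqrtr//.
exact: cauchy_schwarz.
Unshelve. all: by end_near. Qed.

Lemma L2_convergesP (f_ : nat -> T -> quat R) f :
  (forall k, sqint (fun x => f_ k x - f x)) ->
  L2_converges mu D f_ f <-> sqN (fun x => f_ k x - f x) @[k --> \oo] --> (0:R).
Proof.
move=> hs; rewrite /L2_converges; under eq_cvg do rewrite L2norm_sqN//.
split=> h.
  have /fine_cvgP[_ /= h1] := h.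
  have -> : (fun k => sqN (fun x => f_ k x - f x)) =
      (fun k => Num.sqrt (sqN (fun x => f_ k x - f x)) * Num.sqrt (sqN (fun x => f_ k x - f x))).
    by apply/funext => k; rewrite -expr2 sqr_sqrtr// sqN_ge0.
  by have := cvgM h1 h1; rewrite mulr0; apply.
apply: cvg_EFin; first by near=> k.
by have := cvg_comp _ _ h (@sqrt_continuous R _); rewrite sqrtr0; apply.
Unshelve. all: by end_near. Qed.

Lemma sqn_eq0 f : measurable_quat D f -> sqn f = 0%E ->
  {ae mu, forall x, D x -> f x = 0}.
Proof.
move=> mf; rewrite /sqn => h.
have mn : measurable_fun D (fun x => (nq (f x))%:E).
  exact/measurable_EFinP/measurable_nq.
have : ae_eq mu D (fun x => (nq (f x))%:E) (cst 0%E).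
  apply/(ae_eq_integral_abs mu mD mn); rewrite -[RHS]h.
  by apply: eq_integral => x _; rewrite gee0_abs// lee_fin nq_ge0.
by apply: filterS => x hx Dx; apply: nq_eq0; have [] := hx Dx.
Qed.

Lemma sqN_lim_unique (f_ : nat -> T -> quat R) f g :
  (forall k, sqint (f_ k)) -> sqint f -> sqint g ->
  sqN (fun x => f_ k x - f x) @[k --> \oo] --> (0:R) ->
  sqN (fun x => f_ k x - g x) @[k --> \oo] --> (0:R) ->
  {ae mu, forall x, D x -> f x = g x}.
Proof.
move=> hf_ hf hg cf cg.
have hfg := sqintB hf hg.
suff /sqn_eq0 : sqn (fun x => f x - g x) = 0%E.
  move=> /(_ hfg.1); apply: filterS => x h Dx.
  by apply/eqP; rewrite -subr_eq0; apply/eqP; exact: h.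
rewrite sqnE//; congr EFin; apply/eqP; rewrite eq_le sqN_ge0 andbT.
have : (2 * (sqN (fun x => f_ k x - f x) + sqN (fun x => f_ k x - g x)))
    @[k --> \oo] --> (2 * (0 + 0) : R).
  by apply: cvgM; [exact: cvg_cst|exact: cvgD].
rewrite addr0 mulr0 => hl.
have := @cvgr_to_ge _ _ _ _ _ _ (sqN (fun x => f x - g x)) hl; apply.
near=> k; rewrite (sqNBC (f_ k) f); exact: sqNB_le.
Unshelve. all: by end_near. Qed.

End SquareIntegrable.

(** In the square norm of [c f + g] the only term that is not itself a square
    norm is twice the real part of [c <f,g>], and the real parts for all [c]
    determine [<f,g>]. *)
Lemma polarization (R : realType) d1 d2 (T1 : measurableType d1)
    (T2 : measurableType d2) (mu1 : {measure set T1 -> \bar R})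
    (mu2 : {measure set T2 -> \bar R}) (D1 : set T1) (D2 : set T2)
    (mD1 : measurable D1) (mD2 : measurable D2) (C : R)
    (f g : T1 -> quat R) (F G : T2 -> quat R) :
  sqint mu1 D1 f -> sqint mu1 D1 g -> sqint mu2 D2 F -> sqint mu2 D2 G ->
  (forall p q, sqN mu2 D2 (fun x => p * F x + q * G x) =
     C * sqN mu1 D1 (fun x => p * f x + q * g x)) ->
  inner_quat mu2 D2 F G = C *: inner_quat mu1 D1 f g.
Proof.
move=> hf hg hF hG h; apply: quat_ext => c.
rewrite qreMC scaleqAl qreZ (qreMC (inner_quat mu1 _ _ _)).
have := h c 1; rewrite !sqND//; do ?exact: sqintMl.
rewrite !ipMl//; do ?exact: sqintMl.
have e1 : sqN mu2 D2 (fun x => c * F x) = C * sqN mu1 D1 (fun x => c * f x).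
  have := h c 0; under eq_sqN do rewrite mul0r addr0.
  by under [X in _ = _ * X -> _]eq_sqN do rewrite mul0r addr0.
have e2 : sqN mu2 D2 (fun x => 1 * G x) = C * sqN mu1 D1 (fun x => 1 * g x).
  have := h 0 1; under eq_sqN do rewrite mul0r add0r.
  by under [X in _ = _ * X -> _]eq_sqN do rewrite mul0r add0r.
rewrite e1 e2.
have -> : (fun x => 1 * G x) = G by apply/funext => x; rewrite mul1r.
have -> : (fun x => 1 * g x) = g by apply/funext => x; rewrite mul1r.
by move=> hh; lra.
Qed.

Lemma cvg_seq_EFin (R : realType) (u : nat -> R) (l : R) :
  u k @[k --> \oo] --> l -> (u k)%:E @[k --> \oo] --> l%:E.
Proof. by move=> h; apply: cvg_EFin => //; near=> k. Unshelve. all: by end_near. Qed.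

(** Fatou's lemma for the situation met below: real functions, a pointwise
    limit, and integrals with converging bounds. *)
Lemma fatou_le (R : realType) d (T : measurableType d)
    (mu : {measure set T -> \bar R}) (D : set T) (u_ : nat -> T -> R) (u : T -> R)
    (a_ : nat -> R) (a : R) : measurable D ->
  (forall k, measurable_fun D (u_ k)) -> (forall k x, D x -> 0 <= u_ k x) ->
  (forall x, D x -> u_ k x @[k --> \oo] --> u x) ->
  (forall k, (\int[mu]_(x in D) (u_ k x)%:E <= (a_ k)%:E)%E) ->
  a_ k @[k --> \oo] --> a ->
  (\int[mu]_(x in D) (u x)%:E <= a%:E)%E.
Proof.
move=> mD mu_ u0 cu hu ha.
have := @fatou _ T R mu D mD (fun k x => (u_ k x)%:E)
  (fun k => proj2 (measurable_EFinP _ _) (mu_ k)) (fun k x Dx => u0 k x Dx).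
rewrite (_ : (\int[mu]_(x in D) _ = \int[mu]_(x in D) (u x)%:E)%E); last first.
  apply: eq_integral => x /[!inE] Dx; have /cvg_seq_EFin hc := cu x Dx.
  by have [-> _] := cvg_limn_einf_sup hc.
move=> /le_trans; apply; rewrite limn_einf_lim.
have ha' := cvg_seq_EFin ha.
rewrite -(cvg_lim _ ha')//; apply: lee_lim; [exact: is_cvg_einfs|by apply/cvg_ex; eexists; exact: ha'|].
near=> k; apply: (le_trans _ (hu k)).
by apply: ereal_inf_lbound; exists k => /=.
Unshelve. all: by end_near. Qed.

Lemma cvg_of_geometric_steps (R : realType) (u : nat -> R) (S : R) :
  (forall k, `|u k.+1 - u k| <= S * 2^-1 ^+ k) -> cvgn u.
Proof.
move=> h; rewrite (_ : u = fun n => u 0%N + series (telescope u) n); last first.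
  by apply/funext => n; exact: eq_sum_telescope.
apply: is_cvgD; first exact: is_cvg_cst.
apply: normed_cvg; apply: (series_le_cvg (v_ := geometric S 2^-1)).
- by move=> k /=; exact: normr_ge0.
- by move=> k /=; exact: le_trans (h k).
- by move=> k /=; exact: h.
- by apply: is_cvg_geometric_series; rewrite ger0_norm ?invr_ge0// invf_lt1// ltr1n.
Qed.

Section QuaternionLimits.
Context {R : realType}.

Lemma qcomp_le_nq (q : quat R) :
  [/\ `|qre q| <= Num.sqrt (nq q), `|qim_i q| <= Num.sqrt (nq q),
      `|qim_j q| <= Num.sqrt (nq q) & `|qim_k q| <= Num.sqrt (nq q)].
Proof.
have h (x : R) : x ^+ 2 <= nq q -> `|x| <= Num.sqrt (nq q).
  by move=> hx; rewrite -sqrtr_sqr ler_wsqrtr.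
have h1 := sqr_ge0 (qre q); have h2 := sqr_ge0 (qim_i q).
have h3 := sqr_ge0 (qim_j q); have h4 := sqr_ge0 (qim_k q).
by split; apply: h; rewrite /nq; lra.
Qed.

Definition qcvg (u : nat -> quat R) (l : quat R) :=
  [/\ qre (u k) @[k --> \oo] --> qre l, qim_i (u k) @[k --> \oo] --> qim_i l,
      qim_j (u k) @[k --> \oo] --> qim_j l & qim_k (u k) @[k --> \oo] --> qim_k l].

Lemma qcvg_nqB (u : nat -> quat R) l c : qcvg u l ->
  nq (u k - c) @[k --> \oo] --> nq (l - c).
Proof.
move=> [h0 h1 h2 h3]; rewrite /nq /= ; under eq_cvg do rewrite !expr2; rewrite !expr2.
by do 3 (apply: cvgD; last (apply: cvgM; apply: cvgB => //; exact: cvg_cst));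
  apply: cvgM; apply: cvgB => //; exact: cvg_cst.
Qed.

End QuaternionLimits.

Section CompletenessOfL2.
Context {R : realType} d (T : measurableType d) (mu : {measure set T -> \bar R}).
Local Notation sqN := (sqN mu setT).
Local Notation sqint := (sqint mu setT).

(** Along a subsequence with [sqN (g k.+1 - g k) <= 8^-k] the sum of the [4^k
    * nq (g k.+1 x - g k x)] has a finite integral, so [g k x] converges
    geometrically for almost every [x]; Fatou's lemma then bounds the distance
    to the limit. *)
Lemma L2_complete (f_ : nat -> T -> quat R) :
  (forall k, sqint (f_ k)) ->
  (forall e : R, 0 < e -> exists N, forall k l, (N <= k)%N -> (N <= l)%N ->
     sqN (fun x => f_ k x - f_ l x) < e) ->
  exists2 f, sqint f & sqN (fun x => f_ k x - f x) @[k --> \oo] --> (0 : R).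
Proof.
move=> hf hcau.
pose e8 k : R := 8^-1 ^+ k.
have e8_gt0 k : 0 < e8 k by rewrite exprn_gt0.
have /choice[n hn] : forall k, exists N, forall i j, (N <= i)%N -> (N <= j)%N ->
    sqN (fun x => f_ i x - f_ j x) < e8 k by move=> k; exact: hcau.
pose phi k := \sum_(i < k.+1) n i.
have phi_n k : (n k <= phi k)%N by rewrite /phi big_ord_recr /= leq_addl.
have phiS k : (phi k <= phi k.+1)%N by rewrite [in X in (_ <= X)%N]/phi big_ord_recr /= leq_addr.
pose g k := f_ (phi k).
have hg k : sqint (g k) by exact: hf.
have hgS k : sqN (fun x => g k.+1 x - g k x) < e8 k.
  by apply: hn; [exact: leq_trans (phi_n k) (phiS k)|exact: phi_n].
pose u k x := 4 ^+ k * nq (g k.+1 x - g k x).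
have u0 k x : 0 <= u k x by rewrite mulr_ge0 ?nq_ge0 ?exprn_ge0.
have mB k l : measurable_quat setT (fun x => f_ k x - f_ l x).
  by have [] := sqintB measurableT (hf k) (hf l).
have muk k : measurable_fun setT (fun x => (u k x)%:E).
  by apply/measurable_EFinP; apply: measurable_funM => //; exact: (measurable_nq (mB _ _)).
have iS : (\int[mu]_x \sum_(k <oo) (u k x)%:E < +oo)%E.
  rewrite integral_nneseries//; last by move=> k x _; rewrite lee_fin.
  apply: (@le_lt_trans _ _ (\sum_(k <oo) ((2^-1 ^+ k : R)%:E))%E).
    apply: lee_nneseries => k.
      by move=> _ _; apply: integral_ge0 => x _; rewrite lee_fin.
    move=> _; under eq_integral do rewrite EFinM.
    rewrite ge0_integralZl//; first last.
    - by move=> x _; rewrite lee_fin nq_ge0.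
    - by apply/measurable_EFinP; exact: (measurable_nq (mB _ _)).
    have := sqnE (sqintB measurableT (hg k.+1) (hg k)); rewrite /sqn => ->.
    rewrite -EFinM lee_fin.
    have -> : (2^-1 ^+ k : R) = 4 ^+ k * 8^-1 ^+ k.
      by rewrite -exprMn; congr (_ ^+ k); field.
    by rewrite ler_pM2l ?exprn_gt0//; exact/ltW/hgS.
  have h2 := @cvg_geometric_series R 1 (2^-1).
  have {h2} : series (geometric (1:R) 2^-1) @ \oo --> (1 * (1 - 2^-1)^-1 : R).
    by apply: h2; rewrite ger0_norm ?invr_ge0// invf_lt1// ltr1n.
  move=> /cvg_seq_EFin h3.
  rewrite (_ : (\sum_(k <oo) _)%E = (1 * (1 - 2^-1)^-1 : R)%:E) ?ltry//.
  apply/cvg_lim => //; rewrite (_ : (fun k => _) =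
    (fun k => (series (geometric (1:R) 2^-1) k)%:E)) //.
  apply/funext => k; rewrite /series /= -sumEFin.
  by apply: eq_bigr => i _; rewrite mul1r.
have [N [mN N0 hN]] : {ae mu, forall x, (\sum_(k <oo) (u k x)%:E < +oo)%E}.
  have : mu.-integrable setT (fun x => \sum_(k <oo) (u k x)%:E)%E.
    have mS : measurable_fun setT (fun x => \sum_(k <oo) (u k x)%:E)%E.
      by apply: ge0_emeasurable_sum => [k x _ _|k _]; [rewrite lee_fin|exact: muk].
    apply/integrableP; split => //.
    apply: le_lt_trans iS; apply: ge0_le_integral => //.
    - exact: measurableT_comp.
    - by move=> x _; rewrite gee0_abs//; apply: nneseries_ge0 => k _ _; rewrite lee_fin.
  move=> /(integrable_ae measurableT); apply: filterS => x /(_ Logic.I).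
  by rewrite ge0_fin_numE//; apply: nneseries_ge0 => k _ _; rewrite lee_fin.
(* Replacing the sequence by 0 on the exceptional null set makes it converge
   everywhere, so that the limit is measurable. *)
pose z x : R := \1_(~` N) x.
have mz : measurable_fun setT z by apply: measurable_indic; exact: measurableC.
have z_ae : {ae mu, forall x, z x = 1}.
  exists N; split => // x /=; apply: contra_notP => Nx.
  by rewrite /z indicE mem_set.
pose g' k x := z x *: g k x.
have mg' k : measurable_quat setT (g' k).
  by apply: measurable_quatZ => //; have [] := hg k.
have gcvg x : exists l, qcvg (g'^~ x) l.
  have [S hS] : exists S, forall k, Num.sqrt (nq (g' k.+1 x - g' k x)) <= S * 2^-1 ^+ k.
    have [Nx|Nx] := pselect (N x).
      exists 0 => k; rewrite mul0r /g' /z indicE memNset; last by [].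
      by rewrite !scale0r subr0 nq0 sqrtr0.
    have hfin : (\sum_(k <oo) (u k x)%:E < +oo)%E.
      by apply: contrapT => h; apply: Nx; apply: hN.
    exists (Num.sqrt (fine (\sum_(k <oo) (u k x)%:E)%E)) => k.
    have hk : u k x <= fine (\sum_(k <oo) (u k x)%:E)%E.
      rewrite -lee_fin fineK; last first.
        by rewrite ge0_fin_numE//; apply: nneseries_ge0 => i _ _; rewrite lee_fin.
      apply: (@le_trans _ _ (\sum_(0 <= i < k.+1) (u i x)%:E)%E).
        rewrite big_nat_recr //= leeDr//.
        by apply: sume_ge0 => i _; rewrite lee_fin.
      by apply: nneseries_lim_ge => i _ _; rewrite lee_fin.
    rewrite /g' /z indicE mem_set// !scale1r.
    have -> : 2^-1 ^+ k = Num.sqrt (4^-1 ^+ k) :> R.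
      have -> : 4^-1 ^+ k = (2^-1 ^+ k) ^+ 2 :> R.
        by rewrite -exprM mulnC exprM; congr (_ ^+ k); field.
      by rewrite sqrtr_sqr ger0_norm// exprn_ge0.
    rewrite -sqrtrM ?(le_trans _ hk)// ler_wsqrtr//.
    have -> : nq (g k.+1 x - g k x) = u k x * 4^-1 ^+ k.
      by rewrite /u mulrAC -exprMn divff ?expr1n ?mul1r.
    by rewrite ler_wpM2r// exprn_ge0.
  have hc k := qcomp_le_nq (g' k.+1 x - g' k x).
  have c0 : cvgn (fun k => qre (g' k x)).
    by apply: (@cvg_of_geometric_steps _ _ S) => k; have [h _ _ _] := hc k; exact: le_trans h _.
  have c1 : cvgn (fun k => qim_i (g' k x)).
    by apply: (@cvg_of_geometric_steps _ _ S) => k; have [_ h _ _] := hc k; exact: le_trans h _.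
  have c2 : cvgn (fun k => qim_j (g' k x)).
    by apply: (@cvg_of_geometric_steps _ _ S) => k; have [_ _ h _] := hc k; exact: le_trans h _.
  have c3 : cvgn (fun k => qim_k (g' k x)).
    by apply: (@cvg_of_geometric_steps _ _ S) => k; have [_ _ _ h] := hc k; exact: le_trans h _.
  by exists (Quat (limn (fun k => qre (g' k x))) (limn (fun k => qim_i (g' k x)))
    (limn (fun k => qim_j (g' k x))) (limn (fun k => qim_k (g' k x)))).
have [f hfl] := choice gcvg.
have mf : measurable_quat setT f.
  split.
  - by apply: (measurable_fun_cvg (h := fun k x => qre (g' k x))) => [k|x _];
      [have [] := mg' k|have [] := hfl x].
  - by apply: (measurable_fun_cvg (h := fun k x => qim_i (g' k x))) => [k|x _];
      [have [] := mg' k|have [] := hfl x].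
  - by apply: (measurable_fun_cvg (h := fun k x => qim_j (g' k x))) => [k|x _];
      [have [] := mg' k|have [] := hfl x].
  - by apply: (measurable_fun_cvg (h := fun k x => qim_k (g' k x))) => [k|x _];
      [have [] := mg' k|have [] := hfl x].
(* Fatou's lemma along the subsequence, at a fixed index [k] of the original
   sequence. *)
have bound m k : (n m <= k)%N -> (sqn mu setT (fun x => f x - f_ k x)%R <= (e8 m)%:E)%E.
  move=> mk.
  have -> : sqn mu setT (fun x => f x - f_ k x)%R =
      sqn mu setT (fun x => f x - z x *: f_ k x)%R.
    apply: ae_eq_sqn => //.
    - by apply: measurable_quatB => //; have [] := hf k.
    - by apply: measurable_quatB => //; apply: measurable_quatZ => //; have [] := hf k.
    - by apply: filterS z_ae => x -> _; rewrite scale1r.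
  apply: (@fatou_le _ _ _ mu setT (fun j x => nq (g' (j + m)%N x - z x *: f_ k x)) _
    (fun=> e8 m)) => //.
  - move=> j; apply: measurable_nq; apply: measurable_quatB => //.
    by apply: measurable_quatZ => //; have [] := hf k.
  - by move=> j x _; exact: nq_ge0.
  - move=> x _.
    rewrite (@cvg_shiftn m _ (fun j => nq (g' j x - z x *: f_ k x))).
    exact: qcvg_nqB.
  - move=> j; have hjk := sqintB measurableT (hg (j + m)%N) (hf k).
    have -> : (\int[mu]_x (nq (g' (j + m)%N x - z x *: f_ k x))%:E =
        sqn mu setT (fun x => g (j + m)%N x - f_ k x)%R)%E.
      apply: ae_eq_sqn => //.
      - by apply: measurable_quatB => //; apply: measurable_quatZ => //; have [] := hf k.
      - exact: mB.
      - by apply: filterS z_ae => x zx _; rewrite /g' zx !scale1r.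
    rewrite sqnE// lee_fin; apply/ltW/hn => //.
    have phi_le i : (phi m <= phi (i + m))%N.
      by elim: i => // i ih; rewrite addSn; exact: leq_trans ih (phiS _).
    exact: leq_trans (phi_n m) (phi_le j).
  - exact: cvg_cst.
have hff k m : (n m <= k)%N -> sqint (fun x => f x - f_ k x).
  move=> mk; split; first by apply: measurable_quatB => //; have [] := hf k.
  by apply: le_lt_trans (bound m k mk) _; rewrite ltry.
have hfin : sqint f.
  have := sqintD measurableT (hff _ 0%N (leqnn _)) (hf (n 0%N)).
  by under eq_fun do rewrite subrK.
exists f => //; apply/cvgrPdist_le => e e0.
have /cvgrPdist_le/(_ e e0) : (geometric 1 (8^-1 : R)) @ \oo --> (0:R).
  by apply: cvg_geometric; rewrite ger0_norm ?invr_ge0// invf_lt1// ltr1n.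
move=> [m _ /(_ m (leqnn _)) /=]; rewrite sub0r normrN mul1r => hm.
exists (n m) => // k /= mk; rewrite sub0r normrN ger0_norm ?sqN_ge0//.
rewrite sqNBC; apply: le_trans (le_trans (ler_norm _) hm).
by rewrite -lee_fin -sqnE; [exact: bound|exact: (hff k m)].
Unshelve. all: by end_near. Qed.

End CompletenessOfL2.

Section DominatedConvergenceL2.
Context {R : realType} d (T : measurableType d) (mu : {measure set T -> \bar R}).

Lemma dominated_Rintegral (D : set T) (u_ : nat -> T -> R) (u v : T -> R) :
  measurable D -> (forall k, measurable_fun D (u_ k)) ->
  measurable_fun D u ->
  (forall x, D x -> u_ k x @[k --> \oo] --> u x) ->
  mu.-integrable D (EFin \o v) -> (forall k x, D x -> `|u_ k x| <= v x) ->
  \int[mu]_(x in D) (u_ k x) @[k --> \oo] --> \int[mu]_(x in D) u x.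
Proof.
move=> mD mu_ mu0 cu iv uv.
have [iu _ h] := @dominated_convergence _ T R mu D mD (fun k x => (u_ k x)%:E)
  (fun x => (u x)%:E) (fun x => (v x)%:E) (fun k => proj2 (measurable_EFinP _ _) (mu_ k))
  (proj2 (measurable_EFinP _ _) mu0)
  (aeW _ (fun x Dx => cvg_seq_EFin (cu x Dx))) iv
  (aeW _ (fun x k Dx => uv k x Dx)).
have ifin : (\int[mu]_(x in D) (u x)%:E)%E \is a fin_num by exact: integrable_fin_num.
rewrite /Rintegral.
by apply: fine_cvg; rewrite fineK//.
Qed.

Lemma sqN_dominated (f_ : nat -> T -> quat R) f (v : T -> R) :
  (forall k, measurable_quat setT (f_ k)) -> measurable_quat setT f ->
  (forall x, nq (f_ k x - f x) @[k --> \oo] --> (0:R)) ->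
  mu.-integrable setT (EFin \o v) -> (forall k x, nq (f_ k x - f x) <= v x) ->
  sqN mu setT (fun x => f_ k x - f x) @[k --> \oo] --> (0 : R).
Proof.
move=> mf_ mf cf iv fv.
have := @dominated_Rintegral setT (fun k x => nq (f_ k x - f x)) (fun=> 0) v
  measurableT (fun k => measurable_nq (measurable_quatB (mf_ k) mf)) (measurable_cst _)
  (fun x _ => cf x) iv.
have -> : \int[mu]_(x in setT) (0:R) = 0 by rewrite /Rintegral integral0.
by apply => k x _; rewrite ger0_norm ?nq_ge0.
Qed.

(** Cutting a square-integrable function off where it is small makes it
    integrable as well: [modq f <= k.+1 * nq f] where [modq f >= k.+1^-1]. *)
Lemma dense_L1_L2 f : sqint mu setT f ->
  exists f_ : nat -> T -> quat R, [/\ forall k, iq mu setT (f_ k),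
    forall k, sqint mu setT (f_ k),
    sqN mu setT (fun x => f_ k x - f x) @[k --> \oo] --> (0 : R) &
    forall k, sqN mu setT (f_ k) <= sqN mu setT f].
Proof.
move=> hf; have [mf _] := hf; have If := sqint_integrable hf.
pose A k := [set x | k.+1%:R^-1 <= modq (f x)].
have mA k : measurable (A k).
  rewrite (_ : A k = (fun x => modq (f x)) @^-1` `[k.+1%:R^-1, +oo[%classic).
    by rewrite -[X in measurable X]setTI; exact: (measurable_modq mf).
  by apply/seteqP; split => x; rewrite /A /= in_itv /= andbT.
pose f_ k x : quat R := (\1_(A k) x : R) *: f x.
have mf_ k : measurable_quat setT (f_ k).
  by apply: measurable_quatZ => //; exact: measurable_indic.
have nqf k x : nq (f_ k x) <= nq (f x).
  rewrite /f_ nqZ indicE; case: (_ \in _); first by rewrite expr1n mul1r.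
  by rewrite expr0n mul0r nq_ge0.
have nqfB k x : nq (f_ k x - f x) <= nq (f x).
  rewrite /f_ indicE; case: (_ \in _); first by rewrite scale1r subrr nq0 nq_ge0.
  by rewrite scale0r sub0r nqN.
have hs k : sqint mu setT (f_ k) by apply: (le_sqint _ _ If) => // x _; exact: nqf.
exists f_; split => //.
- move=> k; have := integrableZl measurableT k.+1%:R If.
  move=> /(le_iq measurableT (f := f_ k)); apply => // x _ /=.
  rewrite /f_ modqZ indicE; have [h|h] := boolP (x \in A k); last first.
    by rewrite normr0 mul0r mulr_ge0 ?nq_ge0.
  rewrite normr1 mul1r -modq_sqr expr2 mulrA ler_peMl ?modq_ge0//.
  by move: h; rewrite inE /A /= -(ler_pM2l (ltr0Sn R k)) divff ?pnatr_eq0.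
- apply: (sqN_dominated (v := fun x => nq (f x))) => // x.
  have [fx0|fx0] := eqVneq (modq (f x)) 0.
    have f0 : nq (f x) = 0 by rewrite -modq_sqr fx0 expr0n.
    rewrite (_ : (fun k => _) = fun=> 0); first exact: cvg_cst.
    apply/funext => k; apply/eqP; rewrite eq_le nq_ge0 andbT -f0; exact: nqfB.
  have fx_gt0 : 0 < modq (f x) by rewrite lt0r fx0 modq_ge0.
  apply/cvgrPdist_le => e e0.
  have := near_infty_natSinv_lt (PosNum fx_gt0); apply: filterS => k /= hk.
  rewrite /f_ indicE mem_set; last exact: ltW.
  by rewrite scale1r subrr nq0 subrr normr0 ltW.
- move=> k; rewrite !sqN_R; apply: le_Rintegral => //.
    exact: sqint_integrable.
Qed.

End DominatedConvergenceL2.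

(** * Changes of variables in Lebesgue integrals on column vectors *)

Section Scaling.
Context {R : realType} d1 d2 (T1 : measurableType d1) (T2 : measurableType d2).
Variables (mu1 : {measure set T1 -> \bar R}) (mu2 : {measure set T2 -> \bar R}).

(** [phi] pushes [mu1] forward to [K] times [mu2], expressed on nonnegative
    integrals; below, [K] is the inverse of the Jacobian of [phi]. *)
Definition scales (phi : T1 -> T2) (K : R) :=
  [/\ measurable_fun setT phi, 0 <= K & forall f : T2 -> \bar R,
    measurable_fun setT f -> (forall x, 0 <= f x)%E ->
    (\int[mu1]_x f (phi x) = K%:E * \int[mu2]_x f x)%E].

Lemma scales_integrable phi K (f : T2 -> \bar R) : scales phi K ->
  mu2.-integrable setT f -> mu1.-integrable setT (f \o phi).
Proof.
move=> [mphi K0 h] /integrableP[mf fi]; apply/integrableP; split.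
  exact: measurableT_comp.
rewrite /= (h (abse \o f))//=; last exact: measurableT_comp.
by rewrite lte_mul_pinfty.
Qed.

Lemma scales_Rintegral phi K (f : T2 -> R) : scales phi K ->
  mu2.-integrable setT (EFin \o f) ->
  \int[mu1]_x f (phi x) = K * \int[mu2]_x f x.
Proof.
move=> hs fi; have [mphi K0 h] := hs; have mf := measurable_int _ fi.
rewrite /Rintegral integralE [in RHS]integralE.
have e2 : (fun x => (f x)%:E) = EFin \o f by [].
have hp := h _ (measurable_funepos mf) (fun x => funepos_ge0 _ x).
have hn := h _ (measurable_funeneg mf) (fun x => funeneg_ge0 _ x).
have fp : (\int[mu2]_x (EFin \o f)^\+ x)%E \is a fin_num.
  by rewrite ge0_fin_numE ?integral_ge0//; exact: integral_funepos_lt_pinfty.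
have fn : (\int[mu2]_x (EFin \o f)^\- x)%E \is a fin_num.
  by rewrite ge0_fin_numE ?integral_ge0//; exact: integral_funeneg_lt_pinfty.
have e1 : (fun x => (f (phi x))%:E) = (EFin \o f) \o phi by [].
have hp' : (\int[mu1]_x ((EFin \o f) \o phi)^\+ x = K%:E * \int[mu2]_x (EFin \o f)^\+ x)%E.
  by rewrite -hp; apply: eq_integral => x _; rewrite funepos_comp.
have hn' : (\int[mu1]_x ((EFin \o f) \o phi)^\- x = K%:E * \int[mu2]_x (EFin \o f)^\- x)%E.
  by rewrite -hn; apply: eq_integral => x _; rewrite funeneg_comp.
rewrite e1 hp' hn'.
by rewrite e2 -(fineK fp) -(fineK fn) -!EFinM -!EFinB /= mulrBr.
Qed.

Lemma scales_iq phi K (f : T2 -> quat R) : scales phi K ->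
  iq mu2 setT f -> iq mu1 setT (f \o phi).
Proof. by move=> hs fi c; exact: (scales_integrable hs (fi c)). Qed.

Lemma scales_integral_quat phi K (f : T2 -> quat R) : scales phi K ->
  iq mu2 setT f ->
  integral_quat mu1 setT (f \o phi) = K *: integral_quat mu2 setT f.
Proof.
move=> hs fi; apply: quat_ext => c.
rewrite scaleqAl qreZ !qre_int//; last exact: scales_iq hs fi.
exact: (scales_Rintegral hs (fi c)).
Qed.

Lemma scales_sqn phi K (f : T2 -> quat R) : scales phi K ->
  measurable_quat setT f -> (sqn mu1 setT (f \o phi) = K%:E * sqn mu2 setT f)%E.
Proof.
move=> [mphi K0 h] mf; apply: (h (fun x => (nq (f x))%:E)).
  exact/measurable_EFinP/measurable_nq.
by move=> x; rewrite lee_fin nq_ge0.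
Qed.

Lemma scales_sqint phi K (f : T2 -> quat R) : scales phi K ->
  sqint mu2 setT f -> sqint mu1 setT (f \o phi).
Proof.
move=> hs [mf fi]; split; first by apply: measurable_quat_comp => //; have [] := hs.
by rewrite (scales_sqn hs)// lte_mul_pinfty//; have [] := hs.
Qed.

Lemma scales_sqN phi K (f : T2 -> quat R) : scales phi K ->
  sqint mu2 setT f -> sqN mu1 setT (f \o phi) = K * sqN mu2 setT f.
Proof.
move=> hs fi; have [mf _] := fi; rewrite /sqN (scales_sqn hs)// fineM//.
by rewrite sqnE.
Qed.

Lemma scales_ae phi K (P : T2 -> Prop) : scales phi K ->
  {ae mu2, forall x, P x} -> {ae mu1, forall x, P (phi x)}.
Proof.
move=> [mphi K0 h] [N [mN N0 hN]].
have mphiN : measurable (phi @^-1` N) by rewrite -[X in measurable X]setTI; exact: mphi.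
exists (phi @^-1` N); split => //; last by move=> x hx; exact: hN.
have := h (fun x => (\1_N x)%:E).
have -> : (\int[mu2]_x (\1_N x)%:E = 0)%E by rewrite integral_indic// setIT.
rewrite mule0 => h'.
have : (\int[mu1]_x (\1_(phi @^-1` N) x)%:E = 0)%E.
  by apply: h'; [exact/measurable_EFinP/measurable_indic|move=> x; rewrite lee_fin].
by rewrite integral_indic// setIT.
Qed.

End Scaling.

Lemma scales_comp (R : realType) d1 d2 d3 (T1 : measurableType d1)
    (T2 : measurableType d2) (T3 : measurableType d3)
    (mu1 : {measure set T1 -> \bar R}) (mu2 : {measure set T2 -> \bar R})
    (mu3 : {measure set T3 -> \bar R}) phi psi K L :
  scales mu1 mu2 phi K -> scales mu2 mu3 psi L ->
  scales mu1 mu3 (psi \o phi) (K * L).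
Proof.
move=> [m1 K0 h1] [m2 L0 h2]; split; [exact: measurableT_comp|exact: mulr_ge0|].
move=> f mf f0 /=; rewrite (h1 (f \o psi) (measurableT_comp mf m2) (fun x => f0 (psi x))).
by rewrite (h2 f mf f0) muleA EFinM.
Qed.

Section AffineLine.
Context {R : realType}.
Local Notation leb1 := (@lebesgue_measure R).

Let affine (c b : R) (x : R) := c * x + b.

Lemma measurable_affine (c b : R) :
  measurable_fun setT (affine c b : measurableTypeR R -> measurableTypeR R).
Proof. by apply: measurable_funD => //; exact: measurable_funM. Qed.

(** The pushforward, multiplied by [`|c|], agrees with Lebesgue measure on
    half-open intervals; for negative [c] their preimages are half-open on the
    other side. *)
Lemma scales_affine (c b : R) : c != 0 ->
  scales leb1 leb1 (affine c b) `|c|^-1.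
Proof.
move=> c0; have c_gt0 : 0 < `|c| by rewrite normr_gt0.
split; [exact: measurable_affine|by rewrite invr_ge0|move=> f mf f0].
pose m : {measure set (measurableTypeR R) -> \bar R} := mscale (NngNum (ltW c_gt0))
  (measure_function_pushforward__canonical__measure_function_Measure leb1
    (measurable_affine c b)).
have mE (A : set (measurableTypeR R)) : measurable A -> leb1 A = m A.
  move: A; apply: (lebesgue_measure_unique (mu := m)) => _ [[u v] _ <-] /=.
  rewrite /m /mscale /= /pushforward.
  have [uv|vu] := ltP u v; last first.
    rewrite set_itv_ge -?leNgt ?bnd_simp// preimage_set0 !measure0 mule0//.
  have [cp|cn] := ltP 0 c.
    rewrite (_ : _ @^-1` _ = `](u - b) / c, (v - b) / c]%classic); last first.
      apply/seteqP; split => x /=; rewrite !in_itv /= /affine;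
        rewrite ltr_pdivrMr// ler_pdivlMr// ltrBlDr lerBrDr (mulrC c x)//.
    rewrite !lebesgue_measure_itv /= !lte_fin uv ltr_pM2r ?invr_gt0// ltrD2r uv.
    by rewrite -!EFinB -EFinM gtr0_norm//; congr EFin; field.
  have {}cn : c < 0 by rewrite lt_neqAle c0.
  rewrite (_ : _ @^-1` _ = `[(v - b) / c, (u - b) / c[%classic); last first.
    apply/seteqP; split => x /=; rewrite !in_itv /= /affine;
      rewrite ltr_ndivlMr// ler_ndivrMr// ltrBlDr lerBrDr (mulrC c x) andbC//.
  rewrite !lebesgue_measure_itv /= !lte_fin uv ltr_nM2r ?invr_lt0// ltrD2r uv.
  by rewrite -!EFinB -EFinM ltr0_norm//; congr EFin; field.
have -> : (\int[leb1]_x f x = \int[m]_x f x)%E.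
  by apply: eq_measure_integral => A mA _; exact: mE.
rewrite ge0_integral_mscale//.
rewrite (ge0_integral_pushforward (measurable_affine c b))// preimage_setT.
rewrite muleA /= -EFinM mulVf ?mul1e// ?gt_eqF//.
Qed.

End AffineLine.

Section ConsCoordinates.
Context {R : realType}.
Implicit Types d : nat.

Lemma cons_cV0 d (p : measurableTypeR R * 'cV[R]_d) : cons_cV p ord0 0 = p.1.
Proof.
rewrite (_ : ord0 = lshift d (ord0 : 'I_1)); last exact: val_inj.
by rewrite /cons_cV (col_mxEu (const_mx p.1 : 'cV_1)) mxE.
Qed.

Lemma cons_cVS d (p : measurableTypeR R * 'cV[R]_d) i :
  cons_cV p (lift ord0 i) 0 = p.2 i 0.
Proof.
rewrite (_ : lift ord0 i = rshift 1 i); last exact: val_inj.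
by rewrite /cons_cV (col_mxEd (const_mx p.1 : 'cV_1)).
Qed.

Lemma cV_consP d (x y : 'cV[R]_d.+1) :
  x ord0 0 = y ord0 0 -> (forall i, x (lift ord0 i) 0 = y (lift ord0 i) 0) -> x = y.
Proof.
move=> h0 hS; apply/colP => i; case: (unliftP ord0 i) => [j ->|->] //.
Qed.

Lemma ge0_integral_cons d (f : 'cV[R]_d.+1 -> \bar R) :
  measurable_fun setT f -> (forall x, 0 <= f x)%E ->
  (\int[lebesgue_cV d.+1]_x f x =
   \int[lebesgue_measure]_a \int[lebesgue_cV d]_x f (cons_cV (a, x)))%E.
Proof.
move=> mf f0.
rewrite [LHS](ge0_integral_pushforward (@measurable_cons_cV R d))//.
rewrite preimage_setT.
exact: (fubini_tonelli1 _ (measurableT_comp mf (@measurable_cons_cV R d)) (fun p => f0 _)).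
Qed.

Lemma ge0_integral_cons_swap d (f : 'cV[R]_d.+1 -> \bar R) :
  measurable_fun setT f -> (forall x, 0 <= f x)%E ->
  (\int[lebesgue_cV d.+1]_x f x =
   \int[lebesgue_cV d]_x \int[lebesgue_measure]_a f (cons_cV (a, x)))%E.
Proof.
move=> mf f0.
rewrite ge0_integral_cons//.
exact: (@fubini_tonelli _ _ _ _ _ lebesgue_measure (lebesgue_cV d) (f \o @cons_cV R d)
  (measurableT_comp mf (@measurable_cons_cV R d)) (fun p => f0 _)).
Qed.

Definition diag_affine d (c b x : 'cV[R]_d) : 'cV[R]_d :=
  \col_i (c i 0 * x i 0 + b i 0).

Lemma measurable_diag_affine d (c b : 'cV[R]_d) :
  measurable_fun setT (diag_affine c b).
Proof.
apply: measurable_cVP => i; under eq_fun do rewrite mxE.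
apply: measurable_funD => //; apply: measurable_funM => //.
exact: measurable_coord_cV.
Qed.

Lemma diag_affine_cons d (c b : 'cV[R]_d.+1) (a : R) (x : 'cV[R]_d) :
  diag_affine c b (cons_cV (a, x)) =
  cons_cV (c ord0 0 * a + b ord0 0,
           diag_affine (\col_i c (lift ord0 i) 0) (\col_i b (lift ord0 i) 0) x).
Proof.
apply: cV_consP => [|i]; first by rewrite mxE !cons_cV0.
by rewrite mxE !cons_cVS /= !mxE.
Qed.

(** Induction on the dimension, one coordinate of the line at a time. *)
Lemma scales_diag_affine d (c b : 'cV[R]_d) : (forall i, c i 0 != 0) ->
  scales (lebesgue_cV d) (lebesgue_cV d) (diag_affine c b)
    (\prod_i `|c i 0|^-1).
Proof.
elim: d c b => [|d ih] c b c0.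
  split; [exact: measurable_diag_affine|by rewrite big_ord0|move=> f mf f0].
  rewrite big_ord0 mul1e; apply: eq_integral => x _; congr f.
  by apply/colP => -[].
split; [exact: measurable_diag_affine| |move=> f mf f0].
  by apply: prodr_ge0 => i _; rewrite invr_ge0.
have mfc : measurable_fun setT (f \o @cons_cV R d).
  exact: measurableT_comp mf (@measurable_cons_cV R d).
rewrite ge0_integral_cons//; last first.
  exact: measurableT_comp mf (measurable_diag_affine c b).
pose G a := (\int[lebesgue_cV d]_x f (cons_cV (a, x)))%E.
have mG : measurable_fun setT G.
  exact: (@measurable_fun_fubini_tonelli_F _ _ _ _ _ (lebesgue_cV d)
    (f \o @cons_cV R d) mfc (fun p => f0 _)).
have G0 a : (0 <= G a)%E by apply: integral_ge0.
pose c' : 'cV[R]_d := \col_i c (lift ord0 i) 0.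
pose b' : 'cV[R]_d := \col_i b (lift ord0 i) 0.
have c'0 i : c' i 0 != 0 by rewrite mxE.
have [_ K0 hc'] := ih c' b' c'0.
have [_ _ hc] := scales_affine (b ord0 0) (c0 ord0).
transitivity (\int[lebesgue_measure]_a
    ((\prod_i `|c' i 0|^-1)%:E * G (c ord0 0 * a + b ord0 0)%R))%E.
  apply: eq_integral => a _; rewrite /G.
  rewrite -(hc' (fun x => f (cons_cV (c ord0 0 * a + b ord0 0, x)))).
  - by apply: eq_integral => x _; rewrite diag_affine_cons.
  - exact: (measurableT_comp mfc (measurable_pair1 _)).
  - by move=> x.
rewrite ge0_integralZl//; last first.
  exact: (measurableT_comp mG (measurable_affine _ _)).
rewrite (hc G)// muleA -EFinM; congr (_%:E * _)%E; last by rewrite ge0_integral_cons.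
rewrite big_ord_recl mulrC; congr (_ * _).
by apply: eq_bigr => i _; rewrite mxE.
Qed.

Definition shear_map d (s : 'cV[R]_d) (x : 'cV[R]_d.+1) : 'cV[R]_d.+1 :=
  cons_cV (x ord0 0 + dotv s (uncons_cV x).2, (uncons_cV x).2).

Lemma uncons_cVE d (x : 'cV[R]_d.+1) :
  uncons_cV x = (x ord0 0, \col_i x (lift ord0 i) 0).
Proof.
have e : x = cons_cV (x ord0 0, \col_i x (lift ord0 i) 0).
  by apply: cV_consP => [|i]; rewrite ?cons_cV0 ?cons_cVS ?mxE.
by rewrite {1}e cons_cVK.
Qed.

Lemma measurable_dotv d (u : 'cV[R]_d) : measurable_fun setT (dotv u).
Proof.
apply: measurable_sum => i; apply: measurable_funM => //.
exact: measurable_coord_cV.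
Qed.

Lemma measurable_shear_map d (s : 'cV[R]_d) : measurable_fun setT (shear_map s).
Proof.
apply: measurableT_comp; first exact: measurable_cons_cV.
have m2 : measurable_fun setT (fun x : 'cV[R]_d.+1 => (uncons_cV x).2).
  exact: measurableT_comp measurable_snd (@measurable_uncons_cV R d).
apply/measurable_fun_pairP; split => //=.
apply: measurable_funD; first exact: measurable_coord_cV.
exact: measurableT_comp (measurable_dotv s) m2.
Qed.

(** For fixed values of the other coordinates the shear along the first one is
    a translation. *)
Lemma scales_shear_map d (s : 'cV[R]_d) :
  scales (lebesgue_cV d.+1) (lebesgue_cV d.+1) (shear_map s) 1.
Proof.
split; [exact: measurable_shear_map|by []|move=> f mf f0].
rewrite mul1e.
apply: (etrans (ge0_integral_cons_swap (measurableT_comp mf (measurable_shear_map s))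
  (fun x => f0 (shear_map s x)))).
apply: (etrans _ (esym (ge0_integral_cons_swap mf f0))); apply: eq_integral => x _.
have [_ _ h] := scales_affine (dotv s x) (oner_neq0 R).
have := h (fun a => f (cons_cV (a, x))); rewrite normr1 invr1 mul1e => <-//.
- by apply: eq_integral => a _; rewrite /comp /shear_map cons_cVK cons_cV0 mul1r.
- exact: (measurableT_comp mf (measurableT_comp (@measurable_cons_cV R d) (pair2_measurable _))).
Qed.

(** Tonelli's theorem in the coordinate concerned reduces this to the nullity
    of a point of the line. *)
Lemma ae_coord_neq0 d (i : 'I_d) : {ae lebesgue_cV d, forall x : 'cV[R]_d, x i 0 != 0}.
Proof.
have mi := @measurable_coord_cV R d i.
have mN e (j : 'I_e) : measurable [set x : 'cV[R]_e | x j 0 = 0].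
  rewrite (_ : mkset _ = (fun x : 'cV[R]_e => x j 0 : measurableTypeR R) @^-1` [set 0])//.
  by rewrite -[X in measurable X]setTI; exact: measurable_coord_cV.
exists [set x : 'cV[R]_d | x i 0 = 0]; split => //; last first.
  by move=> x /= /negP; rewrite negbK => /eqP.
have -> : lebesgue_cV d [set x : 'cV[R]_d | x i 0 = 0] =
    (\int[lebesgue_cV d]_x (\1_[set x : 'cV[R]_d | x i 0 = 0] x)%:E)%E.
  by rewrite integral_indic// setIT.
elim: d i mi => [[]//|d ih] i mi.
have mI (k : 'I_d.+1) : measurable_fun setT
    (fun x : 'cV[R]_d.+1 => (\1_[set x : 'cV[R]_d.+1 | x k 0 = 0] x : R)%:E).
  exact/measurable_EFinP/measurable_indic.
case: (unliftP ord0 i) => [j ->|->].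
  rewrite ge0_integral_cons//.
  rewrite integral0_eq// => a _; rewrite -[RHS](ih j (@measurable_coord_cV R d j)).
  apply: eq_integral => x _; rewrite !indicE; congr ((_ : bool)%:R%:E).
  by apply/idP/idP; rewrite !inE /= cons_cVS.
rewrite ge0_integral_cons_swap//.
rewrite integral0_eq// => x _; rewrite -[RHS](lebesgue_measure_set1 (0 : R)).
rewrite -[in RHS](setIT [set 0]) -integral_indic//.
apply: eq_integral => a _; rewrite !indicE; congr ((_ : bool)%:R%:E).
by apply/idP/idP; rewrite !inE /= cons_cV0.
Qed.

End ConsCoordinates.

(** * The Poisson kernel as a Fourier transform *)

Section PoissonLine.
Context {R : realType}.
Local Notation leb1 := (@lebesgue_measure R).

(** A primitive of [exp (-a w) (1 + cos (b w + th))]. Adding 1 to the cosine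
    keeps the integrand nonnegative, as the fundamental theorem of calculus on
    a half-line wants. *)
Let primitive (a b th w : R) : R := expR (- (a * w)) *
  (- a^-1 + (- (a * cos (b * w + th)) + b * sin (b * w + th)) / (a ^+ 2 + b ^+ 2)).

Let is_derive_primitive (a b th w : R) : 0 < a ->
  is_derive w 1 (primitive a b th) (expR (- (a * w)) * (1 + cos (b * w + th))).
Proof.
move=> a0.
have ab : a ^+ 2 + b ^+ 2 != 0 by rewrite gt_eqF// ltr_wpDr ?sqr_ge0 ?exprn_gt0.
have dl : is_derive w 1 (fun w : R => b * w + th) b.
  by apply: is_derive_eq; rewrite /GRing.scale /= mulr1 addr0.
have dc : is_derive w 1 (fun w : R => cos (b * w + th)) (- sin (b * w + th) * b).
  exact: (@is_derive1_comp _ cos (fun w => b * w + th)).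
have ds : is_derive w 1 (fun w : R => sin (b * w + th)) (cos (b * w + th) * b).
  exact: (@is_derive1_comp _ sin (fun w => b * w + th)).
have de0 : is_derive w 1 (fun w : R => - (a * w)) (- a).
  by apply: is_derive_eq; rewrite /GRing.scale /= mulr1.
have de : is_derive w 1 (fun w : R => expR (- (a * w))) (expR (- (a * w)) * - a).
  exact: (@is_derive1_comp _ expR (fun w => - (a * w))).
rewrite /primitive; apply: is_derive_eq.
rewrite /GRing.scale /=.
by field; rewrite ab gt_eqF.
Qed.

Lemma half_line_laplace_cos (a b th : R) : 0 < a ->
  (\int[leb1]_(w in `[0%R, +oo[) (expR (- (a * w)) * (1 + cos (b * w + th)))%:E =
   (a^-1 + (a * cos th - b * sin th) / (a ^+ 2 + b ^+ 2))%:E)%E.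
Proof.
move=> a0; have dP w := @is_derive_primitive a b th w a0.
have dv w : derivable (primitive a b th) w 1 by have [] := dP w.
rewrite (@ge0_continuous_FTC2y _ _ (primitive a b th) 0 0).
- rewrite -EFinB sub0r /primitive !mulr0 oppr0 expR0 mul1r !add0r.
  congr EFin; field; rewrite (gt_eqF a0) gt_eqF// ltr_wpDr ?sqr_ge0 ?exprn_gt0//.
- by move=> x _; have := cos_geN1 (b * x + th); have := expR_gt0 (- (a * x)); nra.
- apply: continuous_subspaceT => x.
  apply: cvgM; last first.
    apply: cvgD; first exact: cvg_cst.
    by apply: continuous_comp; [apply: cvgD; [apply: cvgM; [exact: cvg_cst|exact: cvg_id]|exact: cvg_cst]|exact: continuous_cos].
  by apply: continuous_comp; [apply: cvgN; apply: cvgM; [exact: cvg_cst|exact: cvg_id]|exact: continuous_expR].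
- pose K : R := a^-1 + (a + `|b|) / (a ^+ 2 + b ^+ 2).
  have ab : 0 < a ^+ 2 + b ^+ 2 by rewrite ltr_wpDr ?sqr_ge0 ?exprn_gt0.
  have hE : expR (- (a * w)) @[w --> +oo] --> (0 : R).
    have h : (a * w) @[w --> +oo] --> +oo.
      apply/cvgryPge => A; near=> w.
      by rewrite -ler_pdivrMl//; near: w; exact: nbhs_pinfty_ge.
    exact: (cvg_comp _ _ h (@cvgr_expR R)).
  have hK : (expR (- (a * w)) * K) @[w --> +oo] --> (0 : R).
    by rewrite -(mul0r K); apply: cvgM => //; exact: cvg_cst.
  apply/norm_cvg0P; apply: (squeeze_cvgr (f := fun=> 0) _ (cvg_cst 0) hK).
  near=> w; rewrite normr_ge0 /= /primitive normrM (ger0_norm (expR_ge0 _)).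
  rewrite ler_pM2l ?expR_gt0// (le_trans (ler_normD _ _))// normrN normfV.
  rewrite (gtr0_norm a0) lerD2l normrM normfV (gtr0_norm ab) ler_pM2r ?invr_gt0//.
  rewrite (le_trans (ler_normD _ _))// normrN !normrM (gtr0_norm a0) lerD//.
    by rewrite ger_pMr// ler_norml cos_geN1 cos_le1.
  by rewrite ler_piMr// ler_norml sin_geN1 sin_le1.
- by move=> x _.
- apply: cvg_at_right_filter; apply: differentiable_continuous.
  exact/derivable1_diffP.
- by move=> x _; rewrite derive1E; have [_ ->] := dP x.
Unshelve. all: by end_near. Qed.

(** The negative half-line contributes the same integral with [b] replaced by
    its opposite, so the sines cancel. *)
Let laplace_cos (a b th : R) : 0 < a ->
  (\int[leb1]_w (expR (- (a * `|w|)) * (1 + cos (b * w + th)))%:E =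
   (2 / a + 2 * a * cos th / (a ^+ 2 + b ^+ 2))%:E)%E.
Proof.
move=> a0; set f := fun w : R => expR (- (a * `|w|)) * (1 + cos (b * w + th)).
have cf : continuous f.
  move=> x; apply: cvgM; last first.
    apply: cvgD; first exact: cvg_cst.
    by apply: continuous_comp; [apply: cvgD; [apply: cvgM; [exact: cvg_cst|exact: cvg_id]|exact: cvg_cst]|exact: continuous_cos].
  by apply: continuous_comp; [apply: cvgN; apply: cvgM; [exact: cvg_cst|exact: norm_continuous]|exact: continuous_expR].
have f0 x : 0 <= f x.
  by rewrite /f; have := cos_geN1 (b * x + th); have := expR_gt0 (- (a * `|x|)); nra.
have mf : measurable_fun [set: R] f by exact: continuous_measurable_fun.
have mposnums : measurable [set x : R | 0 <= x]%R by rewrite -set_itvcy.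
rewrite -[LHS]/(\int[leb1]_w (f w)%:E)%E.
rewrite -(setUv [set x : R | 0 <= x]%R) ge0_integral_setU//= ; last 4 first.
- exact: measurableC.
- by apply/measurable_EFinP; rewrite setUv.
- by move=> x _; rewrite lee_fin.
- exact/disj_setPCl.
rewrite -set_itvcy// setCitvr.
rewrite integral_itv_bndo_bndc; last exact/measurable_EFinP/measurable_funTS.
rewrite -[in X in (_ + X)%E]oppr0 ge0_integration_by_substitutionNy//; last exact: continuous_subspaceT.
transitivity (\int[leb1]_(w in `[0%R, +oo[) (expR (- (a * w)) * (1 + cos (b * w + th)))%:E +
    \int[leb1]_(w in `[0%R, +oo[) (expR (- (a * w)) * (1 + cos (- b * w + th)))%:E)%E.
  congr (_ + _)%E; apply: eq_integral => x; rewrite inE /= in_itv /= andbT => x0.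
    by rewrite /f ger0_norm.
  by rewrite /f /= normrN ger0_norm// mulrN mulNr.
rewrite !half_line_laplace_cos// -EFinD; congr EFin; field.
by rewrite (gt_eqF a0) gt_eqF// ltr_wpDr ?sqr_ge0 ?exprn_gt0.
Qed.

(** The Poisson kernel of the half-plane at height [e]; [damp1 e] is its
    Fourier transform. *)
Definition poisson1 (e z : R) : R := e / (pi * (e ^+ 2 + z ^+ 2)).
Definition damp1 (e w : R) : R := expR (- (2 * pi * e * `|w|)).

Lemma damp1_ge0 e w : 0 <= damp1 e w. Proof. exact: expR_ge0. Qed.

Lemma continuous_damp1 e : continuous (damp1 e).
Proof.
move=> x; apply: continuous_comp; last exact: continuous_expR.
by apply: cvgN; apply: cvgM; [exact: cvg_cst|exact: norm_continuous].
Qed.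

Lemma measurable_damp1 e : measurable_fun setT (damp1 e).
Proof. exact: continuous_measurable_fun (@continuous_damp1 e). Qed.

Lemma poisson1_ge0 e z : 0 < e -> 0 <= poisson1 e z.
Proof.
by move=> e0; rewrite mulr_ge0 ?invr_ge0 ?mulr_ge0 ?pi_ge0 ?addr_ge0 ?sqr_ge0// ltW.
Qed.

Lemma measurable_poisson1 e : 0 < e -> measurable_fun setT (poisson1 e).
Proof.
move=> e0; apply: continuous_measurable_fun => x.
apply: cvgM; first exact: cvg_cst.
apply: cvgV.
  by rewrite mulf_neq0 ?gt_eqF ?pi_gt0// ltr_wpDr ?sqr_ge0 ?exprn_gt0.
apply: cvgM; first exact: cvg_cst.
apply: cvgD; first exact: cvg_cst.
exact: exprn_continuous.
Qed.

Lemma integral_damp1 e : 0 < e ->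
  (\int[leb1]_w (damp1 e w)%:E = ((pi * e)^-1)%:E)%E.
Proof.
move=> e0; have p0 := pi_gt0 R.
have a0 : 0 < 2 * pi * e by rewrite !mulr_gt0.
have := laplace_cos 0 0 a0.
under eq_integral do rewrite mul0r addr0 cos0 EFinM muleC.
rewrite ge0_integralZl//=; last exact: (proj2 (measurable_EFinP _ _) (measurable_damp1 e)).
rewrite -[X in (_ * X)%E]/(\int[leb1]_x (damp1 e x)%:E)%E => h.
have : (2^-1%:E * ((1 + 1)%:E * \int[leb1]_x (damp1 e x)%:E) = ((pi * e)^-1)%:E)%E.
  rewrite h -EFinM cos0; congr EFin.
  by move: (@pi R) p0 => p p0; field; rewrite !gt_eqF.
rewrite muleA -EFinM => <-.
by rewrite (_ : 2^-1 * (1 + 1) = 1) ?mul1e//; field.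
Qed.

Lemma integrable_damp1 e : 0 < e -> leb1.-integrable setT (EFin \o damp1 e).
Proof.
move=> e0; apply/integrable_ge0P; first exact: measurable_damp1.
- by move=> x _; exact: damp1_ge0.
- by rewrite integral_damp1// ltry.
Qed.

Lemma measurable_damp1_cos e b th : measurable_fun setT (fun w : R => damp1 e w * cos (b * w + th)).
Proof.
apply: continuous_measurable_fun => x; apply: cvgM; first exact: continuous_damp1.
by apply: continuous_comp; [apply: cvgD; [apply: cvgM; [exact: cvg_cst|exact: cvg_id]|exact: cvg_cst]|exact: continuous_cos].
Qed.

Lemma integrable_damp1_cos e b th : 0 < e ->
  leb1.-integrable setT (EFin \o (fun w => damp1 e w * cos (b * w + th))).
Proof.
move=> e0; apply: le_integrable (integrable_damp1 e0) => //.
  by apply/measurable_EFinP; exact: measurable_damp1_cos.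
move=> x _ /=; rewrite lee_fin normrM ger_pMr ?normr_gt0 ?gt_eqF ?expR_gt0//.
by rewrite ler_norml cos_geN1 cos_le1.
Qed.

(** The Fourier transform of the damping factor, with an arbitrary phase [th]
    for the induction on the dimension. *)
Lemma integral_damp1_cos e z th : 0 < e ->
  (\int[leb1]_w (damp1 e w * cos (2 * pi * (w * z) + th))%:E =
   (poisson1 e z * cos th)%:E)%E.
Proof.
move=> e0; have p0 := pi_gt0 R.
have a0 : 0 < 2 * pi * e by rewrite !mulr_gt0.
have := laplace_cos (2 * pi * z) th a0.
under eq_integral do rewrite mulrDr mulr1 EFinD.
rewrite integralD_EFin//; last 2 first.
- exact: (integrable_damp1 e0).
- exact: (integrable_damp1_cos _ _ e0).
rewrite integral_damp1//.
have ifin : (\int[leb1]_w (damp1 e w * cos (2 * pi * z * w + th))%:E)%E \is a fin_num.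
  exact: (integrable_fin_num measurableT (integrable_damp1_cos _ _ e0)).
move=> /eqP; rewrite -(fineK ifin) -EFinD eqe => /eqP h.
under eq_integral do rewrite (mulrC _ z) mulrA.
rewrite -(fineK ifin); congr EFin.
rewrite -[LHS](addKr ((pi * e)^-1)) h /poisson1.
have ez : e ^+ 2 + z ^+ 2 != 0 by rewrite gt_eqF// ltr_wpDr ?sqr_ge0 ?exprn_gt0.
clear h ifin a0; move: (@pi R) p0 => p p0.
have pez : (2 * p * e) ^+ 2 + (2 * p * z) ^+ 2 != 0.
  by rewrite gt_eqF// ltr_wpDr ?sqr_ge0// exprn_gt0// !mulr_gt0.
by field; rewrite ez pez !gt_eqF.
Qed.

Lemma integral_poisson1 : (\int[leb1]_h (poisson1 1 h)%:E = 1)%E.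
Proof.
have p0 := pi_gt0 R.
have e h : poisson1 1 h = pi^-1 * (oneDsqr h)^-1.
  by rewrite /poisson1 mul1r invfM expr1n.
rewrite ge0_symfun_integralT.
- rewrite -set_itvcy; under eq_integral do rewrite e EFinM.
  rewrite ge0_integralZl//=; last 2 first.
  + apply/measurable_EFinP; apply: measurable_funTS; apply: continuous_measurable_fun.
    exact: continuous_oneDsqrV.
  + by rewrite lee_fin invr_ge0 ltW.
  rewrite integral0y_oneDsqr -!EFinM; congr EFin.
  by move: (@pi R) p0 => p p0; field; rewrite gt_eqF.
- by move=> x; exact: poisson1_ge0.
- move=> x; rewrite (_ : poisson1 1 = fun h => pi^-1 * (oneDsqr h)^-1); last first.
    by apply/funext => y.
  by apply: cvgM; [exact: cvg_cst|exact: continuous_oneDsqrV].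
- by move=> x; rewrite /poisson1 /= sqrrN.
Qed.

Lemma poisson1_scale e h : 0 < e -> e * poisson1 e (e * h) = poisson1 1 h.
Proof.
move=> e0; rewrite /poisson1 expr1n exprMn.
have p0 := pi_gt0 R.
have h0 : 1 + h ^+ 2 != 0 by rewrite gt_eqF// ltr_wpDr ?sqr_ge0.
have eh : e ^+ 2 + (e * h) ^+ 2 != 0.
  by rewrite gt_eqF// ltr_wpDr ?sqr_ge0// exprn_gt0.
by move: (@pi R) p0 => p p0; field; rewrite h0 eh gt_eqF.
Qed.

End PoissonLine.

Section ProductFunctions.
Context {R : realType}.
Local Notation leb1 := (@lebesgue_measure R).

Definition prodf (g : R -> R) d (x : 'cV[R]_d) : R := \prod_i g (x i 0).

Lemma prodf_cons g d a (x : 'cV[R]_d) :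
  prodf g (cons_cV (a, x)) = g a * prodf g x.
Proof.
rewrite /prodf big_ord_recl cons_cV0; congr (_ * _).
by apply: eq_bigr => i _; rewrite cons_cVS.
Qed.

Lemma prodf_ge0 g d (x : 'cV[R]_d) : (forall a, 0 <= g a) -> 0 <= prodf g x.
Proof. by move=> g0; apply: prodr_ge0. Qed.

Lemma measurable_prodf (g : R -> R) d : measurable_fun setT g ->
  measurable_fun setT (@prodf g d).
Proof.
move=> mg; apply: measurable_prod => i _.
exact: (measurableT_comp mg (measurable_coord_cV i)).
Qed.

Lemma integral_prodf (g : R -> R) d (c : R) : measurable_fun setT g -> (forall a, 0 <= g a) ->
  (\int[leb1]_a (g a)%:E = c%:E)%E ->
  (\int[lebesgue_cV d]_x (prodf g x)%:E = (c ^+ d)%:E)%E.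
Proof.
move=> mg g0 gc; elim: d => [|d ih].
  rewrite /= integral_dirac//=; last first.
    by apply/measurable_EFinP; exact: measurable_prodf.
  by rewrite diracT mul1e /prodf big_ord0.
have mp d' : measurable_fun setT (fun x : 'cV[R]_d' => (prodf g x)%:E).
  by apply/measurable_EFinP; exact: measurable_prodf.
rewrite ge0_integral_cons//; last by move=> x; rewrite lee_fin prodf_ge0.
transitivity (\int[leb1]_a ((g a)%:E * (c ^+ d)%:E))%E.
  apply: eq_integral => a _; rewrite -ih -ge0_integralZl//; first last.
  - by rewrite lee_fin.
  - by move=> x _; rewrite lee_fin prodf_ge0.
  by apply: eq_integral => x _; rewrite prodf_cons EFinM.
rewrite ge0_integralZr//.
- by rewrite gc -EFinM exprS.
- by apply/measurable_EFinP.
- by move=> a _; rewrite lee_fin.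
- by rewrite lee_fin exprn_ge0// -lee_fin -gc integral_ge0// => a _; rewrite lee_fin.
Qed.

Lemma integral_cons_swap d (f : 'cV[R]_d.+1 -> R) (g : 'cV[R]_d -> R) :
  (lebesgue_cV d.+1).-integrable setT (EFin \o f) ->
  (forall x, (\int[leb1]_a (f (cons_cV (a, x)))%:E = (g x)%:E)%E) ->
  (\int[lebesgue_cV d.+1]_x (f x)%:E = \int[lebesgue_cV d]_x (g x)%:E)%E.
Proof.
move=> fi fg; have mf := measurable_int _ fi.
have fi' : (leb1 \x lebesgue_cV d)%E.-integrable setT ((EFin \o f) \o @cons_cV R d).
  apply/integrableP; split; first exact: measurableT_comp mf (@measurable_cons_cV R d).
  move/integrableP : fi => [_].
  rewrite [X in (X < _)%E -> _](ge0_integral_pushforward (@measurable_cons_cV R d))//.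
  exact: measurableT_comp.
transitivity (\int[leb1 \x lebesgue_cV d]_p ((EFin \o f) \o @cons_cV R d) p)%E.
  have fi2 : (leb1 \x lebesgue_cV d)%E.-integrable (@cons_cV R d @^-1` setT)
      ((EFin \o f) \o @cons_cV R d) by rewrite preimage_setT.
  exact: (integral_pushforward (@measurable_cons_cV R d) mf fi2 measurableT).
rewrite -integral21_prod_meas1//.
by apply: eq_integral => x _; rewrite -fg.
Qed.

End ProductFunctions.

Section PoissonKernel.
Context {R : realType}.
Local Notation leb1 := (@lebesgue_measure R).
Implicit Types (I : pred nat) (e : R).

(** The part of the scalar product carried by the coordinates in [I]; these
    are the coordinates whose exponential acts from the left. *)
Definition phase I d (w z : 'cV[R]_d) : R := \sum_(i < d | I i) w i 0 * z i 0.

Definition poisson e d := @prodf R (poisson1 e) d.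
Definition damp e d := @prodf R (damp1 e) d.

Definition tailv d (z : 'cV[R]_d.+1) : 'cV[R]_d := \col_i z (lift ord0 i) 0.

Lemma phase_cons I d a (x : 'cV[R]_d) z :
  phase I (cons_cV (a, x)) z =
  (if I 0%N then a * z ord0 0 else 0) + phase (I \o S) x (tailv z).
Proof.
rewrite /phase big_mkcond big_ord_recl cons_cV0 /=; congr (_ + _).
rewrite [RHS]big_mkcond; apply: eq_bigr => i _ /=.
by rewrite cons_cVS mxE.
Qed.

Lemma measurable_phase1 I d (z : 'cV[R]_d) : measurable_fun setT (fun w => phase I w z).
Proof.
have -> : (fun w => phase I w z) =
    (fun w => \sum_(i < d) if I i then w i 0 * z i 0 else 0).
  by apply/funext => w; exact: big_mkcond.
apply: measurable_sum => i; case: (I i); last exact: measurable_cst.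
apply: measurable_funM => //; exact: measurable_coord_cV.
Qed.

Lemma phaseC I d (w z : 'cV[R]_d) : phase I w z = phase I z w.
Proof. by apply: eq_bigr => i _; rewrite mulrC. Qed.

Lemma phaseDr I d (w z z' : 'cV[R]_d) : phase I w (z + z') = phase I w z + phase I w z'.
Proof. by rewrite /phase -big_split; apply: eq_bigr => i _; rewrite mxE mulrDr. Qed.

Lemma phaseNr I d (w z : 'cV[R]_d) : phase I w (- z) = - phase I w z.
Proof. by rewrite /phase -sumrN; apply: eq_bigr => i _; rewrite mxE mulrN. Qed.

Lemma damp_ge0 e d (w : 'cV[R]_d) : 0 <= damp e w.
Proof. by apply: prodf_ge0 => a; exact: damp1_ge0. Qed.

Lemma measurable_damp e d : measurable_fun setT (@damp e d).
Proof. by apply: measurable_prodf; exact: measurable_damp1. Qed.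

Lemma integrable_damp e d : 0 < e -> (lebesgue_cV d).-integrable setT (EFin \o @damp e d).
Proof.
move=> e0; apply/integrable_ge0P; first exact: measurable_damp.
- by move=> x _; exact: damp_ge0.
- rewrite (@integral_prodf _ _ d (pi * e)^-1) ?ltry//.
  + exact: measurable_damp1.
  + by move=> a; exact: damp1_ge0.
  + exact: integral_damp1.
Qed.

Let damp_cos e I th1 th2 d (z w : 'cV[R]_d) : R :=
  damp e w * (cos (2 * pi * phase I w z + th1) * cos (2 * pi * phase (predC I) w z + th2)).

Lemma integrable_damp_cos e I th1 th2 d (z : 'cV[R]_d) : 0 < e ->
  (lebesgue_cV d).-integrable setT (EFin \o damp_cos e I th1 th2 z).
Proof.
move=> e0; apply: le_integrable (integrable_damp d e0) => //.
  apply/measurable_EFinP; apply: measurable_funM; first exact: measurable_damp.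
  have mc : measurable_fun setT (@cos R).
    by apply: continuous_measurable_fun; exact: continuous_cos.
  by apply: measurable_funM; apply: (measurableT_comp mc); apply: measurable_funD => //;
    apply: measurable_funM => //; exact: measurable_phase1.
move=> x _ /=; rewrite lee_fin normrM (ger0_norm (damp_ge0 _ _)).
rewrite ler_piMr ?damp_ge0// normrM -[leRHS]mulr1 ler_pM// ler_norml cos_geN1 cos_le1//.
Qed.

(** Carrying two independent phases through the induction on the dimension
    makes the sine integrals vanish without being mentioned: each coordinate
    contributes one real kernel and leaves the phases alone. *)
Lemma integral_damp_cos e I th1 th2 d (z : 'cV[R]_d) : 0 < e ->
  (\int[lebesgue_cV d]_w (damp_cos e I th1 th2 z w)%:E =
   (poisson e z * (cos th1 * cos th2))%:E)%E.
Proof.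
move=> e0; elim: d I z th1 th2 => [|d ih] I z th1 th2.
  rewrite /= integral_dirac//=; last first.
    exact: (measurable_int _ (integrable_damp_cos I th1 th2 z e0)).
  rewrite diracT mul1e /damp_cos /poisson /damp /prodf /phase !big_ord0.
  by rewrite !mulr0 !add0r.
rewrite (integral_cons_swap (integrable_damp_cos I th1 th2 z e0) (g := fun x =>
  poisson1 e (z ord0 0) * damp_cos e (I \o S) th1 th2 (tailv z) x)).
  under eq_integral do rewrite EFinM.
  rewrite integralZl//; last exact: integrable_damp_cos.
  rewrite ih -EFinM; congr EFin.
  have -> : poisson e z = poisson1 e (z ord0 0) * poisson e (tailv z).
    rewrite /poisson /prodf big_ord_recl; congr (_ * _).
    by apply: eq_bigr => i _; rewrite mxE.
  exact: mulrA.
move=> x.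
have step k t : (\int[leb1]_a (k * (damp1 e a * cos (2 * pi * (a * z ord0 0) + t)))%:E =
    (k * (poisson1 e (z ord0 0) * cos t))%:E)%E.
  under eq_integral do rewrite EFinM.
  rewrite integralZl ?integral_damp1_cos//.
  have := integrable_damp1_cos (2 * pi * z ord0 0) t e0.
  by apply: eq_integrable => // a _ /=; rewrite -mulrA (mulrC (z _ _)).
rewrite /damp_cos /damp.
pose J := I \o S.
case I0 : (I 0%N).
- transitivity (\int[leb1]_a ((prodf (damp1 e) x *
      cos (2 * pi * phase (predC J) x (tailv z) + th2)) *
      (damp1 e a * cos (2 * pi * (a * z ord0 0) + (2 * pi * phase J x (tailv z) + th1))))%:E)%E.
    apply: eq_integral => a _; rewrite prodf_cons !phase_cons /= I0 /= add0r.
    by rewrite mulrDr -addrA -/J; congr EFin; ring.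
  by rewrite step; congr EFin; rewrite -/J; ring.
- transitivity (\int[leb1]_a ((prodf (damp1 e) x *
      cos (2 * pi * phase J x (tailv z) + th1)) *
      (damp1 e a * cos (2 * pi * (a * z ord0 0) + (2 * pi * phase (predC J) x (tailv z) + th2))))%:E)%E.
    apply: eq_integral => a _; rewrite prodf_cons !phase_cons /= I0 /= add0r.
    by rewrite [in cos (2 * pi * (_ + _) + _)]mulrDr -addrA -/J; congr EFin; ring.
  by rewrite step; congr EFin; rewrite -/J; ring.
Qed.

End PoissonKernel.

(** * Mean square continuity of translations *)

Section TranslationModulus.
Context {R : realType} (d : nat).
Local Notation V := ('cV[R]_d).
Local Notation leb := (lebesgue_cV d : {measure set V -> \bar R}).
Local Notation leb2 := (leb \x leb)%E.
Implicit Types (F G : V -> quat R) (e : R) (A : set V).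

(** Displacements are averaged against this probability density. *)
Definition kernel1 (h : V) : R := poisson 1 h.

Lemma kernel1_ge0 h : 0 <= kernel1 h.
Proof. by apply: prodf_ge0 => a; exact: poisson1_ge0. Qed.

Lemma measurable_kernel1 : measurable_fun setT kernel1.
Proof. by apply: measurable_prodf; exact: measurable_poisson1. Qed.

Lemma integral_kernel1 : (\int[leb]_h (kernel1 h)%:E = 1)%E.
Proof.
rewrite (@integral_prodf _ _ d 1) ?expr1n//.
- exact: measurable_poisson1.
- by move=> a; exact: poisson1_ge0.
- exact: integral_poisson1.
Qed.

Lemma measurable_translate e :
  measurable_fun setT (fun p : V * V => p.2 + e *: p.1).
Proof.
apply: measurable_cVP => i; under eq_fun do rewrite !mxE.
apply: measurable_funD.
  exact: measurableT_comp (measurable_coord_cV i) measurable_snd.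
apply: measurable_funM => //.
exact: measurableT_comp (measurable_coord_cV i) measurable_fst.
Qed.

Lemma scales_translation (t : V) : scales leb leb (fun x => x + t) 1.
Proof.
have -> : (fun x => x + t) = diag_affine (const_mx 1) t.
  by apply/funext => x; apply/colP => i; rewrite !mxE mul1r.
have := @scales_diag_affine R d (const_mx 1) t.
rewrite big1 => [|i _]; last by rewrite mxE normr1 invr1.
by apply => i; rewrite mxE oner_neq0.
Qed.

Lemma measurable_kernel1_fst : measurable_fun setT (fun p : V * V => kernel1 p.1).
Proof. exact: measurableT_comp measurable_kernel1 measurable_fst. Qed.

(** For each displacement the integral does not change, and the displacements
    have total mass 1. *)
Lemma integral_average e (g : V -> R) : measurable_fun setT g -> (forall x, 0 <= g x) ->
  (\int[leb2]_p (kernel1 p.1 * g (p.2 + e *: p.1))%:E = \int[leb]_x (g x)%:E)%E.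
Proof.
move=> mg g0.
rewrite fubini_tonelli1; last 2 first.
- apply/measurable_EFinP; apply: measurable_funM; first exact: measurable_kernel1_fst.
  exact: (measurableT_comp mg (measurable_translate e)).
- by move=> p; rewrite lee_fin mulr_ge0// kernel1_ge0.
have mgE : measurable_fun setT (fun x => (g x)%:E) by apply/measurable_EFinP.
transitivity (\int[leb]_h ((kernel1 h)%:E * \int[leb]_x (g x)%:E))%E.
  apply: eq_integral => h _; rewrite /fubini_F /=.
  under eq_integral do rewrite EFinM.
  have [mphi _ ht] := scales_translation (e *: h).
  rewrite ge0_integralZl//; first by rewrite (ht (fun x => (g x)%:E)) ?mul1e.
  - exact: (measurableT_comp mgE mphi).
  - by move=> x _; rewrite lee_fin.
  - by rewrite lee_fin kernel1_ge0.
rewrite ge0_integralZr//; first by rewrite integral_kernel1 mul1e.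
- by apply/measurable_EFinP; exact: measurable_kernel1.
- by move=> h _; rewrite lee_fin kernel1_ge0.
- by apply: integral_ge0 => x _; rewrite lee_fin.
Qed.

(** Mean square difference between [F] and its translates by [e h], the
    displacement [h] having the density of the Poisson kernel. *)
Definition shift_energy e F : \bar R :=
  (\int[leb2]_p (kernel1 p.1 * nq (F (p.2 + e *: p.1) - F p.2))%:E)%E.

Lemma measurable_translate_diff e F : measurable_quat setT F ->
  measurable_quat setT (fun p : V * V => F (p.2 + e *: p.1) - F p.2).
Proof.
move=> mF; apply: measurable_quatB.
  exact: (measurable_quat_comp (measurable_translate e) mF).
exact: (measurable_quat_comp measurable_snd mF).
Qed.

Lemma measurable_shift_energy e F : measurable_quat setT F -> measurable_fun setT
  (fun p : V * V => (kernel1 p.1 * nq (F (p.2 + e *: p.1) - F p.2))%:E).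
Proof.
move=> mF; apply/measurable_EFinP; apply: measurable_funM.
  exact: measurable_kernel1_fst.
exact: (measurable_nq (measurable_translate_diff e mF)).
Qed.

Lemma shift_energy_ge0 e F : (0 <= shift_energy e F)%E.
Proof.
by apply: integral_ge0 => p _; rewrite lee_fin mulr_ge0 ?kernel1_ge0 ?nq_ge0.
Qed.

Lemma shift_energyD e F G : measurable_quat setT F -> measurable_quat setT G ->
  (shift_energy e (fun x => F x + G x)%R <= 2%:E * (shift_energy e F + shift_energy e G))%E.
Proof.
move=> mF mG; have mFG := measurable_quatD mF mG.
have k0 := kernel1_ge0.
rewrite /shift_energy -ge0_integralD//; [|by move=> p _; rewrite lee_fin mulr_ge0 ?nq_ge0
  |exact: measurable_shift_energy|by move=> p _; rewrite lee_fin mulr_ge0 ?nq_ge0|exact: measurable_shift_energy].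
rewrite -ge0_integralZl//; first last.
- by move=> p _; rewrite -EFinD lee_fin addr_ge0// mulr_ge0 ?nq_ge0.
- by apply: emeasurable_funD; exact: measurable_shift_energy.
apply: ge0_le_integral => //.
- by move=> p _; rewrite lee_fin mulr_ge0 ?nq_ge0.
- exact: (measurable_shift_energy e mFG).
- by apply: measurable_funeM; apply: emeasurable_funD; exact: measurable_shift_energy.
- move=> p _; rewrite -EFinD -EFinM lee_fin -mulrDr mulrCA ler_wpM2l//.
  by rewrite opprD addrACA nqD_le.
Qed.

Lemma shift_energyMl e q F : measurable_quat setT F ->
  (shift_energy e (fun x => q * F x)%R = (nq q)%:E * shift_energy e F)%E.
Proof.
move=> mF; rewrite /shift_energy -ge0_integralZl//; first last.
- by rewrite lee_fin nq_ge0.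
- by move=> p _; rewrite lee_fin mulr_ge0 ?nq_ge0 ?kernel1_ge0.
- exact: measurable_shift_energy.
by apply: eq_integral => p _; rewrite -mulrBr nqM -EFinM mulrCA.
Qed.

(** Both terms of the difference have the square norm of [F] in the
    average. *)
Lemma shift_energy_le e F : sqint leb setT F -> (shift_energy e F <= 4%:E * sqn leb setT F)%E.
Proof.
move=> hF; have [mF _] := hF; have k0 := kernel1_ge0; have mnF := measurable_nq mF.
have m1 : measurable_fun setT (fun p : V * V => (kernel1 p.1 * nq (F (p.2 + e *: p.1)))%:E).
  apply/measurable_EFinP; apply: measurable_funM; first exact: measurable_kernel1_fst.
  exact: (measurableT_comp mnF (measurable_translate e)).
have m0 : measurable_fun setT (fun p : V * V => (kernel1 p.1 * nq (F p.2))%:E).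
  apply/measurable_EFinP; apply: measurable_funM; first exact: measurable_kernel1_fst.
  exact: (measurableT_comp mnF measurable_snd).
have av1 := integral_average e mnF (fun x => nq_ge0 _).
have av0 := integral_average 0 mnF (fun x => nq_ge0 _).
have {}av0 : (\int[leb2]_p (kernel1 p.1 * nq (F p.2))%:E = \int[leb]_x (nq (F x))%:E)%E.
  by rewrite -av0; apply: eq_integral => p _; rewrite scale0r addr0.
apply: (@le_trans _ _ (\int[leb2]_p (2%:E * ((kernel1 p.1 * nq (F (p.2 + e *: p.1)))%:E
    + (kernel1 p.1 * nq (F p.2))%:E)))%E).
  apply: ge0_le_integral => //.
  - by move=> p _; rewrite lee_fin mulr_ge0 ?nq_ge0.
  - exact: measurable_shift_energy.
  - by apply: measurable_funeM; exact: emeasurable_funD.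
  - move=> p _; rewrite -EFinD -EFinM lee_fin -mulrDr mulrCA ler_wpM2l//.
    by rewrite (le_trans (nqD_le _ _))// nqN.
rewrite ge0_integralZl//; last 2 first.
- exact: emeasurable_funD.
- by move=> p _; rewrite -EFinD lee_fin addr_ge0// mulr_ge0 ?nq_ge0.
rewrite ge0_integralD//; [|by move=> p _; rewrite lee_fin mulr_ge0 ?nq_ge0
  |by move=> p _; rewrite lee_fin mulr_ge0 ?nq_ge0].
rewrite av1 av0 -/(sqn leb setT F) sqnE// -EFinD -!EFinM lee_fin.
by lra.
Qed.

(** Only a sequence of heights is needed, so limits are taken along it. *)
Definition eps (k : nat) : R := k.+1%:R^-1.

Lemma eps_gt0 k : 0 < eps k. Proof. by rewrite invr_gt0. Qed.

Lemma cvg_eps : eps k @[k --> \oo] --> (0 : R).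
Proof. exact: cvg_harmonic. Qed.

Definition shift_continuous F := sqint leb setT F /\
  forall r : R, 0 < r -> \forall k \near \oo, (shift_energy (eps k) F <= r%:E)%E.

Lemma shift_continuousD F G : shift_continuous F -> shift_continuous G -> shift_continuous (fun x => F x + G x).
Proof.
move=> [hF cF] [hG cG]; split; first exact: sqintD.
move=> r r0; have r4 : 0 < r / 4 by rewrite divr_gt0.
have := cF _ r4; have := cG _ r4; apply: filterS2 => k hk1 hk2.
apply: (le_trans (shift_energyD _ _ _)); [by have [] := hF|by have [] := hG|].
apply: (@le_trans _ _ (2%:E * ((r / 4)%:E + (r / 4)%:E))%E).
  by rewrite lee_wpmul2l// leeD.
by rewrite -EFinD -EFinM lee_fin; lra.
Qed.

Lemma shift_continuousMl q F : shift_continuous F -> shift_continuous (fun x => q * F x).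
Proof.
move=> [hF cF]; split; first exact: sqintMl.
move=> r r0; have q0 := nq_ge0 q.
have rq : 0 < r / (nq q + 1) by rewrite divr_gt0// ltr_wpDl.
have := cF _ rq; apply: filterS => k hk; rewrite shift_energyMl; last by have [] := hF.
apply: (@le_trans _ _ ((nq q)%:E * (r / (nq q + 1))%:E)%E).
  by rewrite lee_wpmul2l// lee_fin.
rewrite -EFinM lee_fin mulrCA ler_piMr ?(ltW r0)//.
by rewrite ler_pdivrMr ?ltr_wpDl// mul1r lerDl.
Qed.

Lemma shift_continuous0 : shift_continuous (fun=> 0).
Proof.
split; first exact: sqint0.
move=> r r0; near=> k; rewrite /shift_energy integral0_eq ?lee_fin ?(ltW r0)// => p _.
by rewrite subrr nq0 mulr0.
Unshelve. all: by end_near. Qed.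

Lemma shift_continuous_sum m (F_ : 'I_m -> V -> quat R) :
  (forall i, shift_continuous (F_ i)) -> shift_continuous (fun x => \sum_(i < m) F_ i x).
Proof.
elim: m F_ => [|m ih] F_ h.
  by under eq_fun do rewrite big_ord0; exact: shift_continuous0.
under eq_fun do rewrite big_ord_recl.
by apply: shift_continuousD => //; exact: (ih (fun i => F_ (lift ord0 i))).
Qed.

(** The energy of [F - G] is at most four times its square norm, uniformly in
    the height. *)
Lemma shift_continuous_lim F : sqint leb setT F ->
  (forall r : R, 0 < r -> exists2 G, shift_continuous G & sqN leb setT (fun x => F x - G x) <= r) ->
  shift_continuous F.
Proof.
move=> hF h; split => // r r0.
(* Of the bound [r], half goes to [2 * 4 * (r / 16)] for [F - G] and half to
   [2 * (r / 4)] for [G]. *)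
have r16 : 0 < r / 16 by rewrite divr_gt0.
have r4 : 0 < r / 4 by rewrite divr_gt0.
have [G [hG cG] FG] := h _ r16.
have hFG := sqintB measurableT hF hG.
have := cG _ r4; apply: filterS => k hk.
have -> : F = (fun x => (F x - G x) + G x) by apply/funext => x; rewrite subrK.
apply: (le_trans (shift_energyD _ _ _)); [by have [] := hFG|by have [] := hG|].
apply: (@le_trans _ _ (2%:E * (4%:E * (r / 16)%:E + (r / 4)%:E))%E).
  rewrite lee_wpmul2l// leeD//; apply: (le_trans (shift_energy_le _ hFG)).
  by rewrite lee_wpmul2l// sqnE// lee_fin.
by rewrite -[X in (_ * (X + _))%E]EFinM -EFinD -EFinM lee_fin; lra.
Qed.

Definition indicq A (x : V) : quat R := (\1_A x : R) *: (1 : quat R).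

Lemma nq_indicq A x : nq (indicq A x) = \1_A x.
Proof.
rewrite /indicq nqZ /nq /= expr0n !addr0 expr1n mulr1 indicE.
by case: (_ \in _); rewrite ?expr1n ?expr0n.
Qed.

Lemma measurable_indicq A : measurable A -> measurable_quat setT (indicq A).
Proof.
move=> mA; apply: measurable_quatZ; last exact: measurable_quat_cst.
exact: measurable_indic.
Qed.

Lemma sqn_indicq A : measurable A -> sqn leb setT (indicq A) = leb A.
Proof.
move=> mA; rewrite /sqn; under eq_integral do rewrite nq_indicq.
by rewrite integral_indic// setIT.
Qed.

Lemma sqint_indicq A : measurable A -> (leb A < +oo)%E -> sqint leb setT (indicq A).
Proof. by move=> mA fA; split; [exact: measurable_indicq|rewrite sqn_indicq]. Qed.

(** For a set that contains the small translates of its points only those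
    points matter, because [1_A y + 1_A x - 2 1_A x 1_A y] averages to [2 (|A|
    - average of 1_A x 1_A y)], and the products converge by domination. *)
Lemma shift_continuous_open A : measurable A -> (leb A < +oo)%E ->
  (forall x h, A x -> \forall k \near \oo, A (x + eps k *: h)) ->
  shift_continuous (indicq A).
Proof.
move=> mA fA oA; have sA := sqint_indicq mA fA; split => //.
have m1A : measurable_fun setT (\1_A : V -> R) by exact: measurable_indic.
pose u k (p : V * V) : R := kernel1 p.1 * (\1_A p.2 * \1_A (p.2 + eps k *: p.1)).
pose v e (p : V * V) : R := kernel1 p.1 * \1_A (p.2 + e *: p.1).
have mv e : measurable_fun setT (v e).
  apply: measurable_funM; first exact: measurable_kernel1_fst.
  exact: (measurableT_comp m1A (measurable_translate e)).
have v0 e p : 0 <= v e p by rewrite mulr_ge0 ?kernel1_ge0.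
have iv e : (\int[leb2]_p (v e p)%:E = leb A)%E.
  by rewrite (integral_average e m1A)// integral_indic// setIT.
have fv e : leb2.-integrable setT (EFin \o v e).
  apply/integrable_ge0P => //; by rewrite iv.
have Rv e : \int[leb2]_p (v e p) = fine (leb A) by rewrite /Rintegral iv.
have v0E : v 0 = fun p => kernel1 p.1 * \1_A p.2.
  by apply/funext => p; rewrite /v scale0r addr0.
have ind01 x : 0 <= (\1_A x : R) <= 1.
  by rewrite indicE; case: (_ \in _); rewrite ?lexx ler01.
have mu_ k : measurable_fun setT (u k).
  apply: measurable_funM; first exact: measurable_kernel1_fst.
  apply: measurable_funM; first exact: (measurableT_comp m1A measurable_snd).
  exact: (measurableT_comp m1A (measurable_translate _)).
have u0 k p : 0 <= u k p <= v 0 p.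
  rewrite v0E /u; have := kernel1_ge0 p.1; have /andP[? ?] := ind01 p.2.
  have /andP[? ?] := ind01 (p.2 + eps k *: p.1) => K0.
  by rewrite !mulr_ge0//= ler_wpM2l// ler_piMr.
have fu k : leb2.-integrable setT (EFin \o u k).
  apply: le_integrable (fv 0) => //; first exact/measurable_EFinP.
  by move=> p _ /=; rewrite lee_fin; have /andP[a b] := u0 k p; rewrite !ger0_norm.
have cu : \int[leb2]_p (u k p) @[k --> \oo] --> \int[leb2]_p (v 0 p).
  apply: dominated_Rintegral (fv 0) _ => //.
  - move=> p _; rewrite v0E /u; have [Ap|Ap] := pselect (A p.2); last first.
      rewrite indicE memNset// mulr0.
      by under eq_cvg do rewrite mul0r mulr0; exact: cvg_cst.
    apply: (@cvg_near_cst _ _ _ _ _).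
    have := oA p.2 p.1 Ap; apply: filterS => k hk.
    by rewrite !indicE !mem_set// mulr1.
  - by move=> k p _; have /andP[a b] := u0 k p; rewrite ger0_norm.
have tE k : shift_energy (eps k) (indicq A) =
    (2 * (\int[leb2]_p (v 0 p) - \int[leb2]_p (u k p)))%:E.
  have e1 p : kernel1 p.1 * nq (indicq A (p.2 + eps k *: p.1) - indicq A p.2) =
      v (eps k) p + v 0 p - 2 * u k p.
    rewrite /indicq -scalerBl nqZ v0E /v /u [nq 1]/nq /= expr0n !addr0 expr1n mulr1.
    by rewrite !indicE; case: (_ \in _); case: (_ \in _) => /=; ring.
  have i2u : leb2.-integrable setT (EFin \o (fun p => 2 * u k p)).
    by have := integrableZl measurableT 2 (fu k); apply: eq_integrable.
  have ivv : leb2.-integrable setT (EFin \o (fun p => v (eps k) p + v 0 p)).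
    by have := integrableD measurableT (fv (eps k)) (fv 0); apply: eq_integrable.
  have ivvu : leb2.-integrable setT (EFin \o (fun p => v (eps k) p + v 0 p - 2 * u k p)).
    by have := integrableB measurableT ivv i2u; apply: eq_integrable.
  transitivity (\int[leb2]_p (v (eps k) p + v 0 p - 2 * u k p))%:E.
    rewrite /Rintegral fineK; last exact: integrable_fin_num.
    by apply: eq_integral => p _; rewrite e1.
  congr EFin; rewrite RintegralB// RintegralD//.
  have -> : \int[leb2]_p (2 * u k p) = 2 * \int[leb2]_p u k p by rewrite RintegralZl.
  by rewrite !Rv; ring.
move=> r r0; have r2 : 0 < r / 2 by rewrite divr_gt0.
have /cvgrPdist_le/(_ _ r2) := cu; apply: filterS => k hk.
rewrite tE lee_fin -ler_pdivlMl// mulrC; exact: le_trans (ler_norm _) hk.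
Qed.

End TranslationModulus.

Section TranslationContinuity.
Context {R : realType} (d : nat).
Local Notation V := ('cV[R]_d).
Local Notation leb := (lebesgue_cV d : {measure set V -> \bar R}).
Implicit Types (F G : V -> quat R) (A : set V).

(** Open cubes, which make every set have finite measure; being open, they
    fall under [shift_continuous_open] also after intersection with an open
    half-space. *)
Definition box (m : nat) : set V := [set x : V | forall i, `|x i 0| < m%:R].

Let box1 (m : nat) (a : R) : R := \1_(`]- m%:R, m%:R[%classic : set R) a.

Let indic_box m (x : V) : \1_(box m) x = prodf (box1 m) x.
Proof.
rewrite indicE; have [bx|bx] := boolP (x \in box m).
  rewrite /prodf big1// => i _; rewrite /box1 indicE mem_set//= in_itv /=.
  by move: bx; rewrite inE => /(_ i); rewrite ltr_norml.
have /existsNP[i /negP] : ~ (forall i, `|x i 0| < m%:R).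
  by move=> h; move: bx; rewrite notin_setE.
rewrite -leNgt => hi; rewrite /prodf (bigD1 i)//= /box1 indicE memNset ?mul0r//=.
by rewrite in_itv /= -ltr_norml; apply/negP; rewrite -leNgt.
Qed.

Let measurable_box1 m : measurable_fun setT (box1 m).
Proof. exact: measurable_indic. Qed.

Lemma measurable_box m : measurable (box m).
Proof.
rewrite (_ : box m = (@prodf R (box1 m) d) @^-1` `]0, +oo[%classic).
  rewrite -[X in measurable X]setTI; exact: (measurable_prodf (measurable_box1 m)).
apply/seteqP; split => x; rewrite /preimage /= in_itv /= andbT -indic_box indicE.
  by move=> bx; rewrite mem_set.
by case: (boolP (x \in box m)) => [|_]; [rewrite inE|rewrite ltxx].
Qed.

Lemma lebesgue_box m : (leb (box m) < +oo)%E.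
Proof.
have -> : leb (box m) = (\int[leb]_x (prodf (box1 m) x)%:E)%E.
  rewrite -[box m]setIT -integral_indic//; last exact: measurable_box.
  by apply: eq_integral => x _; rewrite indic_box.
rewrite (@integral_prodf _ _ d (m%:R - - m%:R)) ?ltry//.
rewrite integral_indic// setIT.
have := @lebesgue_measure_itv R `]- m%:R, m%:R[.
rewrite /= lte_fin; case: ltP => [_|h] ->; first by rewrite EFinB.
by have : 0 <= (m%:R : R) by []; move=> m0; congr EFin; lra.
Qed.

Lemma box_fin_ind A m : measurable A -> (leb (A `&` box m) < +oo)%E.
Proof.
move=> mA; apply: le_lt_trans (lebesgue_box m).
apply: le_measure; rewrite ?inE; [exact: measurableI mA (measurable_box m)|exact: measurable_box|exact: subIsetr].
Qed.

Lemma shift_continuous_ext F G : F =1 G -> shift_continuous F -> shift_continuous G.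
Proof. by move=> /funext ->. Qed.

Lemma cvg_translate_coord (x h : V) j :
  (x + eps k *: h) j 0 @[k --> \oo] --> x j 0.
Proof.
have -> : (fun k => (x + eps k *: h) j 0) = (fun k => x j 0 + eps k * h j 0).
  by apply/funext => k; rewrite !mxE.
rewrite -[X in _ --> X]addr0 -(mul0r (h j 0)).
apply: cvgD; first exact: cvg_cst.
by apply: cvgM; [exact: cvg_eps|exact: cvg_cst].
Qed.

Lemma near_box_translate m (x h : V) : box m x ->
  \forall k \near \oo, box m (x + eps k *: h).
Proof.
move=> xm; suff : \forall k \near \oo, forall j, `|(x + eps k *: h) j 0| < m%:R by [].
apply: filter_forall => j.
exact: (cvgr_lt _ (cvg_norm (@cvg_translate_coord x h j)) _ (xm j)).
Qed.

Lemma shift_continuous_box_halfspace m (i : 'I_d) (r : R) :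
  shift_continuous (indicq ([set x : V | x i 0 < r] `&` box m)).
Proof.
have mH : measurable [set x : V | x i 0 < r].
  rewrite (_ : mkset _ = (fun x : V => x i 0 : measurableTypeR R) @^-1` `]-oo, r[%classic).
    by rewrite -[X in measurable X]setTI; exact: measurable_coord_cV.
  by apply/seteqP; split => x; rewrite /preimage /= in_itv.
apply: shift_continuous_open; [exact: measurableI mH (measurable_box m)|exact: box_fin_ind|].
move=> x h [/= xr xm].
apply: filterI; last exact: near_box_translate.
exact: (cvgr_lt _ (@cvg_translate_coord x h i) _ xr).
Qed.

Lemma shift_continuous_box m : shift_continuous (indicq (box m)).
Proof.
apply: shift_continuous_open; [exact: measurable_box|exact: lebesgue_box|].
by move=> x h; exact: near_box_translate.
Qed.

Let good m : set (set V) := [set A | measurable A /\ shift_continuous (indicq (A `&` box m))].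

Lemma nq_indicqB A B (x y : V) :
  nq (indicq (A `|` B) x - indicq (A `|` B) y) <=
  nq (indicq A x - indicq A y) + nq (indicq B x - indicq B y).
Proof.
rewrite /indicq -!scalerBl !nqZ [nq 1]/nq /= expr0n !addr0 expr1n !mulr1.
rewrite !indicE !in_setU.
by case: (_ \in A); case: (_ \in A); case: (_ \in B); case: (_ \in B) => /=; lra.
Qed.

Lemma shift_continuous_setU A B : measurable A -> measurable B ->
  shift_continuous (indicq A) -> shift_continuous (indicq B) -> shift_continuous (indicq (A `|` B)).
Proof.
move=> mA mB [[mqA hA] cA] [[mqB hB] cB]; have mAB := measurableU _ _ mA mB.
split.
  apply: sqint_indicq => //; move: hA hB; rewrite !sqn_indicq// => hA hB.
  by apply: (le_lt_trans (measureU2 _ _ _)) => //; exact: lte_add_pinfty.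
move=> r r0; have r2 : 0 < r / 2 by rewrite divr_gt0.
have := cA _ r2; have := cB _ r2; apply: filterS2 => k hB' hA'.
apply: (@le_trans _ _ (shift_energy (eps k) (indicq A) + shift_energy (eps k) (indicq B))%E); last first.
  by rewrite (le_trans (leeD hA' hB'))// -EFinD lee_fin; lra.
have K0 := @kernel1_ge0 R d.
rewrite /shift_energy -ge0_integralD//; [|by move=> p _; rewrite lee_fin mulr_ge0 ?nq_ge0
  |exact: measurable_shift_energy|by move=> p _; rewrite lee_fin mulr_ge0 ?nq_ge0|exact: measurable_shift_energy].
apply: ge0_le_integral => //.
- by move=> p _; rewrite lee_fin mulr_ge0 ?nq_ge0.
- by apply: measurable_shift_energy; exact: measurable_indicq.
- by apply: emeasurable_funD; apply: measurable_shift_energy.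
- by move=> p _; rewrite -EFinD lee_fin -mulrDr ler_wpM2l// nq_indicqB.
Qed.

Lemma shift_continuous_Dindic m A : shift_continuous (indicq (A `&` box m)) ->
  shift_continuous (indicq ((setT `\` A) `&` box m)).
Proof.
move=> hA; have := shift_continuousD (shift_continuous_box m) (shift_continuousMl (-1) hA).
apply: shift_continuous_ext => x; rewrite mulN1r /indicq -scalerBl; congr (_ *: _).
rewrite setTD !indicE !in_setI in_setC.
by case: (_ \in A); case: (_ \in box m); rewrite /= ?subrr ?subr0.
Qed.

(** Countable unions are mean square limits of the finite ones, by domination
    inside the cube. *)
Lemma sigma_algebra_good m : sigma_algebra setT (good m).
Proof.
split.
- split; first exact: measurable0.
  rewrite set0I; apply: shift_continuous_ext (@shift_continuous0 R d) => x.
  by rewrite /indicq indicE in_set0 scale0r.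
- move=> A [mA hA]; split; first exact: measurableD.
  exact: shift_continuous_Dindic.
- move=> A hA; have mA n : measurable (A n) by have [] := hA n.
  split; first exact: bigcupT_measurable.
  pose U n := \big[setU/set0]_(i < n) A i.
  have mU n : measurable (U n) by exact: bigsetU_measurable.
  have gU n : shift_continuous (indicq (U n `&` box m)).
    rewrite /U; elim: n => [|n ih].
      rewrite big_ord0 set0I; apply: shift_continuous_ext (@shift_continuous0 R d) => x.
      by rewrite /indicq indicE in_set0 scale0r.
    rewrite big_ord_recr /= setIUl; apply: shift_continuous_setU => //.
    + exact: measurableI (mU n) (measurable_box m).
    + exact: measurableI (mA n) (measurable_box m).
    + by have [] := hA n.
  have mI B : measurable B -> measurable (B `&` box m).
    by move=> mB; exact: measurableI mB (measurable_box m).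
  have mcup : measurable (\bigcup_k A k) by exact: bigcupT_measurable.
  apply: shift_continuous_lim; first by apply: sqint_indicq; [exact: mI|exact: box_fin_ind].
  have := @sqN_dominated R _ V leb (fun n => indicq (U n `&` box m))
    (indicq (\bigcup_k A k `&` box m)) (\1_(box m))
    (fun n => measurable_indicq (mI _ (mU n))) (measurable_indicq (mI _ mcup)).
  move=> hd r r0.
  have {}hd : sqN leb setT (fun x => indicq (U k `&` box m) x
      - indicq (\bigcup_k A k `&` box m) x) @[k --> \oo] --> (0 : R).
    apply: hd.
    + move=> x; have [[j _ Ajx]|nAx] := pselect ((\bigcup_k A k) x).
        apply: cvg_near_cst; near=> n.
        rewrite /indicq !indicE !in_setI (mem_set (A := \bigcup_k A k)); last by exists j.
        rewrite (mem_set (A := U n)); first by rewrite subrr nq0.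
        rewrite /U -(bigcup_mkord n A); exists j => //=.
        by near: n; exact: nbhs_infty_gt.
      apply: cvg_near_cst; near=> n.
      rewrite /indicq !indicE !in_setI (memNset (A := \bigcup_k A k))//.
      rewrite (memNset (A := U n)); first by rewrite subrr nq0.
      by rewrite /U -(bigcup_mkord n A) => -[j _ Ajx]; apply: nAx; exists j.
    + apply/integrable_ge0P => //; first by apply: measurable_indic; exact: measurable_box.
      by rewrite integral_indic ?setIT; [exact: lebesgue_box| |exact: measurable_box].
    + move=> n x; rewrite /indicq -scalerBl nqZ [nq 1]/nq /= expr0n !addr0 expr1n mulr1.
      rewrite !indicE !in_setI.
      by case: (_ \in box m); case: (_ \in U n); case: (_ \in \bigcup_k _) => /=;
        rewrite ?subrr ?subr0 ?sub0r ?sqrrN ?expr0n ?expr1n ?lexx ?ler01.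
  have /cvgrPdist_le/(_ _ r0)[n _ /(_ n (leqnn _)) /=] := hd.
  rewrite sub0r normrN ger0_norm ?sqN_ge0// => hn.
  by exists (indicq (U n `&` box m)) => //; rewrite sqNBC.
Unshelve. all: by end_near. Qed.

(** The half-spaces [x i < r] generate the measurable sets, and they are
    open. *)
Lemma measurable_good m A : measurable A -> shift_continuous (indicq (A `&` box m)).
Proof.
move=> mA; suff : good m A by move=> [].
move: A mA; apply: smallest_sub; first exact: sigma_algebra_good.
rewrite -bigcup_seq; apply: bigcup_sub => i _ A [B mB <-]; rewrite setTI.
pose C := [set B : set R | good m ((fun x : V => x i 0) @^-1` B)].
suff : C B by [].
have [g0 gD gU] := sigma_algebra_good m.
have : (@ocitv R).-sigma.-measurable B := mB.
rewrite RGenInftyO.measurableE; move: B {mB}; apply: smallest_sub.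
  split.
  - by rewrite /C /= preimage_set0.
  - move=> B CB; rewrite /C /=.
    have -> : (fun x : V => x i 0) @^-1` (setT `\` B) =
        setT `\` (fun x : V => x i 0) @^-1` B by apply/seteqP; split.
    exact: gD.
  - by move=> B CB; rewrite /C /= preimage_bigcup; exact: gU.
move=> B [r ->]; rewrite /C /=.
have e : (fun x : V => x i 0) @^-1` `]-oo, r[ = [set x : V | x i 0 < r].
  by apply/seteqP; split => x; rewrite /preimage /= in_itv.
split.
  rewrite -[X in measurable X]setTI; apply: (measurable_coord_cV i) => //.
by rewrite e; exact: shift_continuous_box_halfspace.
Qed.

Import HBNNSimple.

(** Simple functions cut off outside a cube are finite combinations of
    indicators already treated, and they approximate [f] in mean square. *)
Lemma shift_continuous_ge0 (f : V -> R) (c : quat R) : measurable_fun setT f ->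
  (forall x, 0 <= f x) -> sqint leb setT (fun x => f x *: c) ->
  shift_continuous (fun x => f x *: c).
Proof.
move=> mf f0 hf; apply: shift_continuous_lim => // r r0.
have mfE : measurable_fun setT (fun x => (f x)%:E) by apply/measurable_EFinP.
have f0E x : setT x -> (0 <= (f x)%:E)%E by move=> _; rewrite lee_fin.
pose g n : {nnsfun V >-> R} := nnsfun_approx measurableT mfE n.
have gcvg x : g n x @[n --> \oo] --> f x.
  have := @cvg_nnsfun_approx _ _ _ _ measurableT _ mfE f0E x Logic.I.
  by move=> /fine_cvgP[_].
have gle n x : g n x <= f x.
  have nd : nondecreasing_seq (fun n => g n x).
    by move=> a b ab; have /lefP := nd_nnsfun_approx measurableT mfE ab; exact.
  have := nondecreasing_cvgn_le nd (cvgP _ (gcvg x)) n.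
  by rewrite (cvg_lim _ (gcvg x)).
pose G n (x : V) : quat R := (g n x * \1_(box n) x) *: c.
have mG n : measurable_quat setT (G n).
  apply: measurable_quatZ; last exact: measurable_quat_cst.
  by apply: measurable_funM => //; apply: measurable_indic; exact: measurable_box.
have vG n : shift_continuous (G n).
  have := @shift_continuous_sum R d _ (fun i : 'I_(size (finmap.enum_fset (fset_set (range (g n))))) =>
    let r := (finmap.enum_fset (fset_set (range (g n))))`_i in
    fun x => (r *: c) * indicq (g n @^-1` [set r] `&` box n) x).
  have h i : shift_continuous ((fun i : 'I_(size (finmap.enum_fset (fset_set (range (g n))))) =>
    let r := (finmap.enum_fset (fset_set (range (g n))))`_i in
    fun x => (r *: c) * indicq (g n @^-1` [set r] `&` box n) x) i).
    by apply: shift_continuousMl; apply: measurable_good.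
  move=> /(_ h); apply: shift_continuous_ext => x; rewrite /G fimfunEord mulr_suml scaler_suml.
  apply: eq_bigr => i _; rewrite /indicq scaleqAr mulr1 scalerA; congr (_ *: _).
  rewrite mulrC -mulrA; congr (_ * _).
  by rewrite !indicE in_setI; case: (_ \in _); case: (_ \in _); rewrite ?mul1r ?mul0r ?mulr0.
have : sqN leb setT (fun x => G k x - f x *: c) @[k --> \oo] --> (0 : R).
  apply: (@sqN_dominated _ _ _ _ _ _ (fun x => nq (f x *: c))) => //.
  - by have [] := hf.
  - move=> x; rewrite /G.
    have hx : g k x * \1_(box k) x @[k --> \oo] --> f x.
      rewrite -[X in _ --> X]mulr1; apply: cvgM => //.
      apply: cvg_near_cst; near=> k; rewrite indicE mem_set//.
      (* Any cube with half side above every coordinate of [x] will do. *)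
      near: k; exists (\sum_i Num.truncn `|x i 0|%R).+1 => // k /= hk i.
      apply: (lt_le_trans (truncnS_gt _)).
      rewrite ler_nat (leq_trans _ hk)// ltnS (bigD1 i)//= leq_addr//.
    pose a k : R := g k x * \1_(box k) x - f x.
    have h0 : a k @[k --> \oo] --> (0:R).
      by rewrite -(subrr (f x)); apply: cvgB => //; exact: cvg_cst.
    have h1 : a k * a k * nq c @[k --> \oo] --> (0 * 0 * nq c : R).
      by apply: cvgM; [exact: cvgM|exact: cvg_cst].
    rewrite !mul0r in h1.
    rewrite (_ : (fun k => _) = (fun k => a k * a k * nq c))//.
    by apply/funext => k; rewrite -scalerBl nqZ expr2.
  - exact: sqint_integrable.
  - move=> k x; rewrite /G -scalerBl !nqZ ler_wpM2r ?nq_ge0//.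
    have := f0 x; have := gle k x; have : 0 <= g k x by exact: fun_ge0.
    rewrite indicE; case: (_ \in _) => /= h1 h2 h3; rewrite ?mulr1 ?mulr0; nra.
move=> /cvgrPdist_le/(_ _ r0)[n _ /(_ n (leqnn _)) /=].
rewrite sub0r normrN ger0_norm ?sqN_ge0// => hn.
by exists (G n) => //; rewrite sqNBC.
Unshelve. all: by end_near. Qed.

Lemma shift_continuous_real (f : V -> R) (c : quat R) : measurable_fun setT f ->
  sqint leb setT (fun x => f x *: c) -> shift_continuous (fun x => f x *: c).
Proof.
move=> mf hf.
have Ih := sqint_integrable hf.
have mfp := measurable_funrpos mf; have mfn := measurable_funrneg mf.
have nqc := nq_ge0 c.
have bound (g : V -> R) : measurable_fun setT g -> (forall x, `|g x| <= `|f x|) ->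
    sqint leb setT (fun x => g x *: c).
  move=> mg gf; apply: (le_sqint _ _ Ih) => //.
    by apply: measurable_quatZ => //; exact: measurable_quat_cst.
  move=> x _; rewrite !nqZ ler_wpM2r// -(real_normK (num_real (g x))).
  by rewrite -(real_normK (num_real (f x))) lerXn2r ?nnegrE.
have hp : shift_continuous (fun x => f^\+ x *: c).
  apply: shift_continuous_ge0 => //.
  apply: (bound f^\+%R) => // x; rewrite ger0_norm ?funrpos_ge0//.
  by rewrite /funrpos ge_max ler_norm normr_ge0.
have hn : shift_continuous (fun x => f^\- x *: c).
  apply: shift_continuous_ge0 => //.
  apply: (bound f^\-%R) => // x; rewrite ger0_norm ?funrneg_ge0//.
  by rewrite /funrneg ge_max normr_ge0 andbT -normrN ler_norm.
have := shift_continuousD hp (shift_continuousMl (-1) hn); apply: shift_continuous_ext => x.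
by rewrite mulN1r -scalerBl -[in RHS](funrposBneg f).
Qed.

(** Each of the four real components is the difference of two nonnegative
    functions. *)
Theorem shift_continuous_sqint F : sqint leb setT F -> shift_continuous F.
Proof.
move=> hF; have [mF _] := hF; have Ih := sqint_integrable hF.
have [m0 m1 m2 m3] := mF.
have key (f : V -> R) c : measurable_fun setT f -> nq c = 1 ->
    (forall x, f x ^+ 2 <= nq (F x)) -> shift_continuous (fun x => f x *: c).
  move=> mf c1 h; apply: shift_continuous_real => //; apply: (le_sqint _ _ Ih) => //.
    by apply: measurable_quatZ => //; exact: measurable_quat_cst.
  by move=> x _; rewrite nqZ c1 mulr1.
have u0 : nq (Quat 1 0 0 (0:R)) = 1 by rewrite /nq /=; ring.
have u1 : nq (Quat 0 1 0 (0:R)) = 1 by rewrite /nq /=; ring.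
have u2 : nq (Quat 0 0 1 (0:R)) = 1 by rewrite /nq /=; ring.
have u3 : nq (Quat 0 0 0 (1:R)) = 1 by rewrite /nq /=; ring.
have sq (x : V) : [/\ 0 <= qre (F x) ^+ 2, 0 <= qim_i (F x) ^+ 2,
  0 <= qim_j (F x) ^+ 2 & 0 <= qim_k (F x) ^+ 2] by rewrite !sqr_ge0.
have v0 := key _ _ m0 u0 (fun x => ltac:(rewrite /nq; have [? ? ? ?] := sq x; lra)).
have v1 := key _ _ m1 u1 (fun x => ltac:(rewrite /nq; have [? ? ? ?] := sq x; lra)).
have v2 := key _ _ m2 u2 (fun x => ltac:(rewrite /nq; have [? ? ? ?] := sq x; lra)).
have v3 := key _ _ m3 u3 (fun x => ltac:(rewrite /nq; have [? ? ? ?] := sq x; lra)).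
have := shift_continuousD (shift_continuousD v0 v1) (shift_continuousD v2 v3); apply: shift_continuous_ext => x.
by apply/quatP; split=> /=; ring.
Qed.

End TranslationContinuity.

(** * The Plancherel theorem for two-sided exponentials *)

Section ProductMeasures.
Context {R : realType} d1 d2 (T1 : measurableType d1) (T2 : measurableType d2).
Variables (m1 : {sigma_finite_measure set T1 -> \bar R}).
Variables (m2 : {sigma_finite_measure set T2 -> \bar R}).

Definition sfprod : {sigma_finite_measure set (T1 * T2)%type -> \bar R} :=
  HB.pack_for {sigma_finite_measure set (T1 * T2)%type -> \bar R} (m1 \x m2)%E
    (Measure_isSigmaFinite.Build _ _ _ (m1 \x m2)%E (sigma_finite_product m1 m2)).

Lemma measurable_Rintegral_param (u : T1 * T2 -> R) : measurable_fun setT u ->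
  measurable_fun setT (fun x => \int[m2]_y u (x, y)).
Proof.
move=> mu; have muE : measurable_fun setT (EFin \o u) by apply/measurable_EFinP.
have -> : (fun x => \int[m2]_y u (x, y)) = fine \o (fun x =>
    \int[m2]_y (EFin \o u)^\+ (x, y) - \int[m2]_y (EFin \o u)^\- (x, y))%E.
  apply/funext => x; rewrite /Rintegral /= integralE.
  have -> : (fun y => (u (x, y))%:E) = (EFin \o u) \o (fun y => (x, y)) by [].
  by rewrite funepos_comp funeneg_comp.
apply: measurableT_comp; first exact: fine_measurable.
apply: emeasurable_funB.
- exact: (measurable_fun_fubini_tonelli_F _ (measurable_funepos muE) (fun p => funepos_ge0 _ p)).
- exact: (measurable_fun_fubini_tonelli_F _ (measurable_funeneg muE) (fun p => funeneg_ge0 _ p)).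
Qed.

Lemma measurable_integral_quat_param (u : T1 * T2 -> quat R) : measurable_quat setT u ->
  measurable_quat setT (fun x => integral_quat m2 setT (fun y => u (x, y))).
Proof.
move=> [u0 u1 u2 u3]; split.
- exact: (measurable_Rintegral_param u0).
- exact: (measurable_Rintegral_param u1).
- exact: (measurable_Rintegral_param u2).
- exact: (measurable_Rintegral_param u3).
Qed.

Lemma integrable_tensor (f : T1 -> R) (g : T2 -> R) :
  m1.-integrable setT (EFin \o f) -> m2.-integrable setT (EFin \o g) ->
  (m1 \x m2)%E.-integrable setT (EFin \o (fun p : T1 * T2 => f p.1 * g p.2)).
Proof.
move=> fi gi.
have mf : measurable_fun setT f by have /measurable_int/measurable_EFinP := fi.
have mg : measurable_fun setT g by have /measurable_int/measurable_EFinP := gi.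
have mfg : measurable_fun setT (EFin \o (fun p : T1 * T2 => f p.1 * g p.2)).
  apply/measurable_EFinP; apply: measurable_funM.
    exact: (measurableT_comp mf measurable_fst).
  exact: (measurableT_comp mg measurable_snd).
apply/(integrable12ltyP m1 m2 mfg).
have /integrableP[mfE foo] := fi; have /integrableP[mgE goo] := gi.
rewrite (eq_integral (fun x => (`|f x|%:E * \int[m2]_y `|(g y)%:E|)%E)); last first.
  move=> x _; rewrite -ge0_integralZl//; last exact: measurableT_comp.
  by apply: eq_integral => y _ /=; rewrite normrM EFinM.
rewrite ge0_integralZr//.
- by apply: lte_mul_pinfty => //; [exact: integral_ge0|rewrite ge0_fin_numE//; exact: integral_ge0].
- by apply/measurable_EFinP; exact: measurableT_comp.
- exact: integral_ge0.
Qed.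

(** Fubini's theorem for the square of an integral: it becomes a double
    integral over two independent variables. *)
Lemma qre_integral_mul_conj (u : T1 -> quat R) (v : T2 -> quat R) :
  iq m1 setT u -> iq m2 setT v ->
  qre (integral_quat m1 setT u * conjq (integral_quat m2 setT v)) =
    \int[(m1 \x m2)%E]_p qre (u p.1 * conjq (v p.2)) /\
  (m1 \x m2)%E.-integrable setT (EFin \o (fun p => qre (u p.1 * conjq (v p.2)))).
Proof.
move=> hu hv; set k := fun p : T1 * T2 => qre (u p.1 * conjq (v p.2)).
have mu : measurable_quat setT u by exact: iq_measurable hu.
have mv : measurable_quat setT v by exact: iq_measurable hv.
have mk : measurable_fun setT k.
  have mq : measurable_quat setT (fun p : T1 * T2 => u p.1 * conjq (v p.2)).
    apply: measurable_quatM; first exact: (measurable_quat_comp measurable_fst mu).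
    by apply: measurable_quat_conj; exact: (measurable_quat_comp measurable_snd mv).
  by have [] := mq.
have ik : (m1 \x m2)%E.-integrable setT (EFin \o k).
  apply: le_integrable (integrable_tensor (iq_modq measurableT hu) (iq_modq measurableT hv)) => //.
    exact/measurable_EFinP.
  move=> p _ /=; rewrite lee_fin normrM !(ger0_norm (modq_ge0 _)).
  by rewrite -(modq_conj (v _)); exact: qreM_le.
split => //.
have ivc := iq_conj measurableT hv.
rewrite qre_int// /Rintegral; congr fine; rewrite -integral12_prod_meas1//.
apply: eq_integral => x _; rewrite /fubini_F /=.
have i1 : m2.-integrable setT (EFin \o (fun y => qre (u x * conjq (v y)))).
  by have := ivc (u x); apply: eq_integrable => // y _ /=; rewrite qreMC.
rewrite -[RHS]fineK; last exact: (integrable_fin_num measurableT i1).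
congr EFin; rewrite -integral_quat_conj// qreMC qre_int//.
by apply: eq_Rintegral => y _; rewrite qreMC.
Qed.

End ProductMeasures.

Section FourierPlancherel.
Context {R : realType} (d : nat) (I : pred nat).
Local Notation V := ('cV[R]_d).
Local Notation leb := (lebesgue_cV d : {sigma_finite_measure set V -> \bar R}).
Implicit Types (f g : V -> quat R) (w z : V).

Definition wi w z : quat R := exp_i (- (2 * pi * phase I w z)).
Definition wj w z : quat R := exp_j (- (2 * pi * phase (predC I) w z)).

(** Coordinates in [I] are transformed by left multiplication with [exp_i],
    the others by right multiplication with [exp_j]. Keeping [I] arbitrary
    treats the two-sided transform and the one-sided transform, for which [I]
    is empty, at once. *)
Definition qF f w : quat R := integral_quat leb setT (fun z => wi w z * f z * wj w z).

Lemma measurable_phase d' (T : measurableType d') (J : pred nat) (a b : T -> V) :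
  measurable_fun setT a -> measurable_fun setT b ->
  measurable_fun setT (fun t => phase J (a t) (b t)).
Proof.
move=> ma mb.
have -> : (fun t => phase J (a t) (b t)) =
    (fun t => \sum_(i < d) if J i then a t i 0 * b t i 0 else 0).
  by apply/funext => t; exact: big_mkcond.
apply: measurable_sum => i; case: (J i); last exact: measurable_cst.
apply: measurable_funM.
- exact: (measurableT_comp (measurable_coord_cV i) ma).
- exact: (measurableT_comp (measurable_coord_cV i) mb).
Qed.

Lemma measurable_wave d' (T : measurableType d') (a b : T -> V) (h : T -> quat R) :
  measurable_fun setT a -> measurable_fun setT b -> measurable_quat setT h ->
  measurable_quat setT (fun t => wi (a t) (b t) * h t * wj (a t) (b t)).
Proof.
move=> ma mb mh; apply: measurable_quatM; first apply: measurable_quatM => //.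
- apply: measurable_exp_i; apply: measurableT_comp => //.
  by apply: measurable_funM => //; exact: measurable_phase.
- apply: measurable_exp_j; apply: measurableT_comp => //.
  by apply: measurable_funM => //; exact: measurable_phase.
Qed.

Lemma modq_wave w z q : modq (wi w z * q * wj w z) = modq q.
Proof. by rewrite !modqM modq_exp_i modq_exp_j mul1r mulr1. Qed.

Lemma iq_wave f w : iq leb setT f -> iq leb setT (fun z => wi w z * f z * wj w z).
Proof.
move=> hf; have mf : measurable_quat setT f by exact: iq_measurable hf.
apply: (le_iq measurableT _ (iq_modq measurableT hf)).
- by apply: (measurable_wave (a := fun=> w) (b := id)) => //; exact: measurable_cst.
- by move=> z _; rewrite modq_wave.
Qed.

Lemma measurable_qF f : iq leb setT f -> measurable_quat setT (qF f).
Proof.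
move=> hf; have mf : measurable_quat setT f by exact: iq_measurable hf.
apply: (@measurable_integral_quat_param _ _ _ V V leb (fun p : V * V => wi p.1 p.2 * f p.2 * wj p.1 p.2)).
apply: (measurable_wave (a := fst) (b := snd)) => //.
exact: (measurable_quat_comp measurable_snd mf).
Qed.

(** Only products of one cosine or sine of each phase occur, which is what the
    damped integrals provide. *)
Lemma qre_exp_exp (a b : R) (p q : quat R) :
  qre (exp_i a * p * exp_j b * q) =
  cos a * cos b * qre (p * q) + sin a * cos b * qre (Quat 0 1 0 0 * p * q) +
  cos a * sin b * qre (p * Quat 0 0 1 0 * q) +
  sin a * sin b * qre (Quat 0 1 0 0 * p * Quat 0 0 1 0 * q).
Proof. by rewrite !mulqE /=; ring. Qed.

(** Under the real part a factor may be moved from one end of a product to the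
    other, so the left exponentials meet although [p] and [q] stand between
    them. *)
Lemma qre_wave_pair w (x y : V) p q :
  qre ((wi w y * p * wj w y) * conjq (wi w x * q * wj w x)) =
  qre (wi w (y - x) * p * wj w (y - x) * conjq q).
Proof.
rewrite !conjqM /wi /wj conj_exp_i conj_exp_j.
rewrite -[LHS]/(qre (_ * (_ * (_ * _)))) 2![_ * (_ * exp_i _)]mulrA qreMC.
rewrite !mulrA -exp_iD -[_ * exp_j _ * exp_j _]mulrA -exp_jD.
by congr (qre (exp_i _ * _ * exp_j _ * _)); rewrite phaseDr phaseNr; ring.
Qed.

(** Integrating the damped product of two waves against the frequency leaves
    the Poisson kernel of the difference of the two positions: the three terms
    with a sine vanish, a sine being a cosine with phase [pi / 2]. *)
Lemma integral_damp_wave e (x y : V) p q : 0 < e ->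
  (\int[leb]_w (damp e w *
     qre ((wi w y * p * wj w y) * conjq (wi w x * q * wj w x)))%:E =
   (poisson e (y - x) * qre (p * conjq q))%:E)%E.
Proof.
move=> e0; set z := y - x.
pose D th1 th2 w := damp e w * (cos (2 * pi * phase I w z + th1) *
  cos (2 * pi * phase (predC I) w z + th2)).
have cs (t : R) : cos (- t) = cos (t + 0) by rewrite cosN addr0.
have sn (t : R) : sin (- t) = cos (t + pi / 2).
  by rewrite sinN cosD cos_pihalf sin_pihalf mulr0 mulr1 sub0r.
pose c1 := qre (p * conjq q); pose c2 := qre (Quat 0 1 0 0 * p * conjq q).
pose c3 := qre (p * Quat 0 0 1 0 * conjq q).
pose c4 := qre (Quat 0 1 0 0 * p * Quat 0 0 1 0 * conjq q).
have iD th1 th2 c : leb.-integrable setT (EFin \o (fun w => c * D th1 th2 w)).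
  have := integrableZl measurableT c (integrable_damp_cos I th1 th2 z e0).
  by apply: eq_integrable.
have jD th1 th2 c : (\int[leb]_w (c * D th1 th2 w)%:E =
    (c * (poisson e z * (cos th1 * cos th2)))%:E)%E.
  under eq_integral do rewrite EFinM.
  rewrite integralZl//; last exact: integrable_damp_cos.
  by rewrite integral_damp_cos.
transitivity (\int[leb]_w ((c1 * D 0 0 w)%:E + (c2 * D (pi / 2) 0 w)%:E +
    ((c3 * D 0 (pi / 2) w)%:E + (c4 * D (pi / 2) (pi / 2) w)%:E)))%E.
  apply: eq_integral => w _; rewrite qre_wave_pair -/z /wi /wj qre_exp_exp.
  by rewrite !cs !sn -!EFinD; congr EFin; rewrite /D /c1 /c2 /c3 /c4; ring.
rewrite integralD//; last 2 first.
- by apply: integrableD => //; exact: iD.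
- by apply: integrableD => //; exact: iD.
rewrite !integralD_EFin//; try exact: iD.
rewrite !jD cos_pihalf cos0 !mul0r !mulr0 !mulr1 -!EFinD; congr EFin.
by rewrite !addr0 mulrC.
Qed.

End FourierPlancherel.

Section Plancherel.
Context {R : realType} (d : nat) (I : pred nat).
Local Notation V := ('cV[R]_d).
Local Notation leb := (lebesgue_cV d : {sigma_finite_measure set V -> \bar R}).
Local Notation leb2 := (leb \x leb)%E.
Implicit Types (f g : V -> quat R) (w z : V).

Lemma measurable_poisson e : 0 < e -> measurable_fun setT (@poisson R e d).
Proof. by move=> e0; apply: measurable_prodf; exact: measurable_poisson1. Qed.

Lemma poisson_ge0 e (z : V) : 0 < e -> 0 <= poisson e z.
Proof. by move=> e0; apply: prodf_ge0 => a; exact: poisson1_ge0. Qed.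

Lemma measurable_subcV : measurable_fun setT (fun p : V * V => p.1 - p.2).
Proof.
apply: measurable_cVP => i; under eq_fun do rewrite !mxE.
apply: measurable_funB.
- exact: measurableT_comp (measurable_coord_cV i) measurable_fst.
- exact: measurableT_comp (measurable_coord_cV i) measurable_snd.
Qed.

(** Rescaling the displacement turns the kernel of parameter [e] into the
    fixed density [kernel1]. *)
Lemma integral_poisson_diff e (g : V * V -> R) : 0 < e -> measurable_fun setT g ->
  (forall p, 0 <= g p) ->
  (\int[leb2]_p (poisson e (p.1 - p.2) * g p)%:E =
   \int[leb2]_p (kernel1 p.1 * g (p.2 + e *: p.1, p.2))%:E)%E.
Proof.
move=> e0 mg g0.
have mL : measurable_fun setT (fun p : V * V => (poisson e (p.1 - p.2) * g p)%:E).
  apply/measurable_EFinP; apply: measurable_funM => //.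
  exact: (measurableT_comp (measurable_poisson e0) measurable_subcV).
have mpair : measurable_fun setT (fun p : V * V => (p.2 + e *: p.1, p.2)).
  by apply/measurable_fun_pairP; split; [exact: measurable_translate|exact: measurable_snd].
have mRr : measurable_fun setT (fun p : V * V => kernel1 p.1 * g (p.2 + e *: p.1, p.2)).
  apply: measurable_funM; first exact: measurable_kernel1_fst.
  exact: (measurableT_comp mg mpair).
have mR : measurable_fun setT (fun p : V * V => (kernel1 p.1 * g (p.2 + e *: p.1, p.2))%:E).
  exact/measurable_EFinP.
have L0 (p : V * V) : (0 <= (poisson e (p.1 - p.2) * g p)%:E)%E.
  by rewrite lee_fin mulr_ge0// poisson_ge0.
have R0 (p : V * V) : (0 <= (kernel1 p.1 * g (p.2 + e *: p.1, p.2))%:E)%E.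
  by rewrite lee_fin mulr_ge0// kernel1_ge0.
rewrite (fubini_tonelli2 _ mL L0) (fubini_tonelli2 _ mR R0).
apply: eq_integral => x _; rewrite /fubini_G /=.
have := @scales_diag_affine R d (const_mx e) x.
set K := \prod_i _ => hK.
have KE : K = \prod_(i < d) e^-1.
  by apply: eq_bigr => i _; rewrite mxE gtr0_norm.
have K0 : 0 < K by rewrite KE; apply: prodr_gt0 => i _; rewrite invr_gt0.
have {hK} [_ _ hs] := hK (fun i => ltac:(by rewrite mxE gt_eqF)).
have := hs (fun y : V => (poisson e (y - x) * g (y, x))%:E).
have m1 : measurable_fun setT (fun y : V => (poisson e (y - x) * g (y, x))%:E).
  exact: (measurableT_comp mL (pair2_measurable x)).
move=> /(_ m1 (fun y => L0 (y, x))) h.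
have {h} : (K%:E * \int[leb]_h (kernel1 h * g (x + e *: h, x))%:E =
    K%:E * \int[leb]_y (poisson e (y - x) * g (y, x))%:E)%E.
  rewrite -h -ge0_integralZl//; first last.
  - by rewrite lee_fin ltW.
  - by move=> y _; exact: (R0 (y, x)).
  - exact: (measurableT_comp mR (pair2_measurable x)).
  apply: eq_integral => y _; rewrite -EFinM.
  have -> : diag_affine (const_mx e) x y = x + e *: y.
    by apply/colP => i; rewrite !mxE addrC.
  rewrite addrAC subrr add0r mulrA; congr (_ * _)%:E.
  rewrite KE /kernel1 /poisson /prodf -big_split; apply: eq_bigr => i _ /=.
  rewrite mxE -(poisson1_scale (y i 0) e0) mulrA mulVf ?mul1r// gt_eqF//.
move=> /(congr1 (fun t => ((K^-1)%:E * t)%E)).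
by rewrite !muleA -!EFinM mulVf ?gt_eqF// !mul1e => ->.
Qed.

(** Squaring the transform and integrating over the frequency first gives [qre
    (f y conj (f x))] averaged against the Poisson kernel of [y - x]; the
    identity [2 qre (p conj q) = nq p + nq q - nq (p - q)] turns this average
    into a norm minus half the energy. *)
Lemma integral_damp_nq_qF e f : 0 < e -> iq leb setT f -> sqint leb setT f ->
  (\int[leb]_w (damp e w * nq (qF I f w))%:E =
   (sqN leb setT f - fine (shift_energy e f) / 2)%:E)%E.
Proof.
move=> e0 hf hs; have [mf _] := hs.
pose W (w : V) (z : V) := wi I w z * f z * wj I w z.
pose K (q : V * (V * V)) : R :=
  damp e q.1 * qre (W q.1 q.2.1 * conjq (W q.1 q.2.2)).
have m21 : measurable_fun setT (fun q : V * (V * V) => q.2.1).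
  exact: measurableT_comp measurable_fst measurable_snd.
have m22 : measurable_fun setT (fun q : V * (V * V) => q.2.2).
  exact: measurableT_comp measurable_snd measurable_snd.
have m1 : measurable_fun setT (fun q : V * (V * V) => q.1) by exact: measurable_fst.
have mK : measurable_fun setT K.
  apply: measurable_funM; first exact: (measurableT_comp (@measurable_damp R e d) m1).
  have mq : measurable_quat setT (fun q : V * (V * V) => W q.1 q.2.1 * conjq (W q.1 q.2.2)).
    apply: measurable_quatM; last apply: measurable_quat_conj.
    - by apply: (measurable_wave I m1 m21); exact: (measurable_quat_comp m21 mf).
    - by apply: (measurable_wave I m1 m22); exact: (measurable_quat_comp m22 mf).
  by have [] := mq.
have imod := iq_modq measurableT hf.
have iT := integrable_tensor (m2 := sfprod leb leb) (integrable_damp d e0)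
  (integrable_tensor imod imod).
have iK : (leb \x sfprod leb leb)%E.-integrable setT (EFin \o K).
  apply: le_integrable iT => //; first exact/measurable_EFinP.
  move=> q _ /=; rewrite lee_fin !normrM (ger0_norm (damp_ge0 _ _)).
  rewrite ler_wpM2l ?damp_ge0// !(ger0_norm (modq_ge0 _)).
  apply: (le_trans (qreM_le _ _)).
  by rewrite modq_conj !modq_wave.
have step1 w : (damp e w * nq (qF I f w))%:E = (\int[sfprod leb leb]_p (K (w, p))%:E)%E.
  have hw := iq_wave I w hf.
  have [h1 h2] := qre_integral_mul_conj hw hw.
  rewrite -qre_mul_conj h1 /K /=.
  under [RHS]eq_integral do rewrite EFinM.
  rewrite [RHS]integralZl//.
  by rewrite EFinM; congr (_ * _)%E; rewrite fineK//; exact: integrable_fin_num.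
under eq_integral do rewrite step1.
rewrite (Fubini iK).
pose P (p : V * V) := poisson e (p.1 - p.2).
have step2 (p : V * V) : (\int[leb]_w (K (w, p))%:E =
    (P p * qre (f p.1 * conjq (f p.2)))%:E)%E.
  by rewrite -(integral_damp_wave I p.2 p.1 (f p.1) (f p.2) e0).
under eq_integral do rewrite step2.
have mP : measurable_fun setT P.
  exact: (measurableT_comp (measurable_poisson e0) measurable_subcV).
have P0 p : 0 <= P p by exact: poisson_ge0.
have mn := measurable_nq mf.
have mn1 : measurable_fun setT (fun p : V * V => nq (f p.1)) by exact: (measurableT_comp mn measurable_fst).
have mn2 : measurable_fun setT (fun p : V * V => nq (f p.2)) by exact: (measurableT_comp mn measurable_snd).
have mn12 : measurable_fun setT (fun p : V * V => nq (f p.1 - f p.2)).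
  apply: measurable_nq; apply: measurable_quatB.
  - exact: (measurable_quat_comp measurable_fst mf).
  - exact: (measurable_quat_comp measurable_snd mf).
have Ia : (\int[leb2]_p (P p * nq (f p.1))%:E = (sqN leb setT f)%:E)%E.
  rewrite (integral_poisson_diff e0 mn1)//=; last by move=> p; exact: nq_ge0.
  by rewrite (integral_average e mn (fun x => nq_ge0 _)) -sqnE.
have Ib : (\int[leb2]_p (P p * nq (f p.2))%:E = (sqN leb setT f)%:E)%E.
  rewrite (integral_poisson_diff e0 mn2)//=; last by move=> p; exact: nq_ge0.
  rewrite -sqnE// /sqn -(integral_average 0 mn (fun x => nq_ge0 _)).
  by apply: eq_integral => p _; rewrite scale0r addr0.
have tfin : shift_energy e f \is a fin_num.
  rewrite ge0_fin_numE ?shift_energy_ge0//; apply: (le_lt_trans (shift_energy_le e hs)).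
  by rewrite sqnE// -EFinM ltry.
have It : (\int[leb2]_p (P p * nq (f p.1 - f p.2))%:E = (fine (shift_energy e f))%:E)%E.
  rewrite (integral_poisson_diff e0 mn12)//=; last by move=> p; exact: nq_ge0.
  by rewrite fineK.
have fin (u : V * V -> R) c : measurable_fun setT u -> (forall p, 0 <= u p) ->
    (\int[leb2]_p (P p * u p)%:E = c%:E)%E ->
    leb2.-integrable setT (EFin \o (fun p => P p * u p)) /\ \int[leb2]_p (P p * u p) = c.
  move=> mu u0 h; split; last by rewrite /Rintegral h.
  apply/integrable_ge0P; [exact: measurable_funM|by move=> p _; rewrite mulr_ge0|].
  by rewrite h ltry.
have [ia Ra] := fin _ _ mn1 (fun p => nq_ge0 _) Ia.
have [ib Rb] := fin _ _ mn2 (fun p => nq_ge0 _) Ib.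
have [it Rt] := fin _ _ mn12 (fun p => nq_ge0 _) It.
have iab := integrableD measurableT ia ib.
have iabt := integrableB measurableT iab it.
have E (p : V * V) : P p * qre (f p.1 * conjq (f p.2)) =
    2^-1 * (P p * nq (f p.1) + P p * nq (f p.2) - P p * nq (f p.1 - f p.2)).
  by rewrite nqD nqN conjqN mulrN qreN; field.
rewrite (eq_integral (fun p => (2^-1)%:E *
  ((P p * nq (f p.1))%:E + (P p * nq (f p.2))%:E - (P p * nq (f p.1 - f p.2))%:E))%E); last first.
  by move=> p _; rewrite E EFinM EFinB EFinD.
rewrite integralZl// integralB// integralD// Ia Ib It.
rewrite -[LHS]/((2^-1 * (sqN leb setT f + sqN leb setT f - fine (shift_energy e f)))%:E).
by congr EFin; field.
Qed.

Lemma cvg_shift_energy f : sqint leb setT f ->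
  fine (shift_energy (eps k) f) @[k --> \oo] --> (0 : R).
Proof.
move=> hf; have [_ h] := shift_continuous_sqint hf.
apply/cvgrPdist_le => r r0; have := h _ r0; apply: filterS => k hk.
have tfin : shift_energy (eps k) f \is a fin_num.
  by rewrite ge0_fin_numE ?shift_energy_ge0// (le_lt_trans hk)// ltry.
by rewrite sub0r normrN ger0_norm ?fine_ge0 ?shift_energy_ge0// -lee_fin fineK.
Qed.

Lemma dampE e (w : V) : damp e w = expR (- (2 * pi * e * \sum_i `|w i 0|)).
Proof. by rewrite mulr_sumr -sumrN expR_sum. Qed.

Lemma damp_le1 e (w : V) : 0 < e -> damp e w <= 1.
Proof.
move=> e0; rewrite dampE -expR0 ler_expR oppr_le0 !mulr_ge0 ?pi_ge0 ?(ltW e0)//.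
exact: sumr_ge0.
Qed.

Lemma cvg_damp (w : V) : damp (eps k) w @[k --> \oo] --> (1 : R).
Proof.
set c := \sum_i `|w i 0|.
have h : - (2 * pi * eps k * c) @[k --> \oo] --> (- (2 * pi * 0 * c) : R).
  apply: cvgN; apply: cvgM; last exact: cvg_cst.
  by apply: cvgM; [exact: cvg_cst|exact: cvg_eps].
rewrite mulr0 mul0r oppr0 in h.
have := cvg_comp _ _ h (@continuous_expR R _); rewrite expR0.
by rewrite (_ : (fun k => damp (eps k) w) = expR \o (fun k => - (2 * pi * eps k * c)))//;
  apply/funext => k; rewrite dampE.
Qed.

(** As the height tends to 0 the damping factors increase to 1 and the energy
    tends to 0. Fatou's lemma gives one inequality, and [damp <= 1] the
    other. *)
Theorem plancherel f : iq leb setT f -> sqint leb setT f ->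
  sqint leb setT (qF I f) /\ sqN leb setT (qF I f) = sqN leb setT f.
Proof.
move=> hf hs.
have mF := measurable_qF I hf; have mnF := measurable_nq mF.
pose S := sqN leb setT f.
pose a k := S - fine (shift_energy (eps k) f) / 2.
have ca : a k @[k --> \oo] --> S.
  rewrite -[X in _ --> X]subr0 -(mul0r 2^-1); apply: cvgB; first exact: cvg_cst.
  by apply: cvgM; [exact: cvg_shift_energy|exact: cvg_cst].
have ha k : (\int[leb]_w (damp (eps k) w * nq (qF I f w))%:E = (a k)%:E)%E.
  exact: (integral_damp_nq_qF (@eps_gt0 R k) hf hs).
have md k : measurable_fun setT (fun w : V => damp (eps k : R) w * nq (qF I f w)).
  by apply: measurable_funM => //; exact: measurable_damp.
have up : (sqn leb setT (qF I f) <= S%:E)%E.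
  apply: (fatou_le (u_ := fun k w => damp (eps k) w * nq (qF I f w)) (a_ := a)) => //.
  - by move=> k w _; rewrite mulr_ge0 ?damp_ge0 ?nq_ge0.
  - move=> w _; rewrite -[X in _ --> X]mul1r; apply: cvgM; [exact: cvg_damp|exact: cvg_cst].
  - by move=> k; rewrite ha.
have sF : sqint leb setT (qF I f) by split => //; exact: le_lt_trans up (ltry _).
split => //; apply/eqP; rewrite eq_le; apply/andP; split.
  by rewrite -lee_fin -sqnE.
have le_a k : a k <= sqN leb setT (qF I f).
  rewrite -lee_fin -ha -sqnE//; apply: ge0_le_integral => //.
  - by move=> w _; rewrite lee_fin mulr_ge0 ?damp_ge0 ?nq_ge0.
  - exact/measurable_EFinP.
  - exact/measurable_EFinP.
  - by move=> w _; rewrite lee_fin ler_piMl ?nq_ge0// damp_le1// eps_gt0.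
apply: (cvgr_to_le ca); near=> k; exact: le_a.
Unshelve. all: by end_near. Qed.

End Plancherel.

(** * Extension of the transform to square-integrable functions *)

Section SquareIntegrableTransform.
Context {R : realType} (d : nat) (I : pred nat).
Local Notation V := ('cV[R]_d).
Local Notation leb := (lebesgue_cV d : {sigma_finite_measure set V -> \bar R}).
Local Notation sqN := (sqN leb setT).
Local Notation qF := (@qF R d I).
Implicit Types (f g : V -> quat R) (w z : V).

Definition L1L2 f := iq leb setT f /\ sqint leb setT f.

Lemma L1L2D f g : L1L2 f -> L1L2 g -> L1L2 (fun x => f x + g x).
Proof. by move=> [? ?] [? ?]; split; [exact: iqD|exact: sqintD]. Qed.

Lemma L1L2B f g : L1L2 f -> L1L2 g -> L1L2 (fun x => f x - g x).
Proof. by move=> [? ?] [? ?]; split; [exact: iqB|exact: sqintB]. Qed.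

Lemma L1L2Ml q f : L1L2 f -> L1L2 (fun x => q * f x).
Proof. by move=> [? ?]; split; [exact: iqMl|exact: sqintMl]. Qed.

Lemma sqint_qF f : L1L2 f -> sqint leb setT (qF f).
Proof. by move=> [? ?]; have [] := @plancherel R d I f. Qed.

Lemma sqN_qF f : L1L2 f -> sqN (qF f) = sqN f.
Proof. by move=> [? ?]; have [] := @plancherel R d I f. Qed.

Lemma qFD f g w : iq leb setT f -> iq leb setT g ->
  qF (fun x => f x + g x) w = qF f w + qF g w.
Proof.
move=> hf hg; rewrite /qF -integral_quatD//; try exact: iq_wave.
by apply: eq_integral_quat => z _; rewrite mulrDr mulrDl.
Qed.

Lemma qFB f g w : iq leb setT f -> iq leb setT g ->
  qF (fun x => f x - g x) w = qF f w - qF g w.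
Proof.
move=> hf hg; rewrite /qF -integral_quatB//; try exact: iq_wave.
by apply: eq_integral_quat => z _; rewrite mulrBr mulrBl.
Qed.

Lemma sqN_qFB f g : L1L2 f -> L1L2 g ->
  sqN (fun w => qF f w - qF g w) = sqN (fun x => f x - g x).
Proof.
move=> hf hg; rewrite -(sqN_qF (L1L2B hf hg)); apply: eq_sqN => w _.
by rewrite qFB; [|case: hf|case: hg].
Qed.

(** Graph of the continuous extension of [qF]; as a relation, it needs no
    choice of representatives modulo null sets. *)
Definition is_FT f g := sqint leb setT g /\
  exists f_ : nat -> V -> quat R, [/\ forall k, L1L2 (f_ k),
    sqN (fun x => f_ k x - f x) @[k --> \oo] --> (0 : R) &
    sqN (fun w => qF (f_ k) w - g w) @[k --> \oo] --> (0 : R)].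

Lemma sqN_tri0 (u_ v_ : nat -> V -> quat R) g :
  (forall k, sqint leb setT (u_ k)) -> (forall k, sqint leb setT (v_ k)) ->
  sqint leb setT g ->
  sqN (fun x => u_ k x - v_ k x) @[k --> \oo] --> (0 : R) ->
  sqN (fun x => v_ k x - g x) @[k --> \oo] --> (0 : R) ->
  sqN (fun x => u_ k x - g x) @[k --> \oo] --> (0 : R).
Proof.
move=> hu hv hg h1 h2.
have h3 : 2 * (sqN (fun x => u_ k x - v_ k x) + sqN (fun x => v_ k x - g x))
    @[k --> \oo] --> (2 * (0 + 0) : R).
  by apply: cvgM; [exact: cvg_cst|exact: cvgD].
rewrite addr0 mulr0 in h3.
apply: (squeeze_cvgr (f := fun=> 0) _ (cvg_cst 0) h3).
by near=> k; rewrite sqN_ge0 sqNB_le.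
Unshelve. all: by end_near. Qed.

(** The transforms of an approximating sequence form a Cauchy sequence,
    because [qF] is isometric. *)
Lemma is_FT_ex f : sqint leb setT f -> exists g, is_FT f g.
Proof.
move=> hf; have [f_ [h1 h2 cf _]] := dense_L1_L2 hf.
have hL k : L1L2 (f_ k) by split.
have [g hg cg] : exists2 g, sqint leb setT g &
    sqN (fun w => qF (f_ k) w - g w) @[k --> \oo] --> (0 : R).
  apply: L2_complete; first by move=> k; exact: sqint_qF.
  move=> e e0; have e4 : 0 < e / 8 by rewrite divr_gt0.
  have /cvgrPdist_le/(_ _ e4)[N _ hN] := cf.
  exists N => k l Nk Nl; rewrite sqN_qFB//.
  apply: (le_lt_trans (sqNB_le (g := f) _ _ _ _)) => //.
  have := hN k Nk; have := hN l Nl; rewrite /= !sub0r !normrN.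
  by rewrite !ger0_norm ?sqN_ge0// (sqNBC _ _ f (f_ l)) => ? ?; lra.
by exists g; split => //; exists f_.
Qed.

Lemma is_FT_unique f g g' : sqint leb setT f -> is_FT f g -> is_FT f g' ->
  {ae leb, forall w, g w = g' w}.
Proof.
move=> hf [hg [f_ [L cf cg]]] [hg' [f'_ [L' cf' cg']]].
have h2 k : sqint leb setT (f_ k) by have [] := L k.
have h2' k : sqint leb setT (f'_ k) by have [] := L' k.
have cff : sqN (fun x => f'_ k x - f_ k x) @[k --> \oo] --> (0 : R).
  have h3 : 2 * (sqN (fun x => f'_ k x - f x) + sqN (fun x => f_ k x - f x))
      @[k --> \oo] --> (2 * (0 + 0) : R).
    by apply: cvgM; [exact: cvg_cst|exact: cvgD].
  rewrite addr0 mulr0 in h3.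
  apply: (squeeze_cvgr (f := fun=> 0) _ (cvg_cst 0) h3).
  near=> k; rewrite sqN_ge0/= (sqNBC _ _ (f_ k) f); exact: sqNB_le.
have cg2 : sqN (fun w => qF (f'_ k) w - g w) @[k --> \oo] --> (0 : R).
  apply: (sqN_tri0 (v_ := fun k => qF (f_ k))) => //.
  - by move=> k; exact: sqint_qF.
  - by move=> k; exact: sqint_qF.
  - rewrite (_ : (fun k => _) = fun k => sqN (fun x => f'_ k x - f_ k x))//.
    by apply/funext => k; rewrite sqN_qFB.
have := @sqN_lim_unique _ _ _ leb setT measurableT (fun k => qF (f'_ k)) g g'
  (fun k => sqint_qF (L' k)) hg hg' cg2 cg'.
by apply: filterS => w; apply.
Unshelve. all: by end_near. Qed.

Lemma is_FT_sqN f g : sqint leb setT f -> is_FT f g -> sqN g = sqN f.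
Proof.
move=> hf [hg [f_ [L cf cg]]].
have c1 := sqNB_cvg_sqN measurableT (fun k => proj2 (L k)) hf cf.
have c2 := sqNB_cvg_sqN measurableT (fun k => sqint_qF (L k)) hg cg.
have e : (fun k => sqN (qF (f_ k))) = (fun k => sqN (f_ k)).
  by apply/funext => k; rewrite sqN_qF.
rewrite e in c2; exact: (cvg_unique _ c2 c1).
Qed.

End SquareIntegrableTransform.

(** * Even functions with values in the complex line of [j] *)

Section EvenComplexFunctions.
Context {R : realType} (d : nat) (I : pred nat).
Local Notation V := ('cV[R]_d).
Local Notation leb := (lebesgue_cV d : {sigma_finite_measure set V -> \bar R}).
Local Notation sqN := (sqN leb setT).
Implicit Types (f g : V -> quat R) (w z : V).

(** Changing the sign of the coordinates in [I] conjugates the left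
    exponentials. *)
Definition mirror z : V := \col_i (if I i then - z i 0 else z i 0).

Lemma mirrorK : involutive mirror.
Proof. by move=> z; apply/colP => i; rewrite !mxE; case: (I i); rewrite ?opprK. Qed.

Lemma scales_mirror : scales leb leb mirror 1.
Proof.
pose c : V := \col_i (if I i then -1 else 1).
have := @scales_diag_affine R d c 0.
have -> : diag_affine c 0 = mirror.
  apply/funext => z; apply/colP => i; rewrite !mxE addr0.
  by case: (I i); rewrite ?mulN1r ?mul1r.
rewrite big1 => [|i _]; first by apply => i; rewrite mxE; case: (I i); rewrite ?oppr_eq0 oner_neq0.
by rewrite mxE; case: (I i); rewrite ?normrN normr1 invr1.
Qed.

Lemma scales_opp : scales leb leb (fun x : V => - x) 1.
Proof.
have := @scales_diag_affine R d (const_mx (-1)) 0.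
have -> : diag_affine (const_mx (-1)) 0 = (fun x : V => - x).
  by apply/funext => z; apply/colP => i; rewrite !mxE addr0 mulN1r.
rewrite big1 => [|i _]; first by apply => i; rewrite mxE oppr_eq0 oner_neq0.
by rewrite mxE normrN normr1 invr1.
Qed.

Lemma phase_mirror w z : phase I w (mirror z) = - phase I w z.
Proof. by rewrite /phase -sumrN; apply: eq_bigr => i Ii; rewrite mxE Ii mulrN. Qed.

Lemma phaseC_mirror w z : phase (predC I) w (mirror z) = phase (predC I) w z.
Proof. by apply: eq_bigr => i /negbTE /= Ii; rewrite mxE Ii. Qed.

Lemma wi_mirror w z : wi I w (mirror z) = wi I (mirror w) z.
Proof. by rewrite /wi phase_mirror [phase I (mirror w) z]phaseC phase_mirror (phaseC _ z). Qed.

Lemma wj_mirror w z : wj I w (mirror z) = wj I (mirror w) z.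
Proof. by rewrite /wj phaseC_mirror [phase _ (mirror w) z]phaseC phaseC_mirror (phaseC _ z). Qed.

Lemma iq_mirror f : iq leb setT f -> iq leb setT (f \o mirror).
Proof. exact: scales_iq scales_mirror. Qed.

Lemma integral_quat_mirror f : iq leb setT f ->
  integral_quat leb setT (f \o mirror) = integral_quat leb setT f.
Proof. by move=> hf; rewrite (scales_integral_quat scales_mirror hf) scale1r. Qed.

Lemma qF_mirror f w : iq leb setT f -> qF I (f \o mirror) w = qF I f (mirror w).
Proof.
move=> hf; rewrite /qF -[RHS]integral_quat_mirror; last exact: iq_wave.
by apply: eq_integral_quat => z _ /=; rewrite -wi_mirror -wj_mirror mirrorK.
Qed.

Lemma exp_i_j (t : R) : exp_i t * unit_j = unit_j * exp_i (- t).
Proof. by rewrite !mulqE /= cosN sinN; apply/quatP; split=> /=; ring. Qed.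

(** Moving [j] across an exponential of [i] conjugates the exponential, which
    amounts to reflecting the frequency. *)
Lemma qF_unit_jl f w : iq leb setT f ->
  qF I (fun x => unit_j * f x) w = unit_j * qF I f (mirror w).
Proof.
move=> hf; rewrite /qF -integral_quatMl//; last exact: iq_wave.
apply: eq_integral_quat => z _; rewrite -wi_mirror -wj_mirror /wj phaseC_mirror -/(wj I w z).
by rewrite !mulrA /wi phase_mirror mulrN opprK exp_i_j opprK.
Qed.

Lemma exp_j_j (t : R) : exp_j t * unit_j = unit_j * exp_j t.
Proof. by rewrite !mulqE /=; apply/quatP; split=> /=; ring. Qed.

Lemma qF_unit_jr f w : iq leb setT f ->
  qF I (fun x => f x * unit_j) w = qF I f w * unit_j.
Proof.
move=> hf; rewrite /qF -integral_quatMr//; last exact: iq_wave.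
by apply: eq_integral_quat => z _; rewrite -!mulrA /wj -exp_j_j.
Qed.

Lemma qFZ (r : R) f w : iq leb setT f -> qF I (fun x => r *: f x) w = r *: qF I f w.
Proof.
move=> hf; rewrite /qF -integral_quatZ//; last exact: iq_wave.
by apply: eq_integral_quat => z _; rewrite scaleqAr scaleqAl.
Qed.

(** Orthogonal projection of the quaternions onto the complex line spanned by
    [1] and [j]. *)
Definition prj (q : quat R) : quat R := Quat (qre q) 0 (qim_j q) 0.

Lemma prjE q : prj q = 2^-1 *: (q - unit_j * q * unit_j).
Proof. by rewrite !mulqE; apply/quatP; split=> /=; field. Qed.

(** Orthogonal projection onto the functions that are even in the coordinates
    of [I] and have values in the line of [1] and [j]. *)
Definition evenj f z : quat R := 2^-1 *: (prj (f z) + prj (f (mirror z))).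

Lemma iq_evenj f : iq leb setT f -> iq leb setT (evenj f).
Proof.
move=> hf; have h1 g : iq leb setT g -> iq leb setT (fun z => prj (g z)).
  move=> hg; have mg := iq_measurable hg.
  apply: (le_iq measurableT _ (iq_modq measurableT hg)).
    by have [? ? ? ?] := mg; split.
  move=> x _; rewrite /modq ler_wsqrtr// /prj /= expr0n !addr0 -!addrA lerD2l.
  by rewrite addrCA lerDl addr_ge0 ?sqr_ge0.
have h2 : iq leb setT (fun z => prj (f z) + prj (f (mirror z))).
  by apply: iqD => //; [exact: (h1 f)|exact: (h1 (f \o mirror) (iq_mirror hf))].
have := iqMl measurableT ((2^-1 : R) *: (1 : quat R)) h2.
by under eq_fun do rewrite scaleqAl mul1r.
Qed.

Lemma nq_prj q : nq (prj q) <= nq q.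
Proof.
rewrite /nq /prj /= expr0n !addr0 -!addrA lerD2l.
by rewrite addrCA lerDl addr_ge0 ?sqr_ge0.
Qed.

Lemma nq_evenj_le f z : nq (evenj f z) <= 2^-1 * (nq (f z) + nq (f (mirror z))).
Proof.
rewrite /evenj nqZ; have := nqD_le (prj (f z)) (prj (f (mirror z))).
by have := nq_prj (f z); have := nq_prj (f (mirror z)); nra.
Qed.

Lemma measurable_evenj f : measurable_quat setT f -> measurable_quat setT (evenj f).
Proof.
move=> mf; have [mr _ _] := scales_mirror.
have mfr := measurable_quat_comp mr mf.
have h1 g : measurable_quat setT g -> measurable_quat setT (fun z => prj (g z)).
  by move=> [? ? ? ?]; split.
apply: (measurable_quatZ (r := fun=> 2^-1)) => //.
by apply: measurable_quatD; apply: h1.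
Qed.

Lemma sqint_evenj f : sqint leb setT f -> sqint leb setT (evenj f) /\ sqN (evenj f) <= sqN f.
Proof.
move=> hf; have [mf _] := hf; have hr := scales_sqint scales_mirror hf.
have I1 := sqint_integrable hf; have I2 := sqint_integrable hr.
have I12 : leb.-integrable setT (EFin \o (fun z => 2^-1 * (nq (f z) + nq (f (mirror z))))).
  have := integrableZl measurableT 2^-1 (integrableD measurableT I1 I2).
  exact: eq_integrable.
have hs : sqint leb setT (evenj f).
  apply: (le_sqint _ _ I12) => //; first exact: measurable_evenj.
  by move=> z _; exact: nq_evenj_le.
split => //; have e : sqN f = \int[leb]_z (2^-1 * (nq (f z) + nq (f (mirror z)))).
  have I3 : leb.-integrable setT (EFin \o (fun z => nq (f z) + nq (f (mirror z)))).
    by have := integrableD measurableT I1 I2; apply: eq_integrable.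
  rewrite RintegralZl// RintegralD// -!sqN_R.
  have := scales_sqN scales_mirror hf; rewrite /comp sqN_R /= mul1r => ->.
  by field.
rewrite e sqN_R; apply: le_Rintegral => //; first exact: sqint_integrable.
by move=> z _; exact: nq_evenj_le.
Qed.

Lemma evenjB f g z : evenj (fun x => f x - g x) z = evenj f z - evenj g z.
Proof. by rewrite /evenj; apply/quatP; split=> /=; ring. Qed.

Lemma evenj_mirror f z : evenj f (mirror z) = evenj f z.
Proof. by rewrite /evenj mirrorK addrC. Qed.

Lemma evenj_comm f z (t : R) : evenj f z * exp_j t = exp_j t * evenj f z.
Proof. by rewrite !mulqE; apply/quatP; split=> /=; ring. Qed.

(** Reflecting the position reflects the frequency, and so does moving [j]
    across a left exponential; both operations in the definition of [evenj]
    thus commute with the transform once they are combined. *)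
Lemma qF_evenj f w : iq leb setT f -> qF I (evenj f) w = evenj (qF I f) w.
Proof.
move=> hf; have hr := iq_mirror hf.
have hj g : iq leb setT g -> iq leb setT (fun z => unit_j * g z * unit_j).
  by move=> hg; apply: iqMr => //; exact: iqMl.
have key g : iq leb setT g -> qF I (fun z => g z - unit_j * g z * unit_j) w =
    qF I g w - unit_j * qF I g (mirror w) * unit_j.
  move=> hg; rewrite qFB//; last exact: hj.
  by rewrite qF_unit_jr; [rewrite qF_unit_jl|exact: iqMl].
have hk g : iq leb setT g -> iq leb setT (fun z => g z - unit_j * g z * unit_j).
  by move=> hg; apply: iqB => //; exact: hj.
have -> : evenj f = (fun z => 4^-1 *: ((f z - unit_j * f z * unit_j) +
    ((f \o mirror) z - unit_j * (f \o mirror) z * unit_j))).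
  apply/funext => z; rewrite /evenj !prjE -scalerDr scalerA; congr (_ *: _).
  by field.
rewrite qFZ; last by apply: iqD => //; exact: hk.
rewrite qFD; [|exact: hk|exact: hk].
rewrite !key// !qF_mirror// mirrorK /evenj !prjE -scalerDr scalerA.
rewrite (_ : 2^-1 * 2^-1 = 4^-1 :> R); last by field.
by congr (_ *: _); rewrite addrACA [RHS]addrACA; congr (_ + _); rewrite addrC.
Qed.

(** On even functions the left and the right exponentials act alike, both
    through their cosine. *)
Lemma qF_even f w : iq leb setT f -> (forall z, f (mirror z) = f z) ->
  qF I f w = qF pred0 f w.
Proof.
move=> hf ef.
have avg (u v : V -> quat R) : iq leb setT u -> iq leb setT v ->
    (forall z, u z + u (mirror z) = v z + v (mirror z)) ->
    integral_quat leb setT u = integral_quat leb setT v.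
  move=> hu hv huv.
  have h k : iq leb setT k -> integral_quat leb setT k =
      2^-1 *: integral_quat leb setT (fun z => k z + k (mirror z)).
    move=> hk; rewrite (integral_quatD measurableT hk (iq_mirror hk)).
    rewrite integral_quat_mirror// -mulr2n.
    by apply/quatP; rewrite mulr2n; split=> /=; field.
  rewrite (h u)// (h v)//; congr (_ *: _).
  by apply: eq_integral_quat => z _; rewrite huv.
apply: avg; [exact: iq_wave|exact: iq_wave|move=> z].
rewrite ef; have ph : phase (predC pred0) w z = phase I w z + phase (predC I) w z.
  by rewrite /phase [LHS](bigID (fun i : 'I_d => I i))/=.
have ph0 x : phase pred0 w x = 0 by rewrite /phase big_pred0.
have phr : phase (predC pred0) w (mirror z) = - phase I w z + phase (predC I) w z.
  by rewrite -phase_mirror -(phaseC_mirror w z) /phase [LHS](bigID (fun i : 'I_d => I i))/=.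
rewrite /wi /wj !ph0 ph phr phase_mirror phaseC_mirror !mulr0 oppr0 exp_i0 !mul1r.
move: (f z) (phase I w z) (phase (predC I) w z) => q a b.
rewrite !mulrDr !mulrN !opprK !opprD !exp_jD opprK.
rewrite !mulqE /exp_i /exp_j /= !cosN !sinN; apply/quatP; split=> /=; ring.
Qed.

End EvenComplexFunctions.

Section EvenConjugation.
Context {R : realType} (d : nat) (I : pred nat).
Local Notation V := ('cV[R]_d).
Local Notation leb := (lebesgue_cV d : {sigma_finite_measure set V -> \bar R}).
Local Notation sqN := (sqN leb setT).
Implicit Types (f g : V -> quat R) (w z : V).

Lemma is_FT_unit_jl f g : is_FT I f g ->
  is_FT I (fun x => unit_j * f x) (fun w => unit_j * g (mirror I w)).
Proof.
move=> [hg [f_ [L cf cg]]]; split.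
  by apply: sqintMl => //; exact: (scales_sqint (@scales_mirror R d I) hg).
have n1 : nq (unit_j : quat R) = 1 by rewrite /nq /=; ring.
exists (fun k x => unit_j * f_ k x); split => [k||].
- exact: L1L2Ml.
- rewrite (_ : (fun k => _) = (fun k => sqN (fun x => f_ k x - f x)))//.
  apply/funext => k; rewrite [RHS]sqN_R [LHS]sqN_R; apply: eq_Rintegral => x _.
  by rewrite -mulrBr nqM n1 mul1r.
- rewrite (_ : (fun k => _) = (fun k => sqN (fun w => qF I (f_ k) w - g w)))//.
  apply/funext => k; have [iL _] := L k.
  have hs : sqint leb setT (fun w => qF I (f_ k) w - g w).
    by apply: sqintB => //; exact: sqint_qF.
  have := scales_sqN (@scales_mirror R d I) hs; rewrite mul1r => <-.
  rewrite [RHS]sqN_R [LHS]sqN_R; apply: eq_Rintegral => x _ /=.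
  by rewrite qF_unit_jl// -mulrBr nqM n1 mul1r.
Qed.

(** The involution of the admissibility integral, in any dimension. *)
Definition star f z : quat R := conjq (f (- z)).

Lemma iq_star f : iq leb setT f -> iq leb setT (star f).
Proof. by move=> hf; apply: (iq_conj measurableT); exact: (scales_iq (@scales_opp R d) hf). Qed.

Lemma sqint_conj f : sqint leb setT f -> sqint leb setT (fun x => conjq (f x)).
Proof.
move=> [mf ff]; split; first exact: measurable_quat_conj.
by move: ff; congr (_ < _)%E; apply: eq_integral => x _; rewrite nq_conj.
Qed.

Lemma sqN_conj f : sqN (fun x => conjq (f x)) = sqN f.
Proof. by congr fine; apply: eq_integral => x _; rewrite nq_conj. Qed.

Lemma sqint_star f : sqint leb setT f -> sqint leb setT (star f).
Proof.
by move=> hf; apply: sqint_conj; exact: (scales_sqint (@scales_opp R d) hf).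
Qed.

Lemma sqN_star f : sqint leb setT f -> sqN (star f) = sqN f.
Proof.
move=> hf; rewrite -(mul1r (sqN f)) -(scales_sqN (@scales_opp R d) hf).
exact: (sqN_conj (f \o _)).
Qed.

Lemma qF_star f w : iq leb setT f ->
  (forall z (t : R), f z * exp_j t = exp_j t * f z) ->
  qF pred0 (star f) w = conjq (qF pred0 f w).
Proof.
move=> hf fj; rewrite /qF -(integral_quat_conj measurableT); last exact: iq_wave.
have hw : iq leb setT (fun z => conjq (wi pred0 w z * f z * wj pred0 w z)).
  by apply: (iq_conj measurableT); exact: iq_wave.
have := scales_integral_quat (@scales_opp R d) hw; rewrite scale1r => <-.
apply: eq_integral_quat => z _; rewrite /star /comp.
have ph0 x : phase pred0 w x = 0 by rewrite /phase big_pred0.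
rewrite /wi /wj !ph0 !mulr0 oppr0 exp_i0 !mul1r fj conjqM conj_exp_j.
by rewrite phaseNr mulrN !opprK.
Qed.

End EvenConjugation.

(** * The two-sided transform *)

Section TwoSidedTransform.
Context {R : realType} (n : nat).
Local Notation V := ('cV[R]_(n + n)).
Local Notation leb := (lebesgue_cV (n + n) : {sigma_finite_measure set V -> \bar R}).
Implicit Types (f g : V -> quat R) (w z : V).

Definition first_half : pred nat := fun i => (i < n)%N.

Lemma phase_half w z : phase first_half w z = dotv (usubmx w) (usubmx z).
Proof.
rewrite /phase big_mkcond big_split_ord /= [X in _ + X]big1 ?addr0; last first.
  by move=> i _; rewrite /first_half /= ltnNge leq_addr.
by apply: eq_bigr => i _; rewrite /first_half /= ltn_ord !mxE.
Qed.

Lemma phase_halfC w z : phase (predC first_half) w z = dotv (dsubmx w) (dsubmx z).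
Proof.
rewrite /phase big_mkcond big_split_ord /= [X in X + _]big1 ?add0r; last first.
  by move=> i _; rewrite /first_half /= ltn_ord.
by apply: eq_bigr => i _; rewrite /first_half /= ltnNge leq_addr !mxE.
Qed.

Lemma qft_intE f : qft_int f = qF first_half f.
Proof.
apply/funext => w; apply: eq_integral_quat => z _.
by rewrite /wi /wj phase_half phase_halfC.
Qed.

Lemma is_qftE f g : sqint leb setT f -> is_qft f g <-> is_FT first_half f g.
Proof.
move=> hf; rewrite /is_qft /is_FT; split.
- move=> [/L2_quatP hg [f_ [L cf cg]]]; split => //.
  have L' k : L1L2 (f_ k) by have [h1 /L2_quatP h2] := L k; split => //; apply/iqP.
  exists f_; split => //.
    by apply/L2_convergesP => // k; apply: sqintB => //; have [] := L' k.
  have h : L2_converges leb setT (fun k => qF first_half (f_ k)) g.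
    by rewrite (_ : (fun k => _) = (fun k => qft_int (f_ k)))//; apply/funext => k; rewrite qft_intE.
  by move: h => /L2_convergesP; apply => k; apply: sqintB => //; exact: sqint_qF.
- move=> [hg [f_ [L cf cg]]]; split; first exact/L2_quatP.
  exists f_; split => [k||].
  + by have [h1 h2] := L k; split; [exact/iqP|exact/L2_quatP].
  + by apply/L2_convergesP => // k; apply: sqintB => //; have [] := L k.
  + rewrite (_ : (fun k => _) = (fun k => qF first_half (f_ k))).
      by apply/L2_convergesP => // k; apply: sqintB => //; exact: sqint_qF.
    by apply/funext => k; rewrite qft_intE.
Qed.

(** An [xget] of the graph lies in the graph since the transform exists. *)
Lemma is_FT_qft f : sqint leb setT f -> is_FT first_half f (qft f).
Proof.
move=> hf; apply/(is_qftE _ hf); have [g /(is_qftE _ hf) hg] := is_FT_ex first_half hf.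
exact: (xgetPex _ (ex_intro _ g hg)).
Qed.

End TwoSidedTransform.

Section CommutingTransform.
Context {R : realType} (n : nat).
Local Notation V := ('cV[R]_(n.+1 + n.+1)).
Local Notation leb := (lebesgue_cV (n.+1 + n.+1) : {sigma_finite_measure set V -> \bar R}).
Local Notation sqN := (sqN leb setT).
Local Notation I := (first_half n.+1).
Implicit Types (f g : V -> quat R) (w z : V).

Lemma prj_comm (q : quat R) (t : R) : sin t != 0 ->
  q * exp_j t = exp_j t * q -> prj q = q.
Proof.
move=> t0; rewrite !mulqE /exp_j /= => /quatP[/= _ hi _ hk].
have hq (x : R) : 2 * (x * sin t) = 0 -> x = 0.
  by move/eqP; rewrite !mulf_eq0 pnatr_eq0 (negbTE t0) orbF => /eqP.
apply/quatP; split=> //=; apply/esym; apply: hq.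
  have -> : 2 * (qim_i q * sin t) =
    (qre q * 0 + qim_i q * cos t + qim_j q * 0 - qim_k q * sin t) * 0 +
    2 * (qim_i q * sin t) by ring.
  by move: hk; lra.
by move: hi; lra.
Qed.

(** A large divisor brings the argument into the open interval from 0 to
    [pi]. *)
Lemma sin_dilate_neq0 (x : R) : x != 0 -> exists m, sin (x / m.+1%:R) != 0.
Proof.
move=> x0; have [m hm] : exists m : nat, `|x| / pi < m.+1%:R.
  exists (Num.truncn (`|x| / pi)); exact: truncnS_gt.
exists m; have m0 : 0 < m.+1%:R :> R by rewrite ltr0n.
have h : 0 < sin (`|x| / m.+1%:R).
  apply: sin_gt0_pi; rewrite divr_gt0 ?normr_gt0//=.
  by rewrite ltr_pdivrMr// mulrC -ltr_pdivrMr// pi_gt0.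
have [x_ge0|x_lt0] := leP 0 x; first by rewrite ger0_norm// in h; rewrite gt_eqF.
by rewrite ltr0_norm// mulNr sinN oppr_gt0 in h; rewrite lt_eqF.
Qed.

(** Each translation has its own null set, so only countably many can be used.
    The vectors [e_1 / m.+1] suffice: at a frequency whose tested coordinate
    is not 0 one of the corresponding waves is not real, and what commutes
    with it lies in the line of [1] and [j]. *)
Lemma ae_prj g : (forall t : 'cV[R]_n.+1, \forall w \ae leb,
    g w * wave_j (dsubmx w) t = wave_j (dsubmx w) t * g w) ->
  {ae leb, forall w, prj (g w) = g w}.
Proof.
move=> h; pose t (m : nat) : 'cV[R]_n.+1 := \col_i (if i == ord0 then m.+1%:R^-1 else 0).
have h1 : {ae leb, forall w, forall m : nat,
    g w * wave_j (dsubmx w) (t m) = wave_j (dsubmx w) (t m) * g w}.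
  exact/ae_foralln.
have h2 := @ae_coord_neq0 R _ (rshift n.+1 (ord0 : 'I_n.+1)).
apply: filterS2 h1 h2 => w h1 h2.
have tE m : dotv (dsubmx w) (t m) = w (rshift n.+1 ord0) 0 / m.+1%:R.
  rewrite /dotv big_ord_recl big1 ?addr0; first by rewrite !mxE eqxx.
  by move=> i _; rewrite !mxE /= mulr0.
have [m hm] : exists m, sin (2 * pi * w (rshift n.+1 ord0) 0 / m.+1%:R) != 0.
  apply: sin_dilate_neq0; rewrite mulf_neq0// mulf_neq0 ?pnatr_eq0//.
  by rewrite gt_eqF// pi_gt0.
have := h1 m; rewrite /wave_j tE mulrA; apply: prj_comm.
by rewrite sinN oppr_eq0.
Qed.

(** The first hypothesis puts the values of the transform of [psi] in the line
    of [1] and [j]; the second one, at [t = 0], says that the transform is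
    even in the first half of the frequency. Both properties are fixed by the
    projection [evenj], which commutes with the transform, so [psi] is
    approximated by functions of the same kind. For these the two-sided
    transform is the right-sided one. *)
Lemma commuting_transform psi : sqint leb setT psi ->
  (forall t : 'cV[R]_n.+1, \forall w \ae leb,
    qft psi w * wave_j (dsubmx w) t = wave_j (dsubmx w) t * qft psi w) ->
  (forall t : 'cV[R]_n.+1, \forall w \ae leb,
    qft (fun x => unit_j * psi x) w * wave_j (dsubmx w) t =
      unit_j * wave_j (dsubmx w) t * qft psi w) ->
  exists g, [/\ is_FT pred0 psi g,
    forall w (t : R), g w * exp_j t = exp_j t * g w &
    {ae leb, forall w, nq (qft (involution psi) w) = nq (g w)}].
Proof.
move=> hpsi h1 h2; have hg := is_FT_qft hpsi; set g0 := qft psi in h1 h2 hg *.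
have ep := ae_prj h1.
have ev : {ae leb, forall w, g0 (mirror I w) = g0 w}.
  have hj := is_FT_qft (sqintMl measurableT unit_j hpsi).
  have := is_FT_unique (sqintMl measurableT unit_j hpsi) hj (is_FT_unit_jl hg).
  apply: filterS2 (h2 0) => w; rewrite /wave_j.
  have -> : dotv (dsubmx w) (0 : 'cV[R]_n.+1) = 0.
    by rewrite /dotv big1// => i _; rewrite !mxE mulr0.
  rewrite mulr0 oppr0 exp_j0 !mulr1 => -> e.
  have jj (q : quat R) : - unit_j * (unit_j * q) = q.
    by rewrite !mulqE; apply/quatP; split=> /=; ring.
  by rewrite -[LHS]jj -e jj.
have epr : {ae leb, forall w, prj (g0 (mirror I w)) = g0 (mirror I w)}.
  exact: (scales_ae (@scales_mirror R _ I) ep).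
have eevenj : {ae leb, forall w, evenj I g0 w = g0 w}.
  apply: filterS3 ep ev epr => w e1 e2 e3.
  by rewrite /evenj e3 e1 e2; apply/quatP; split=> /=; field.
have [hg0 [f_ [L cf cg]]] := hg.
pose g := evenj I g0; pose p_ k := evenj I (f_ k).
have hgg : sqint leb setT g by have [] := sqint_evenj I hg0.
have Lp k : L1L2 (p_ k).
  by have [i1 i2] := L k; split; [exact: iq_evenj|have [] := sqint_evenj I i2].
have pF k w : qF pred0 (p_ k) w = evenj I (qF I (f_ k)) w.
  have [i1 i2] := L k; rewrite -qF_evenj// qF_even//; first exact: iq_evenj.
  by move=> z; exact: evenj_mirror.
have cpF : sqN (fun w => qF pred0 (p_ k) w - g w) @[k --> \oo] --> (0 : R).
  apply: (squeeze_cvgr (f := fun=> 0) _ (cvg_cst 0) cg); near=> k.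
  rewrite sqN_ge0/=; have hs : sqint leb setT (fun w => qF I (f_ k) w - g0 w).
    by apply: sqintB => //; exact: sqint_qF.
  have [_] := sqint_evenj I hs.
  by congr (_ <= _); congr fine; apply: eq_integral => w _; rewrite pF evenjB.
have hpF k : sqint leb setT (qF pred0 (p_ k)) by exact: sqint_qF.
have hF k : sqint leb setT (qF I (f_ k)) by exact: sqint_qF.
have eIp k : qF I (p_ k) = qF pred0 (p_ k).
  have [i1 _] := Lp k; apply/funext => w; apply: qF_even => // z; exact: evenj_mirror.
have hpsq k : sqint leb setT (p_ k) by have [] := Lp k.
have hfsq k : sqint leb setT (f_ k) by have [] := L k.
(* The projected sequence still converges to [psi]: its transforms have the
   same limit as those of [f_], and the transform is isometric. *)
have cp : sqN (fun x => p_ k x - psi x) @[k --> \oo] --> (0 : R).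
  apply: (sqN_tri0 (v_ := f_)) => //.
  rewrite (_ : (fun k => _) =
      (fun k => sqN (fun w => qF pred0 (p_ k) w - qF I (f_ k) w))); last first.
    by apply/funext => k; rewrite -eIp sqN_qFB.
  have h3 : 2 * (sqN (fun w => qF pred0 (p_ k) w - g w) +
      sqN (fun w => qF I (f_ k) w - g0 w)) @[k --> \oo] --> (2 * (0 + 0) : R).
    by apply: cvgM; [exact: cvg_cst|exact: cvgD].
  rewrite addr0 mulr0 in h3.
  apply: (squeeze_cvgr (f := fun=> 0) _ (cvg_cst 0) h3).
  near=> k; rewrite sqN_ge0/=.
  have -> : sqN (fun w => qF I (f_ k) w - g0 w) = sqN (fun w => g w - qF I (f_ k) w).
    rewrite sqNBC; congr fine; apply: (ae_eq_sqn measurableT).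
    - by have [] := sqintB measurableT hg0 (hF k).
    - by have [] := sqintB measurableT hgg (hF k).
    - by apply: filterS eevenj => w e _; rewrite /g e.
  exact: sqNB_le.
have hstar : sqint leb setT (star psi) by exact: sqint_star.
have hFstar : is_FT I (star psi) (fun w => conjq (g w)).
  split; first exact: sqint_conj.
  exists (fun k => star (p_ k)); split => [k||].
  - by have [i1 i2] := Lp k; split; [exact: iq_star|exact: sqint_star].
  - rewrite (_ : (fun k => _) = (fun k => sqN (fun x => p_ k x - psi x)))//.
    apply/funext => k; rewrite -[RHS]sqN_star; last by apply: sqintB.
    by congr fine; apply: eq_integral => x _; rewrite /star conjqB.
  - rewrite (_ : (fun k => _) = (fun k => sqN (fun w => qF pred0 (p_ k) w - g w)))//.
    apply/funext => k; rewrite -[RHS]sqN_conj.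
    have e : qF I (star (p_ k)) = fun w => conjq (qF pred0 (p_ k) w).
      have [i1 _] := Lp k; apply/funext => w.
      rewrite (qF_even w (iq_star i1)).
        by apply: qF_star => // z t; exact: evenj_comm.
      move=> z; rewrite /star; congr conjq.
      rewrite -[RHS](evenj_mirror I (f_ k)).
      by congr (evenj _ _ _); apply/colP => i; rewrite !mxE; case: ifP.
    by rewrite e; congr fine; apply: eq_integral => w _; rewrite conjqB.
exists g; split.
- by split => //; exists p_.
- by move=> w t; exact: evenj_comm.
- apply: filterS (is_FT_unique hstar (is_FT_qft hstar) hFstar) => w e.
  by rewrite [qft _ _]e nq_conj.
Unshelve. all: by end_near. Qed.

End CommutingTransform.

(** * The right-sided transform *)

Section RightSidedTransform.
Context {R : realType} (d : nat).
Local Notation V := ('cV[R]_d).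
Local Notation leb := (lebesgue_cV d : {sigma_finite_measure set V -> \bar R}).
Local Notation sqN := (sqN leb setT).
Local Notation qFr := (@qF R d pred0).
Implicit Types (f g : V -> quat R) (w z : V).

Lemma phase0 w z : phase pred0 w z = 0.
Proof. by rewrite /phase big_pred0. Qed.

Lemma wi0 w z : wi pred0 w z = 1.
Proof. by rewrite /wi phase0 mulr0 oppr0 exp_i0. Qed.

Lemma qF0Ml q f w : iq leb setT f -> qFr (fun x => q * f x) w = q * qFr f w.
Proof.
move=> hf; rewrite /qF -(integral_quatMl measurableT); last exact: iq_wave.
by apply: eq_integral_quat => z _; rewrite !wi0 !mul1r mulrA.
Qed.

(** Only the transform without left exponentials is linear for the left
    multiplication. *)
Lemma is_FT_lin p q f f' g g' : sqint leb setT f -> sqint leb setT g ->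
  is_FT pred0 f f' -> is_FT pred0 g g' ->
  is_FT pred0 (fun x => p * f x + q * g x) (fun w => p * f' w + q * g' w).
Proof.
move=> hf hg [hf' [f_ [Lf cf cf']]] [hg' [g_ [Lg cg cg']]].
have c (u_ v_ : nat -> V -> quat R) u v : (forall k, sqint leb setT (u_ k)) ->
    (forall k, sqint leb setT (v_ k)) -> sqint leb setT u -> sqint leb setT v ->
    sqN (fun x => u_ k x - u x) @[k --> \oo] --> (0 : R) ->
    sqN (fun x => v_ k x - v x) @[k --> \oo] --> (0 : R) ->
    sqN (fun x => (p * u_ k x + q * v_ k x) - (p * u x + q * v x)) @[k --> \oo] --> (0 : R).
  move=> hu_ hv_ hu hv cu cv.
  have h3 : 2 * (nq p * sqN (fun x => u_ k x - u x) + nq q * sqN (fun x => v_ k x - v x))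
      @[k --> \oo] --> (2 * (nq p * 0 + nq q * 0) : R).
    by apply: cvgM; [exact: cvg_cst|apply: cvgD; apply: cvgM => //; exact: cvg_cst].
  rewrite !mulr0 addr0 mulr0 in h3.
  apply: (squeeze_cvgr (f := fun=> 0) _ (cvg_cst 0) h3); near=> k.
  rewrite sqN_ge0/=.
  have s1 : sqint leb setT (fun x => p * (u_ k x - u x)) by apply: sqintMl => //; exact: sqintB.
  have s2 : sqint leb setT (fun x => q * (v_ k x - v x)) by apply: sqintMl => //; exact: sqintB.
  have := sqNB_le measurableT s1 (sqint0 _ setT) (sqintN measurableT s2).
  rewrite (_ : sqN (fun x => p * (u_ k x - u x) - 0) = nq p * sqN (fun x => u_ k x - u x)); last first.
    rewrite -(sqNMl measurableT); last by apply: sqintB.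
    by congr fine; apply: eq_integral => x _; rewrite subr0.
  rewrite (_ : sqN (fun x => 0 - - (q * (v_ k x - v x))) = nq q * sqN (fun x => v_ k x - v x)); last first.
    rewrite -(sqNMl measurableT); last by apply: sqintB.
    by congr fine; apply: eq_integral => x _; rewrite sub0r opprK.
  congr (_ <= _); congr fine; apply: eq_integral => x _; congr (nq _)%:E.
  by rewrite opprK !mulrBr opprD addrACA.
have sF k : sqint leb setT (f_ k) by case: (Lf k).
have sG k : sqint leb setT (g_ k) by case: (Lg k).
have iF k : iq leb setT (f_ k) by case: (Lf k).
have iG k : iq leb setT (g_ k) by case: (Lg k).
split; first by apply: sqintD => //; exact: sqintMl.
exists (fun k x => p * f_ k x + q * g_ k x); split => [k||].
- by apply: L1L2D; exact: L1L2Ml.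
- exact: c.
- rewrite (_ : (fun k => _) = (fun k => sqN (fun w =>
      (p * qFr (f_ k) w + q * qFr (g_ k) w) - (p * f' w + q * g' w)))).
    by apply: c => // k; exact: sqint_qF.
  apply/funext => k; congr fine; apply: eq_integral => w _.
  by rewrite qFD ?qF0Ml//; exact: iqMl.
Unshelve. all: by end_near. Qed.

Lemma parseval f f' g g' : sqint leb setT f -> sqint leb setT g ->
  is_FT pred0 f f' -> is_FT pred0 g g' ->
  inner_quat leb setT f' g' = inner_quat leb setT f g.
Proof.
move=> hf hg Hf Hg; rewrite -[RHS]scale1r.
have [hf' _] := Hf; have [hg' _] := Hg.
apply: (polarization measurableT measurableT hf hg hf' hg') => p q; rewrite mul1r.
apply: (is_FT_sqN _ (is_FT_lin p q hf hg Hf Hg)).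
by apply: sqintD => //; exact: sqintMl.
Qed.

(** Rule for an affine substitution [phi] whose linear part has adjoint
    [beta]; the translation becomes a wave. *)
Lemma is_FT_affine (phi beta : V -> V) (t : V) (kap K L : R) f g :
  scales leb leb phi K -> scales leb leb beta L ->
  (forall w x, phase (predC pred0) w x =
     phase (predC pred0) w t + phase (predC pred0) (beta w) (phi x)) ->
  sqint leb setT f -> is_FT pred0 f g ->
  is_FT pred0 (fun x => kap *: f (phi x))
    (fun w => (kap * K) *: (g (beta w) * wj pred0 w t)).
Proof.
move=> sphi sbeta ph hf [hg [f_ [Lf cf cg]]].
have hZ (r : R) u : sqint leb setT u -> sqint leb setT (fun x => r *: u x).
  move=> hu; have := sqintMl measurableT (r *: (1 : quat R)) hu.
  by under eq_fun do rewrite scaleqAl mul1r.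
have sZ (r : R) u : sqint leb setT u -> sqN (fun x => r *: u x) = r ^+ 2 * sqN u.
  move=> hu; have := sqNMl measurableT (r *: (1 : quat R)) hu.
  rewrite nqZ (_ : nq 1 = 1) ?mulr1; last by rewrite /nq /=; ring.
  by move=> <-; congr fine; apply: eq_integral => x _; rewrite scaleqAl mul1r.
have hW u : sqint leb setT u -> sqint leb setT (fun w => u w * wj pred0 w t).
  move=> [mu fu]; split.
    have := measurable_wave pred0 (@measurable_id _ V setT) (@measurable_cst _ _ V V setT t) mu.
    by under eq_fun do rewrite wi0 mul1r.
  move: fu; congr (_ < _)%E; apply: eq_integral => w _.
  by rewrite nqM nq_exp_j mulr1.
have sW u : sqN (fun w => u w * wj pred0 w t) = sqN u.
  by congr fine; apply: eq_integral => w _; rewrite nqM nq_exp_j mulr1.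
split; first by apply/hZ/hW; exact: scales_sqint sbeta hg.
exists (fun k x => kap *: f_ k (phi x)); split => [k||].
- have [h1 h2] := Lf k; split; last by apply: hZ; exact: scales_sqint sphi h2.
  have := iqMl measurableT (kap *: (1 : quat R)) (scales_iq sphi h1).
  by under eq_fun do rewrite scaleqAl mul1r.
- have h3 : (kap ^+ 2 * K) * sqN (fun x => f_ k x - f x) @[k --> \oo] -->
      ((kap ^+ 2 * K) * 0 : R) by apply: cvgM => //; exact: cvg_cst.
  rewrite mulr0 in h3; apply: cvg_trans h3; apply: near_eq_cvg; near=> k.
  have hs : sqint leb setT (fun x => f_ k x - f x).
    by apply: sqintB => //; have [] := Lf k.
  rewrite -mulrA -(scales_sqN sphi hs) -sZ; last exact: scales_sqint sphi hs.
  by congr fine; apply: eq_integral => x _; rewrite /comp scalerBr.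
- have h3 : ((kap * K) ^+ 2 * L) * sqN (fun x => qFr (f_ k) x - g x) @[k --> \oo] -->
      (((kap * K) ^+ 2 * L) * 0 : R) by apply: cvgM => //; exact: cvg_cst.
  rewrite mulr0 in h3; apply: cvg_trans h3; apply: near_eq_cvg; near=> k.
  have [i1 _] := Lf k.
  have hs : sqint leb setT (fun x => qFr (f_ k) x - g x).
    by apply: sqintB => //; exact: sqint_qF.
  have hsb := scales_sqint sbeta hs.
  rewrite -mulrA -(scales_sqN sbeta hs) -(sW (_ \o beta)) -sZ; last exact: hW.
  congr fine; apply: eq_integral => w _; congr (nq _)%:E.
  rewrite /comp mulrBl scalerBr; congr (_ - _).
  rewrite (qFZ pred0 kap w (scales_iq sphi i1)) -scalerA -scaleqAl; congr (_ *: _).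
  have iw := iq_wave pred0 (beta w) i1.
  rewrite /qF -(scales_integral_quat sphi iw).
  rewrite -(integral_quatMr measurableT); last exact: scales_iq sphi iw.
  apply: eq_integral_quat => x _; rewrite /comp !wi0 !mul1r -mulrA; congr (_ * _).
  by rewrite /wj -exp_jD (ph w x) [in RHS]mulrDr [in RHS]opprD [in RHS]addrC.
Unshelve. all: by end_near. Qed.

End RightSidedTransform.

(** * Geometry of the shearlet group *)

Section ShearletGeometry.
Context {R : realType} (d : nat).
Local Notation V := ('cV[R]_d.+1).
Local Notation leb := (lebesgue_cV d.+1 : {sigma_finite_measure set V -> \bar R}).
Implicit Types (a r : R) (s : 'cV[R]_d) (x w t : V).

(** The inverse of the matrix [S_s A_a], where [r] stands for the second
    diagonal entry of [A_a]; [shear_adj] is the transpose of that matrix. *)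
Definition shear_inv a r s x : V :=
  cons_cV (a^-1 * (x ord0 0 - dotv s (uncons_cV x).2), r^-1 *: (uncons_cV x).2).

Definition shear_adj a r s w : V :=
  cons_cV (a * w ord0 0, r *: (w ord0 0 *: s + (uncons_cV w).2)).

Lemma scales_shear_inv a r s t : a != 0 -> r != 0 ->
  scales leb leb (fun x => shear_inv a r s (x - t)) (`|a| * `|r| ^+ d).
Proof.
move=> a0 r0; pose c : V := cons_cV (a^-1, const_mx r^-1).
have h1 := scales_translation (- t).
have h2 := scales_comp h1 (scales_shear_map (- s)).
have cneq i : c i 0 != 0.
  case: (unliftP ord0 i) => [j ->|->].
    by rewrite cons_cVS mxE invr_eq0.
  by rewrite cons_cV0 invr_eq0.
have h3 := scales_comp h2 (@scales_diag_affine R _ c 0 cneq).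
have -> : (fun x => shear_inv a r s (x - t)) =
    diag_affine c 0 \o (shear_map (- s) \o (fun x => x - t)).
  apply/funext => x /=; rewrite /shear_map diag_affine_cons /shear_inv.
  congr cons_cV; congr pair.
    rewrite cons_cV0 [X in _ = _ + X]mxE addr0; congr (_ * (_ + _)).
    by rewrite /dotv -sumrN; apply: eq_bigr => i _; rewrite [in RHS]mxE mulNr.
  apply/colP => i; rewrite [LHS]mxE [RHS]mxE [X in _ = X * _ + _]mxE cons_cVS mxE.
  by rewrite !mxE addr0.
move: h3; congr scales; rewrite !mul1r big_ord_recl cons_cV0 normrV ?unitfE// invrK.
congr (_ * _); rewrite (eq_bigr (fun=> `|r|)) ?prodr_const ?card_ord// => i _.
by rewrite cons_cVS mxE normrV ?unitfE// invrK.
Qed.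

(** The transposed shear translates the last coordinates by an amount that
    depends on the first one only. *)
Lemma scales_shear_adj a r s : a != 0 -> r != 0 ->
  scales leb leb (shear_adj a r s) (`|a|^-1 * (`|r| ^+ d)^-1).
Proof.
move=> a0 r0; pose c : V := cons_cV (a, const_mx r).
pose T w : V := cons_cV (w ord0 0, w ord0 0 *: s + (uncons_cV w).2).
have mT : measurable_fun setT T.
  have m2 : measurable_fun setT (fun x : V => (uncons_cV x).2).
    exact: measurableT_comp measurable_snd (@measurable_uncons_cV R d).
  have mU : measurable_fun setT (fun w : V => (w ord0 0 : measurableTypeR R,
      w ord0 0 *: s + (uncons_cV w).2)).
    apply/measurable_fun_pairP; split => /=; first exact: measurable_coord_cV.
    apply: measurable_cVP => i; under eq_fun do rewrite !mxE.
    apply: measurable_funD.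
      by apply: measurable_funM => //; exact: measurable_coord_cV.
    exact: (measurable_coord_cV (rshift 1 i)).
  exact: (measurableT_comp (@measurable_cons_cV R d) mU).
have h1 : scales leb leb T 1.
  split => // f mf f0; rewrite mul1e.
  apply: (etrans (ge0_integral_cons (measurableT_comp mf mT) (fun x => f0 (T x)))).
  apply: (etrans _ (esym (ge0_integral_cons mf f0))); apply: eq_integral => b _.
  have [_ _ h] := scales_translation (b *: s).
  rewrite -[RHS]mul1e -h//; last first.
    exact: (measurableT_comp mf (measurableT_comp (@measurable_cons_cV R d)
      (pair1_measurable (b : measurableTypeR R)))).
  by apply: eq_integral => x _; rewrite /comp /T cons_cV0 cons_cVK addrC.
have cneq i : c i 0 != 0.
  by case: (unliftP ord0 i) => [j ->|->]; rewrite ?cons_cVS ?cons_cV0// mxE.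
have h3 := scales_comp h1 (@scales_diag_affine R _ c 0 cneq).
have -> : shear_adj a r s = diag_affine c 0 \o T.
  apply/funext => x /=; rewrite /T diag_affine_cons /shear_adj.
  rewrite cons_cV0 [X in (_ + X, _)]mxE addr0; congr cons_cV; congr pair.
  apply/colP => i; rewrite [LHS]mxE [RHS]mxE [X in _ = X * _ + _]mxE cons_cVS mxE.
  by rewrite !mxE addr0.
move: h3; congr scales; rewrite !mul1r big_ord_recl cons_cV0.
congr (_ * _); rewrite (eq_bigr (fun=> `|r|^-1)) ?prodr_const ?card_ord ?exprVn// => i _.
by rewrite cons_cVS mxE.
Qed.

Lemma phase_shear a r s w x t : a != 0 -> r != 0 ->
  phase (predC pred0) w x = phase (predC pred0) w t +
  phase (predC pred0) (shear_adj a r s w) (shear_inv a r s (x - t)).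
Proof.
move=> a0 r0; have -> : phase (predC pred0) w x =
    phase (predC pred0) w t + phase (predC pred0) w (x - t).
  by rewrite -phaseDr addrC subrK.
congr (_ + _); move: (x - t) => {x t} x.
rewrite /phase !big_ord_recl !cons_cV0; cbn [fst snd].
rewrite [LHS]addrC [RHS]addrC.
have -> : a * w ord0 0 * (a^-1 * (x ord0 0 - dotv s (uncons_cV x).2)) =
   w ord0 0 * x ord0 0 - w ord0 0 * dotv s (uncons_cV x).2 by field.
rewrite addrA addrAC addrC [RHS]addrC; congr (_ + _).
rewrite /dotv mulr_sumr -sumrB; apply: eq_bigr => i _.
rewrite !cons_cVS !uncons_cVE !mxE; cbn [fst snd]; field.
exact: r0.
Qed.

End ShearletGeometry.

(** * Orthogonality relation of the shearlet transform *)

Section Density.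
Context {R : realType} d (T : measurableType d).
Variables (mu nu : {measure set T -> \bar R}) (w : T -> R).
Context (mw : measurable_fun setT w) (w0 : forall x, 0 <= w x).
Context (nuE : forall A, measurable A -> nu A = (\int[mu]_(x in A) (w x)%:E)%E).
Local Open Scope ereal_scope.

Import HBNNSimple.

Lemma integral_density_nnsfun (h : {nnsfun T >-> R}) :
  \int[nu]_x (h x)%:E = \int[mu]_x ((h x)%:E * (w x)%:E).
Proof.
have mh y : measurable (h @^-1` [set y]) by exact: measurable_sfunP.
have hE x : (h x)%:E = \sum_(y \in range h) (y * \1_(h @^-1` [set y]) x)%:E.
  by rewrite fsumEFin// -fimfunE.
have m1 y : measurable_fun setT (fun x => (y * \1_(h @^-1` [set y]) x)%:E).
  exact/measurable_EFinP/measurable_funM.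
rewrite (eq_integral _ _ (fun x _ => hE x)) ge0_integral_fsum//; last first.
  by move=> y x _; exact: nnfun_muleindic_ge0.
have hwE x : (h x)%:E * (w x)%:E =
    \sum_(y \in range h) (y * \1_(h @^-1` [set y]) x)%:E * (w x)%:E.
  rewrite -ge0_mule_fsuml -?hE// => y; exact: nnfun_muleindic_ge0.
rewrite (eq_integral _ _ (fun x _ => hwE x)) ge0_integral_fsum//; first last.
- by move=> y x _; apply: mule_ge0; [exact: nnfun_muleindic_ge0|rewrite lee_fin].
- by move=> y; apply: emeasurable_funM => //; exact/measurable_EFinP.
apply: eq_fsbigr => y; rewrite inE => -[t _ ht].
have y0 : (0 <= y)%R by rewrite -ht.
transitivity (y%:E * nu (h @^-1` [set y])).
  under eq_integral do rewrite EFinM.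
  by rewrite ge0_integralZl//; [rewrite integral_indic// setIT|exact/measurable_EFinP].
rewrite nuE//; transitivity (\int[mu]_x (y%:E * ((w x)%:E * (\1_(h @^-1` [set y]) x)%:E))).
  rewrite ge0_integralZl//.
  - congr (_ * _); rewrite integral_mkcond; apply: eq_integral => x _.
    by rewrite epatch_indic.
  - by apply: emeasurable_funM; exact/measurable_EFinP.
  - by move=> x _; rewrite mule_ge0 ?lee_fin.
by apply: eq_integral => x _; rewrite EFinM -muleA (muleC (w x)%:E).
Qed.

(** A measure with a density, on nonnegative functions; simple functions carry
    the definition over to all of them. *)
Lemma integral_density (f : T -> \bar R) : measurable_fun setT f ->
  (forall x, 0 <= f x) -> \int[nu]_x f x = \int[mu]_x (f x * (w x)%:E).
Proof.
move=> mf f0; pose h := nnsfun_approx measurableT mf.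
have hf x : (h k x)%:E @[k --> \oo] --> f x by exact: cvg_nnsfun_approx.
have nd x k l : (k <= l)%N -> (h k x)%:E <= (h l x)%:E.
  by move=> kl; rewrite lee_fin; exact/lefP/nd_nnsfun_approx.
have mh k : measurable_fun setT (fun x => (h k x)%:E) by exact/measurable_EFinP.
have c1 : \int[nu]_x (h k x)%:E @[k --> \oo] --> \int[nu]_x f x.
  rewrite (eq_integral (fun x => limn (fun k => (h k x)%:E))); last first.
    by move=> x _; apply/esym/cvg_lim.
  apply: cvg_monotone_convergence => //; last by move=> x _ k l; exact: nd.
  by move=> k x _; rewrite lee_fin.
have c2 : \int[mu]_x ((h k x)%:E * (w x)%:E) @[k --> \oo] -->
    \int[mu]_x (f x * (w x)%:E).
  rewrite (eq_integral (fun x => limn (fun k => (h k x)%:E * (w x)%:E))); last first.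
    by move=> x _; apply/esym/cvg_lim => //; exact: cvgeZr.
  apply: cvg_monotone_convergence => //.
  - by move=> k; apply: emeasurable_funM => //; exact/measurable_EFinP.
  - by move=> k x _; rewrite mule_ge0 ?lee_fin.
  - by move=> x _ k l kl; apply: lee_wpmul2r; [rewrite lee_fin|exact: nd].
rewrite (_ : (fun k => _) = (fun k => \int[nu]_x (h k x)%:E)) in c2.
  by apply: cvg_unique c1 c2.
by apply/funext => k; rewrite integral_density_nnsfun.
Qed.

End Density.

Section ShearletIsometry.
Context {R : realType} (d : nat) (rho kap : R -> R).
Context (mrho : measurable_fun (setT : set (measurableTypeR R))
  (rho : measurableTypeR R -> measurableTypeR R)).
Context (mkap : measurable_fun (setT : set (measurableTypeR R))
  (kap : measurableTypeR R -> measurableTypeR R)).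
Context (rho0 : forall a, a != 0 -> rho a != 0).
Context (kapE : forall a, a != 0 -> kap a ^+ 2 * (`|a| * `|rho a| ^+ d) = 1).
Local Notation S := ('cV[R]_d).
Local Notation V := ('cV[R]_d.+1).
Local Notation P2 := (measurableTypeR R * S)%type.
Local Notation P := (P2 * V)%type.
Local Notation leb1 := (@lebesgue_measure R).
Local Notation leb := (lebesgue_cV d.+1 : {sigma_finite_measure set V -> \bar R}).
Local Notation B2 := (sfprod leb1 (lebesgue_cV d)).
Implicit Types (f g psi : V -> quat R) (a : R) (s : S) (p : P) (t x w : V).

(** The shearlets, with the powers of [a] abstracted into [rho] and [kap]: of
    these powers only the relation [kapE] is used. *)
Definition wavelet psi p x : quat R :=
  kap p.1.1 *: psi (shear_inv p.1.1 (rho p.1.1) p.1.2 (x - p.2)).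

Definition sht psi f p : quat R := inner_quat leb setT f (wavelet psi p).

Lemma measurable_invr : measurable_fun (setT : set (measurableTypeR R))
  (fun a => a^-1 : measurableTypeR R).
Proof.
have -> : (fun a : R => a^-1) = (fun a => a * `|a| `^ (- 2%:R)).
  apply/funext => a; rewrite powRN powR_mulrn// real_normK ?num_real// expr2.
  have [->|a0] := eqVneq a 0; first by rewrite invr0 mul0r.
  by rewrite invfM mulrA mulfV// mul1r.
apply: measurable_funM => //; apply: (measurableT_comp (measurable_powR _)).
exact: normr_measurable.
Qed.

Lemma measurable_dotv2 d' (T : measurableType d') (u v : T -> S) :
  measurable_fun setT u -> measurable_fun setT v ->
  measurable_fun setT (fun z => dotv (u z) (v z) : measurableTypeR R).
Proof.
move=> mu mv; apply: measurable_sum => i; apply: measurable_funM.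
  exact: (measurableT_comp (measurable_coord_cV i) mu).
exact: (measurableT_comp (measurable_coord_cV i) mv).
Qed.

Lemma measurable_cons_fun d' (T : measurableType d') (u : T -> measurableTypeR R)
    (v : T -> S) : measurable_fun setT u -> measurable_fun setT v ->
  measurable_fun setT (fun z => cons_cV (u z, v z)).
Proof.
move=> mu mv; apply: (measurableT_comp (@measurable_cons_cV R d)).
exact/measurable_fun_pairP.
Qed.

Lemma measurable_tail d' (T : measurableType d') (u : T -> V) :
  measurable_fun setT u -> measurable_fun setT (fun z => (uncons_cV (u z)).2).
Proof.
move=> mu; apply: (measurableT_comp measurable_snd).
exact: (measurableT_comp (@measurable_uncons_cV R d) mu).
Qed.

Lemma measurable_scale_cV d' (T : measurableType d') (u : T -> measurableTypeR R)
    (v : T -> S) : measurable_fun setT u -> measurable_fun setT v ->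
  measurable_fun setT (fun z => u z *: v z).
Proof.
move=> mu mv; apply: measurable_cVP => i; under eq_fun do rewrite mxE.
apply: measurable_funM => //; exact: (measurableT_comp (measurable_coord_cV i) mv).
Qed.

Lemma measurable_shear_inv d' (T : measurableType d') (a r : T -> measurableTypeR R)
    (s : T -> S) (x : T -> V) :
  measurable_fun setT a -> measurable_fun setT r -> measurable_fun setT s ->
  measurable_fun setT x ->
  measurable_fun setT (fun z => shear_inv (a z) (r z) (s z) (x z)).
Proof.
move=> ma mr ms mx; have mt := measurable_tail mx.
apply: measurable_cons_fun.
  apply: measurable_funM; first exact: (measurableT_comp measurable_invr ma).
  apply: measurable_funB; first exact: (measurableT_comp (measurable_coord_cV ord0) mx).
  exact: measurable_dotv2.
by apply: measurable_scale_cV => //; exact: (measurableT_comp measurable_invr mr).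
Qed.

Lemma measurable_shear_adj d' (T : measurableType d') (a r : T -> measurableTypeR R)
    (s : T -> S) (w : T -> V) :
  measurable_fun setT a -> measurable_fun setT r -> measurable_fun setT s ->
  measurable_fun setT w ->
  measurable_fun setT (fun z => shear_adj (a z) (r z) (s z) (w z)).
Proof.
move=> ma mr ms mw; have mt := measurable_tail mw.
have m0 := measurableT_comp (measurable_coord_cV (ord0 : 'I_d.+1)) mw.
apply: measurable_cons_fun; first exact: measurable_funM.
apply: measurable_scale_cV => //; apply: measurable_cVP => i.
under eq_fun do rewrite mxE; apply: measurable_funD.
  exact: (measurableT_comp (measurable_coord_cV i) (measurable_scale_cV m0 ms)).
exact: (measurableT_comp (measurable_coord_cV i) mt).
Qed.

Lemma measurable_sht psi f : measurable_quat setT psi -> measurable_quat setT f ->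
  measurable_quat setT (sht psi f).
Proof.
move=> mpsi mf.
have m1 : measurable_fun setT (fun q : P * V => q.1.1.1).
  exact: (measurableT_comp measurable_fst (measurableT_comp measurable_fst measurable_fst)).
have m2 : measurable_fun setT (fun q : P * V => q.1.1.2).
  exact: (measurableT_comp measurable_snd (measurableT_comp measurable_fst measurable_fst)).
have m3 : measurable_fun setT (fun q : P * V => q.1.2).
  exact: (measurableT_comp measurable_snd measurable_fst).
have m4 : measurable_fun setT (fun q : P * V => q.2 - q.1.2).
  apply: measurable_cVP => i; under eq_fun do rewrite !mxE.
  apply: measurable_funB; first exact: (measurableT_comp (measurable_coord_cV i) measurable_snd).
  exact: (measurableT_comp (measurable_coord_cV i) m3).
have msh := measurable_shear_inv m1 (measurableT_comp mrho m1) m2 m4.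
apply: (@measurable_integral_quat_param _ _ _ P V leb
  (fun q => f q.2 * conjq (wavelet psi q.1 q.2))).
apply: measurable_quatM; first exact: (measurable_quat_comp measurable_snd mf).
apply: measurable_quat_conj; apply: measurable_quatZ.
  exact: (measurableT_comp mkap m1).
exact: (measurable_quat_comp msh mpsi).
Qed.

Section FixedFunctions.
Variables (psi g f f' : V -> quat R).
Context (hpsi : sqint leb setT psi) (Hg : is_FT pred0 psi g).
Context (hf : sqint leb setT f) (Hf : is_FT pred0 f f').
Context (gj : forall w (t : R), g w * exp_j t = exp_j t * g w).

Let K a := kap a * (`|a| * `|rho a| ^+ d).

Let sg : sqint leb setT g. Proof. by case: Hg. Qed.
Let sf' : sqint leb setT f'. Proof. by case: Hf. Qed.

(** The transform at fixed [a] and [s] is, up to the sign of [t], the Fourier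
    transform of this product. *)
Definition spectrum a s w : quat R :=
  K a *: (f' w * conjq (g (shear_adj a (rho a) s w))).

Lemma is_FT_wavelet a s t : a != 0 ->
  is_FT pred0 (wavelet psi (a, s, t))
    (fun w => K a *: (g (shear_adj a (rho a) s w) * wj pred0 w t)).
Proof.
move=> a0; have r0 := rho0 a0.
have ph w x := phase_shear s w x t a0 r0.
exact: (is_FT_affine (kap a) (scales_shear_inv s t a0 r0)
  (scales_shear_adj s a0 r0) ph hpsi Hg).
Qed.

Lemma sqint_wavelet a s t : a != 0 ->
  sqint leb setT (wavelet psi (a, s, t)) /\
  sqN leb setT (wavelet psi (a, s, t)) = sqN leb setT psi.
Proof.
move=> a0; have r0 := rho0 a0.
have sc := scales_shear_inv s t a0 r0.
have h := scales_sqint sc hpsi.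
have e : wavelet psi (a, s, t) =
    (fun x => (kap a *: (1 : quat R)) * (psi \o (fun x => shear_inv a (rho a) s (x - t))) x).
  by apply/funext => x; rewrite /wavelet /= scaleqAl mul1r.
rewrite e; split; first exact: sqintMl.
rewrite sqNMl// (scales_sqN sc)// nqZ (_ : nq (1 : quat R) = 1) ?mulr1; last by rewrite /nq /=; ring.
by rewrite mulrA kapE// mul1r.
Qed.

(** By Parseval the inner product moves to the frequency side, where the
    translation is a wave; the commutation of [g] with the waves brings this
    wave to the right of the product. *)
Lemma sht_fourier a s t : a != 0 ->
  sht psi f (a, s, t) = qF pred0 (spectrum a s) (- t).
Proof.
move=> a0; have [hw _] := sqint_wavelet s t a0.
rewrite /sht -(parseval hf hw Hf (is_FT_wavelet s t a0)).
apply: eq_integral_quat => w _; rewrite /spectrum wi0 mul1r conjqZ scaleqAr scaleqAl.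
congr (_ *: _); rewrite -mulrA; congr (_ * _).
rewrite gj conjqM conj_exp_j; congr (_ * _); rewrite /wj; congr exp_j.
by rewrite [in RHS]phaseC phaseNr mulrN.
Qed.

Lemma iq_spectrum a s : a != 0 -> iq leb setT (spectrum a s).
Proof.
move=> a0; have r0 := rho0 a0.
have h := iq_mul_conj measurableT sf' (scales_sqint (scales_shear_adj s a0 r0) sg).
have := iqMl measurableT (K a *: (1 : quat R)) h.
by under eq_fun do rewrite scaleqAl mul1r.
Qed.

Lemma sqn_sht a s : a != 0 -> (sqn leb setT (spectrum a s) < +oo)%E ->
  sqn leb setT (fun t => sht psi f (a, s, t)) = sqn leb setT (spectrum a s).
Proof.
move=> a0 hfin; have iS := iq_spectrum s a0.
have sS : sqint leb setT (spectrum a s) by split => //; exact: iq_measurable iS.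
have [sF eF] := @plancherel R d.+1 pred0 _ iS sS.
have sc := @scales_opp R d.+1.
have -> : sqn leb setT (fun t => sht psi f (a, s, t)) =
    sqn leb setT (qF pred0 (spectrum a s) \o (fun t => - t)).
  by apply: eq_integral => t _; rewrite sht_fourier.
by rewrite (scales_sqn sc); [rewrite mul1e !sqnE// eF|case: sF].
Qed.

Let W a : R := `|a| ^- d.+2.

Let mW : measurable_fun (setT : set (measurableTypeR R)) (W : measurableTypeR R -> measurableTypeR R).
Proof.
have -> : W = (fun a => `|a| `^ (- d.+2%:R)).
  by apply/funext => a; rewrite powRN powR_mulrn.
apply: (measurableT_comp (measurable_powR _)); exact: normr_measurable.
Qed.

Let mK : measurable_fun (setT : set (measurableTypeR R)) (K : measurableTypeR R -> measurableTypeR R).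
Proof.
apply: measurable_funM => //; apply: measurable_funM; first exact: normr_measurable.
by apply: measurable_funX; apply: (measurableT_comp (@normr_measurable R setT)).
Qed.

Let W_ge0 a : 0 <= W a. Proof. by rewrite invr_ge0 exprn_ge0. Qed.

Definition admissibility : \bar R :=
  (\int[leb]_w (nq (g w) / `|w ord0 0| ^+ d.+1)%:E)%E.

Lemma measurable_slice a : measurable_fun setT
  (fun x : S => (nq (g (cons_cV (a, x))))%:E).
Proof.
have mg : measurable_quat setT g by case: sg.
apply/measurable_EFinP; apply: measurable_nq.
have mc : measurable_fun setT (fun x : S => cons_cV ((a : measurableTypeR R), x)).
  by apply: measurable_cons_fun => //; exact: measurable_cst.
exact: (measurable_quat_comp mc mg).
Qed.

(** The balance of all powers of [a] and of the first frequency coordinate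
    [u]. *)
Let wK2 a (u : R) : a != 0 -> u != 0 ->
  W a * K a ^+ 2 * (`|rho a * u| ^+ d)^-1 = `|u| * (`|u * a| ^+ d.+1)^-1.
Proof.
move=> a0 u0; have r0 := rho0 a0.
have -> : K a ^+ 2 = `|a| * `|rho a| ^+ d.
  by rewrite /K exprMn [X in _ * X]expr2 mulrA kapE// mul1r.
rewrite /W !normrM !exprMn !exprS.
have : `|a| != 0 by rewrite normr_eq0.
have : `|u| != 0 by rewrite normr_eq0.
have : `|rho a| ^+ d != 0 by rewrite expf_neq0// normr_eq0.
move: (`|rho a| ^+ d) => x x0 u0' a0'.
have : `|u| ^+ d != 0 by rewrite expf_neq0.
have : `|a| ^+ d != 0 by rewrite expf_neq0.
move: (`|u| ^+ d) (`|a| ^+ d) => y z z0 y0; field.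
by rewrite x0 u0' a0' z0 y0.
Qed.

(** For a fixed frequency the substitutions [s -> rho a * (u s + w')] and [a
    -> u a], where [u] is the first coordinate of [w], carry the integral over
    [a] and [s] to an integral over the whole space, which no longer depends
    on [w]. *)
Lemma integral_orbit w : w ord0 0 != 0 ->
  (\int[leb1]_a \int[lebesgue_cV d]_s
     (W a * K a ^+ 2 * nq (g (shear_adj a (rho a) s w)))%:E = admissibility)%E.
Proof.
move=> w0; have mg : measurable_quat setT g by case: sg.
pose u b := (\int[lebesgue_cV d]_x (nq (g (cons_cV (b, x))) / `|b| ^+ d.+1)%:E)%E.
have mh : measurable_fun setT (fun w : V => (nq (g w) / `|w ord0 0| ^+ d.+1)%:E).
  apply/measurable_EFinP; apply: measurable_funM; first exact: measurable_nq.
  apply: (measurableT_comp measurable_invr); apply: measurable_funX.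
  exact: (measurableT_comp (@normr_measurable R setT) (measurable_coord_cV ord0)).
have h0 (x : V) : (0 <= (nq (g x) / `|x ord0 0| ^+ d.+1)%:E)%E.
  by rewrite lee_fin divr_ge0 ?nq_ge0 ?exprn_ge0.
have CE : admissibility = (\int[leb1]_b u b)%E.
  apply: (etrans (ge0_integral_cons mh h0)); apply: eq_integral => b _.
  by apply: eq_integral => x _; rewrite cons_cV0.
have mu : measurable_fun setT (u : measurableTypeR R -> \bar R).
  have mhc := measurableT_comp mh (@measurable_cons_cV R d).
  have := @measurable_fun_fubini_tonelli_F _ _ _ _ _ (lebesgue_cV d) _ mhc
    (fun q : P2 => h0 (cons_cV q)).
  congr measurable_fun; apply/funext => b; apply: eq_integral => x _ /=.
  by rewrite cons_cV0.
have u0 b : (0 <= u b)%E.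
  by apply: integral_ge0 => x _; rewrite lee_fin divr_ge0 ?nq_ge0 ?exprn_ge0.
pose v : R := w ord0 0; have v0 : v != 0 by [].
have [_ _ hs] := scales_affine 0 v0.
have -> : admissibility = (\int[leb1]_a (`|v|%:E * u (v * a + 0)%R))%E.
  rewrite ge0_integralZl//; last first.
    exact: (measurableT_comp mu (measurable_affine v 0)).
  by rewrite hs// muleA -EFinM mulfV ?normr_eq0// mul1e CE.
apply: eq_integral => a _; rewrite addr0 /v.
have [->|a0] := eqVneq a 0.
  rewrite /u mulr0 normr0 expr0n invr0 [X in (_ = _ * X)%E]integral0_eq; last first.
    by move=> x _; rewrite mulr0.
  by rewrite mule0 integral0_eq// => s _; rewrite /W normr0 expr0n invr0 !mul0r.
have r0 := rho0 a0.
have cneq (i : 'I_d) : (const_mx (rho a * w ord0 0) : S) i 0 != 0.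
  by rewrite mxE mulf_neq0.
have [_ _ hd] := scales_diag_affine (rho a *: (uncons_cV w).2) cneq.
have mF := measurable_slice (a * w ord0 0).
have F0 (x : S) : (0 <= (nq (g (cons_cV (a * w ord0 0, x))))%:E)%E by rewrite lee_fin nq_ge0.
transitivity ((W a * K a ^+ 2)%:E * ((`|rho a * w ord0 0| ^+ d)^-1%:E *
   \int[lebesgue_cV d]_x (nq (g (cons_cV (a * w ord0 0, x))))%:E))%E.
  have -> : ((`|rho a * w ord0 0| ^+ d)^-1%:E *
      \int[lebesgue_cV d]_x (nq (g (cons_cV (a * w ord0 0, x))))%:E =
      \int[lebesgue_cV d]_s (nq (g (shear_adj a (rho a) s w)))%:E)%E.
    rewrite -exprVn -[X in _ ^+ X](card_ord d) -prodr_const.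
    rewrite (eq_bigr (fun i : 'I_d => `|(const_mx (rho a * w ord0 0) : S) i 0|^-1)).
      rewrite -hd//; apply: eq_integral => s _; congr (nq (g (cons_cV (_, _))))%:E.
      by apply/colP => i; rewrite !mxE mulrDr mulrA.
    by move=> i _; rewrite mxE.
  rewrite -ge0_integralZl//.
  - apply/measurable_EFinP; apply: measurable_nq.
    have ms : measurable_fun setT (fun s : S => shear_adj a (rho a) s w).
      exact: (measurable_shear_adj (a := cst a) (r := cst (rho a)) (w := cst w)).
    exact: (measurable_quat_comp ms mg).
  - by move=> s _; rewrite lee_fin nq_ge0.
  - by rewrite lee_fin mulr_ge0// sqr_ge0.
rewrite muleA -EFinM wK2// EFinM -muleA (mulrC a); congr (_ * _)%E.
rewrite -ge0_integralZl ?lee_fin ?invr_ge0 ?exprn_ge0//.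
- by rewrite /u; apply: eq_integral => x _; rewrite EFinM muleC.
- exact: measurable_slice.
- by move=> x _; rewrite lee_fin nq_ge0.
Qed.

Let energy (z : P2 * V) : \bar R := (W z.1.1 * nq (spectrum z.1.1 z.1.2 z.2))%:E.

Let energy_ge0 z : (0 <= energy z)%E.
Proof. by rewrite lee_fin mulr_ge0// nq_ge0. Qed.

Let energyE z : energy z = ((nq (f' z.2))%:E *
  (W z.1.1 * K z.1.1 ^+ 2 * nq (g (shear_adj z.1.1 (rho z.1.1) z.1.2 z.2)))%:E)%E.
Proof. by rewrite /energy /spectrum nqZ nqM nq_conj -EFinM; congr EFin; ring. Qed.

Let m11 : measurable_fun setT (fun z : P2 * V => z.1.1).
Proof. exact: (measurableT_comp measurable_fst measurable_fst). Qed.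

Let m_orbit : measurable_fun setT (fun z : P2 * V =>
  W z.1.1 * K z.1.1 ^+ 2 * nq (g (shear_adj z.1.1 (rho z.1.1) z.1.2 z.2))).
Proof.
have mg : measurable_quat setT g by case: sg.
apply: measurable_funM.
  apply: measurable_funM; first exact: (measurableT_comp mW m11).
  by apply: measurable_funX; exact: (measurableT_comp mK m11).
apply: measurable_nq.
have m12 : measurable_fun setT (fun z : P2 * V => z.1.2).
  exact: (measurableT_comp measurable_snd measurable_fst).
exact: (measurable_quat_comp
  (measurable_shear_adj m11 (measurableT_comp mrho m11) m12 measurable_snd) mg).
Qed.

Let m_energy : measurable_fun setT energy.
Proof.
have mf' : measurable_quat setT f' by case: sf'.
rewrite (funext energyE); apply: emeasurable_funM; apply/measurable_EFinP => //.
by apply: measurable_nq; exact: (measurable_quat_comp measurable_snd mf').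
Qed.

(** Tonelli's theorem: for almost every frequency the integral over [a] and
    [s] is the same constant. *)
Lemma integral_energy : (\int[B2]_q \int[leb]_w energy (q, w) =
  admissibility * sqn leb setT f')%E.
Proof.
have mf' : measurable_quat setT f' by case: sf'.
have C0 : (0 <= admissibility)%E.
  by apply: integral_ge0 => x _; rewrite lee_fin divr_ge0 ?nq_ge0 ?exprn_ge0.
rewrite (@fubini_tonelli _ _ _ _ _ B2 leb energy m_energy energy_ge0).
rewrite /sqn -ge0_integralZl//; first last.
- by move=> x _; rewrite lee_fin nq_ge0.
- exact/measurable_EFinP/measurable_nq.
apply: ge0_ae_eq_integral => //.
- exact: (@measurable_fun_fubini_tonelli_G _ _ _ _ _ B2 _ m_energy energy_ge0).
- by apply: emeasurable_funM => //; exact/measurable_EFinP/measurable_nq.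
- by move=> x _; exact: integral_ge0.
- by move=> x _; rewrite mule_ge0// lee_fin nq_ge0.
apply: filterS (ae_coord_neq0 (ord0 : 'I_d.+1)) => w w0 _.
pose h (q : P2) := (W q.1 * K q.1 ^+ 2 * nq (g (shear_adj q.1 (rho q.1) q.2 w)))%:E.
have h0 q : (0 <= h q)%E.
  by rewrite lee_fin mulr_ge0 ?nq_ge0// mulr_ge0 ?sqr_ge0// W_ge0.
have mh : measurable_fun setT h.
  by apply/measurable_EFinP; exact: (measurableT_comp m_orbit (pair2_measurable w)).
transitivity (\int[B2]_q ((nq (f' w))%:E * h q))%E.
  by apply: eq_integral => q _; rewrite energyE.
rewrite ge0_integralZl ?lee_fin ?nq_ge0// muleC; congr (_ * _)%E.
rewrite -(integral_orbit w0).
exact: (@fubini_tonelli1 _ _ _ _ _ leb1 (lebesgue_cV d) h mh h0).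
Qed.

(** Almost every [a] and [s] give a square-integrable spectrum, because the
    total energy is finite, and Plancherel's identity in [t] applies to it. *)
Lemma sht_isometry : (admissibility < +oo)%E ->
  (\int[(B2 \x leb)%E]_p ((nq (sht psi f p))%:E * (W p.1.1)%:E) =
   admissibility * sqn leb setT f)%E.
Proof.
move=> Cfin.
have mpsi : measurable_quat setT psi by case: hpsi.
have mf : measurable_quat setT f by case: hf.
have sqff : sqn leb setT f' = sqn leb setT f by rewrite !sqnE// (is_FT_sqN hf Hf).
have C0 : (0 <= admissibility)%E.
  by apply: integral_ge0 => x _; rewrite lee_fin divr_ge0 ?nq_ge0 ?exprn_ge0.
rewrite -sqff -integral_energy.
pose k (p : P) := ((nq (sht psi f p))%:E * (W p.1.1)%:E)%E.
have k0 p : (0 <= k p)%E by rewrite mule_ge0 ?lee_fin ?nq_ge0.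
have mk : measurable_fun setT k.
  apply: emeasurable_funM; apply/measurable_EFinP.
    by apply: measurable_nq; exact: measurable_sht.
  exact: (measurableT_comp mW m11).
rewrite (@fubini_tonelli1 _ _ _ _ _ B2 leb k mk k0).
have mE := @measurable_fun_fubini_tonelli_F _ _ _ _ _ leb _ m_energy energy_ge0.
have E0 q : (0 <= \int[leb]_w energy (q, w))%E by exact: integral_ge0.
have iE : B2.-integrable setT (fun q => \int[leb]_w energy (q, w))%E.
  apply/integrableP; split => //; under eq_integral do rewrite gee0_abs//.
  rewrite integral_energy; apply: lte_mul_pinfty => //; last by case: sf'.
  by rewrite ge0_fin_numE.
apply: ge0_ae_eq_integral => //.
- exact: (@measurable_fun_fubini_tonelli_F _ _ _ _ _ leb _ mk k0).
- by move=> q _; exact: integral_ge0.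
apply: filterS (integrable_ae measurableT iE) => -[a s] /(_ Logic.I) hfin _.
have [a0|a0] := eqVneq a 0.
  rewrite /fubini_F !integral0_eq// => x _.
    by rewrite /energy /W /= a0 normr0 expr0n invr0 mul0r.
  by rewrite /k /W /= a0 normr0 expr0n invr0 mule0.
have Wa : 0 < W a by rewrite invr_gt0 exprn_gt0// normr_gt0.
have iS := iq_measurable (iq_spectrum s a0).
have eE : (\int[leb]_w energy ((a, s), w) = (W a)%:E * sqn leb setT (spectrum a s))%E.
  rewrite /sqn -ge0_integralZl ?lee_fin//.
  - exact/measurable_EFinP/measurable_nq.
  - by move=> x _; rewrite lee_fin nq_ge0.
have hS : (sqn leb setT (spectrum a s) < +oo)%E.
  rewrite ltey; apply/eqP => e; move: hfin.
  by rewrite eE e gt0_muley ?lte_fin.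
rewrite eE -(sqn_sht a0 hS) /sqn -ge0_integralZl ?lee_fin//.
- by apply: eq_integral => t _; rewrite muleC.
- apply/measurable_EFinP/measurable_nq.
  exact: (measurable_quat_comp (pair1_measurable (a, s)) (measurable_sht mpsi mf)).
- by move=> x _; rewrite lee_fin nq_ge0.
Qed.

End FixedFunctions.

End ShearletIsometry.

(** * The reproducing kernel *)

Section ShearletParameters.
Context {R : realType} (n : nat).
Local Notation dim := (n.+1 + n.+1)%N.
Local Notation d := (n + n.+1)%N.
Local Notation V := ('cV[R]_dim).
Local Notation P := (measurableTypeR R * 'cV[R]_d * V)%type.

Definition rho (a : R) : R := Num.sg a * `|a| `^ (dim%:R^-1).
Definition kap (a : R) : R := `|a| `^ ((4 * n.+1)%:R^-1 - 1).

Lemma measurable_kap : measurable_fun (setT : set (measurableTypeR R))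
  (kap : measurableTypeR R -> measurableTypeR R).
Proof. apply: (measurableT_comp (measurable_powR _)); exact: normr_measurable. Qed.

Lemma measurable_rho : measurable_fun (setT : set (measurableTypeR R))
  (rho : measurableTypeR R -> measurableTypeR R).
Proof.
have mn := @normr_measurable R setT.
have -> : rho = (fun a => a * `|a|^-1 * `|a| `^ (dim%:R^-1)).
  apply/funext => a; rewrite /rho; congr (_ * _).
  have [->|a0] := eqVneq a 0; first by rewrite sgr0 mul0r.
  by rewrite {2}[a]numEsg mulfK// normr_eq0.
apply: measurable_funM; last exact: (measurableT_comp (measurable_powR _) mn).
by apply: measurable_funM => //; exact: (measurableT_comp (@measurable_invr R) mn).
Qed.

Lemma rho_neq0 (a : R) : a != 0 -> rho a != 0.
Proof.
move=> a0; rewrite mulf_neq0 ?sgr_eq0// gt_eqF// powR_gt0// normr_gt0//.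
Qed.

(** With [N = n.+1] the exponents of [`|a|] are [2 (1/(4N) - 1)], [1] and [(2N
    - 1)/(2N)], and they add up to 0. *)
Lemma kap_det (a : R) : a != 0 -> kap a ^+ 2 * (`|a| * `|rho a| ^+ d) = 1.
Proof.
move=> a0; have b0 : 0 < `|a| by rewrite normr_gt0.
have -> : `|rho a| = `|a| `^ (dim%:R^-1).
  by rewrite normrM normr_sg a0 mul1r ger0_norm// powR_ge0.
rewrite -!powR_mulrn ?powR_ge0// /kap -!powRrM -{2}(powRr1 (ltW b0)).
have bn : `|a| != 0 by rewrite normr_eq0.
rewrite -!powRD ?bn ?implybT//.
have -> : ((4 * n.+1)%:R^-1 - 1) * 2%:R + (1 + dim%:R^-1 * d%:R) = 0 :> R.
  rewrite natrM (_ : dim = 2 * n.+1)%N ?natrM; last by rewrite mul2n addnn.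
  rewrite (_ : d%:R = 2 * n.+1%:R - 1 :> R).
    by have : n.+1%:R != 0 :> R by []; move: n.+1%:R => m m0; field.
  apply/eqP; rewrite eq_sym subr_eq -natrM natr1 eqr_nat.
  by rewrite mul2n -addnn addSn.
by rewrite powRr0.
Qed.

Lemma dilation_unit (a : R) : a != 0 -> dilation n a \in unitmx.
Proof.
move=> a0; rewrite unitmxE /dilation (@det_ublock R 1 d) !det_scalar unitfE.
rewrite expr1 mulf_neq0// expf_neq0//; exact: rho_neq0.
Qed.

Lemma shear_unit (s : 'cV[R]_d) : shear s \in unitmx.
Proof. by rewrite unitmxE /shear (@det_ublock R 1 d) !det1 mulr1 unitr1. Qed.

Lemma shear_dilationK (a : R) (s : 'cV[R]_d) (y : V) : a != 0 ->
  shear s *m (dilation n a *m (shear_inv a (rho a) s y : V)) = y.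
Proof.
move=> a0; have r0 := rho_neq0 a0.
rewrite /shear_inv /dilation /cons_cV /shear -/(rho a).
rewrite [X in _ *m X](@mul_block_col R 1 d 1 d 1).
rewrite (@mul_block_col R 1 d 1 d 1) !mul0mx !mul1mx addr0 add0r; cbn [fst snd].
rewrite -[RHS](@vsubmxK R 1 d 1 y).
have -> : (rho a)%:M *m ((rho a)^-1 *: (uncons_cV y).2) = (uncons_cV y).2.
  by rewrite mul_scalar_mx scalerA mulfV// scale1r.
apply: (f_equal2 (@col_mx R 1 d 1)); last by rewrite ?add0r.
apply/matrixP => i j; rewrite !ord1 mul_scalar_mx !mxE.
rewrite (_ : lshift d 0 = ord0); last exact: val_inj.
rewrite mulrA mulfV// mul1r.
rewrite (_ : \sum_j _ = dotv s (uncons_cV y).2) ?subrK//.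
by apply: eq_bigr => k _; rewrite mxE.
Qed.

Lemma shearlet_atE (psi : V -> quat R) (p : P) : p.1.1 != 0 ->
  shearlet_at psi p = wavelet rho kap psi p.
Proof.
case: p => -[a s] t /= a0; apply/funext => x; rewrite /wavelet /=.
congr (_ *: psi _); rewrite -[in LHS](shear_dilationK s (x - t) a0).
by rewrite !mulKmx ?shear_unit ?dilation_unit.
Qed.

End ShearletParameters.

Section ShearletTransform.
Context {R : realType} (n : nat).
Local Notation dim := (n.+1 + n.+1)%N.
Local Notation d := (n + n.+1)%N.
Local Notation V := ('cV[R]_dim).
Local Notation P := (measurableTypeR R * 'cV[R]_d * V)%type.
Local Notation leb := (lebesgue_cV dim : {sigma_finite_measure set V -> \bar R}).
Local Notation nu := (shear_measure R n).
Local Notation D := (shear_domain R n).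
Local Notation SH := (shearlet_transform).
Implicit Types (f g : V -> quat R) (F G : P -> quat R) (p q : P).

Lemma measurable_shear_domain : measurable D.
Proof.
rewrite (_ : D = (fun p : P => p.1.1) @^-1` (~` [set 0])); last first.
  by apply/seteqP; split => p /= /eqP.
rewrite -[X in measurable X]setTI.
have m11 : measurable_fun setT (fun p : P => p.1.1).
  exact: (measurableT_comp measurable_fst measurable_fst).
by apply: m11 => //; exact: measurableC.
Qed.

Lemma sqint_shearlet_at psi p : sqint leb setT psi -> D p ->
  sqint leb setT (shearlet_at psi p) /\
  sqN leb setT (shearlet_at psi p) = sqN leb setT psi.
Proof.
move=> hpsi Dp; rewrite shearlet_atE//; case: p Dp => -[a s] t /= a0.
exact: (sqint_wavelet (@rho_neq0 R n) (@kap_det R n) hpsi s t a0).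
Qed.

Section Isometry.
Variables (psi g : V -> quat R).
Context (hpsi : sqint leb setT psi) (Hg : is_FT pred0 psi g).
Context (gj : forall w (t : R), g w * exp_j t = exp_j t * g w).
Context (gE : {ae leb, forall w, nq (qft (involution psi) w) = nq (g w)}).
Local Notation C := (admissibility_const psi).

Let sg : sqint leb setT g. Proof. by case: Hg. Qed.

Lemma admissibilityE : admissibility_integral psi = admissibility (g : 'cV[R]_d.+1 -> quat R).
Proof.
have mg : measurable_quat setT g by case: sg.
have mq : measurable_quat setT (qft (involution psi)).
  by have [[]] := is_FT_qft (sqint_star hpsi).
have m1 h : measurable_quat setT h ->
    measurable_fun setT (fun w : V => (nq (h w) / `|coord1 w| ^+ dim)%:E).
  move=> mh; apply/measurable_EFinP; apply: measurable_funM; first exact: measurable_nq.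
  apply: (measurableT_comp (@measurable_invr R)); apply: measurable_funX.
  exact: (measurableT_comp (@normr_measurable R setT) (measurable_coord_cV _)).
transitivity (\int[leb]_w (nq (qft (involution psi) w) / `|coord1 w| ^+ dim)%:E)%E.
  by apply: eq_integral => w _; rewrite modq_sqr.
transitivity (\int[leb]_w (nq (g w) / `|coord1 w| ^+ dim)%:E)%E.
  apply: ge0_ae_eq_integral => //; [exact: m1|exact: m1|..].
  - by move=> w _; rewrite lee_fin divr_ge0 ?nq_ge0 ?exprn_ge0.
  - by move=> w _; rewrite lee_fin divr_ge0 ?nq_ge0 ?exprn_ge0.
  - by apply: filterS gE => w -> _.
apply: eq_integral => w _; congr (_ / `|w _ _| ^+ _)%:E; exact: val_inj.
Qed.

Context (Cfin : (admissibility_integral psi < +oo)%E).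

(** On the set [a = 0], which is outside the domain, the density vanishes, so
    the integral over the domain is the integral over all parameters. [F] is
    arbitrary there, as elements of the range are. *)
Lemma shearlet_isometry f F : sqint leb setT f -> (forall p, D p -> F p = SH psi f p) ->
  sqint nu D F /\ sqN nu D F = C * sqN leb setT f.
Proof.
move=> hf FE; have [f' Hf] := is_FT_ex pred0 hf.
have mD := measurable_shear_domain.
have mpsi : measurable_quat setT psi by case: hpsi.
have mf : measurable_quat setT f by case: hf.
pose G : P -> quat R := sht (@rho R n) (@kap R n) psi f.
have GE p : D p -> F p = G p.
  by move=> Dp; rewrite FE// /SH shearlet_atE.
have mG : measurable_quat setT G.
  exact: (measurable_sht (@measurable_rho R n) (@measurable_kap R n) mpsi mf).
have mF : measurable_quat D F.
  have [h1 h2 h3 h4] := mG.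
  by split; [move: h1|move: h2|move: h3|move: h4] => /(measurable_funS measurableT (@subsetT _ D));
    apply: eq_measurable_fun => p /set_mem Dp; rewrite GE.
have e : (sqn nu D F = admissibility_integral psi * sqn leb setT f)%E.
  have Cf := Cfin; rewrite admissibilityE in Cf *.
  rewrite -(sht_isometry (@measurable_rho R n) (@measurable_kap R n)
    (@rho_neq0 R n) (@kap_det R n) hpsi Hg hf Hf gj Cf).
  pose w (p : P) : R := `|p.1.1| ^- d.+2.
  have mw : measurable_fun setT w.
    have m11 : measurable_fun setT (fun p : P => p.1.1).
      exact: (measurableT_comp measurable_fst measurable_fst).
    apply: (measurableT_comp (@measurable_invr R)); apply: measurable_funX.
    exact: (measurableT_comp (@normr_measurable R setT) m11).
  have w0 p : 0 <= w p by rewrite invr_ge0 exprn_ge0.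
  pose h (p : P) := ((fun p => (nq (G p))%:E) \_ D) p.
  have h0 p : (0 <= h p)%E.
    by rewrite /h patchE; case: ifP => // _; rewrite lee_fin nq_ge0.
  have mh : measurable_fun setT h.
    apply/(measurable_restrictT _ mD); apply: (measurable_funS measurableT) => //.
    exact/measurable_EFinP/measurable_nq.
  transitivity (\int[nu]_p h p)%E.
    rewrite /sqn integral_mkcond; apply: eq_integral => p _; rewrite /h !patchE.
    by case: ifPn => // /set_mem Dp; rewrite GE.
  have nuE A : measurable A -> nu A =
      (\int[(sfprod (@lebesgue_measure R) (lebesgue_cV d) \x lebesgue_cV d.+1)%E]_(p in A)
        (w p)%:E)%E by [].
  rewrite (integral_density mw w0 nuE mh h0); apply: eq_integral => p _.
  rewrite /h patchE; case: ifPn => // /negP; rewrite inE => /negP.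
  rewrite /shear_domain /= negbK => /eqP a0.
  by rewrite mul0e /= a0 normr0 expr0n invr0 mule0.
have C0 : (0 <= admissibility_integral psi)%E.
  by apply: integral_ge0 => x _; rewrite lee_fin divr_ge0 ?sqr_ge0 ?exprn_ge0.
have CE : admissibility_integral psi = C%:E.
  by rewrite /admissibility_const fineK// ge0_fin_numE.
have hF : sqint nu D F by split => //; rewrite e CE (sqnE hf) -EFinM ltry.
by split => //; apply: EFin_inj; rewrite -(sqnE hF) e CE (sqnE hf).
Qed.

(** If the constant were 0, the transform of [psi], and then [psi], would
    vanish almost everywhere. *)
Lemma admissibility_const_gt0 : ~ {ae leb, forall x, psi x = 0} -> 0 < C.
Proof.
move=> psi0.
have mg : measurable_quat setT g by case: sg.
have C0 : (0 <= admissibility_integral psi)%E.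
  by apply: integral_ge0 => x _; rewrite lee_fin divr_ge0 ?sqr_ge0 ?exprn_ge0.
rewrite lt_neqAle fine_ge0// andbT; apply/negP => /eqP C00; apply: psi0.
have C1 : admissibility (g : 'cV[R]_d.+1 -> quat R) = 0%E.
  by rewrite -admissibilityE -[LHS]fineK ?ge0_fin_numE// -[fine _]C00.
have g0 : {ae leb, forall w, setT w -> (nq (g w) / `|w ord0 0| ^+ d.+1)%:E = 0%E}.
  apply/(ae_eq_integral_abs leb measurableT).
    apply/measurable_EFinP; apply: measurable_funM; first exact: measurable_nq.
    apply: (measurableT_comp (@measurable_invr R)); apply: measurable_funX.
    exact: (measurableT_comp (@normr_measurable R setT) (measurable_coord_cV _)).
  rewrite -[RHS]C1; apply: eq_integral => w _; rewrite gee0_abs//.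
  by rewrite lee_fin divr_ge0 ?nq_ge0 ?exprn_ge0.
have g1 : {ae leb, forall w, setT w -> g w = 0}.
  apply: filterS2 g0 (ae_coord_neq0 (ord0 : 'I_d.+1)) => w /(_ Logic.I) [] e w0 _.
  apply: nq_eq0; move/eqP: e; rewrite mulf_eq0 invr_eq0 expf_eq0/= normr_eq0.
  by rewrite (negbTE w0) orbF => /eqP.
have sqg : sqn leb setT g = 0%E.
  rewrite (ae_eq_sqn measurableT mg (measurable_quat_cst _ _) g1).
  by rewrite /sqn integral0_eq// => x _; rewrite nq0.
have sqpsi : sqn leb setT psi = 0%E.
  by rewrite sqnE// -(is_FT_sqN hpsi Hg) -sqnE.
have mpsi : measurable_quat setT psi by case: hpsi.
by apply: filterS (sqn_eq0 measurableT mpsi sqpsi) => x; apply.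
Qed.

End Isometry.

End ShearletTransform.

Theorem theorem6 (R : realType) (n : nat)
    (psi : 'cV[R]_(n.+1 + n.+1) -> quat R)
    (psi_admissible : admissible psi)
    (psi_neq0 : ~ (\forall x \ae lebesgue_cV (n.+1 + n.+1), psi x = 0))
    (qft_comm : forall t : 'cV[R]_n.+1,
       \forall w \ae lebesgue_cV (n.+1 + n.+1),
         qft psi w * wave_j (dsubmx w) t = wave_j (dsubmx w) t * qft psi w)
    (qft_j_comm : forall t : 'cV[R]_n.+1,
       \forall w \ae lebesgue_cV (n.+1 + n.+1),
         qft (fun x => unit_j * psi x) w * wave_j (dsubmx w) t =
         unit_j * wave_j (dsubmx w) t * qft psi w) :
  is_rkhs (shear_measure R n) (shear_domain R n)
    (shearlet_range psi) (shearlet_kernel psi) /\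
  (forall p q, shear_domain R n p -> shear_domain R n q ->
     modq (shearlet_kernel psi p q) <=
       fine (L2norm (lebesgue_cV (n.+1 + n.+1)) setT psi) ^+ 2
         / admissibility_const psi).
Proof.
have [/L2_quatP hpsi Cfin] := psi_admissible.
have [g [Hg gj gE]] := commuting_transform hpsi qft_comm qft_j_comm.
pose leb := lebesgue_cV (n.+1 + n.+1) : {sigma_finite_measure set 'cV[R]_(n.+1 + n.+1) -> \bar R}.
pose C := admissibility_const psi.
have iso f F : sqint leb setT f ->
    (forall p, shear_domain R n p -> F p = shearlet_transform psi f p) ->
    sqint (shear_measure R n) (shear_domain R n) F /\
    sqN (shear_measure R n) (shear_domain R n) F = C * sqN leb setT f.
  exact: (shearlet_isometry hpsi Hg gj gE Cfin).
have C0 : 0 < C by exact: (admissibility_const_gt0 hpsi Hg gE Cfin psi_neq0).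
have mD := @measurable_shear_domain R n.
have hat p : shear_domain R n p -> sqint leb setT (shearlet_at psi p).
  by move=> Dp; have [] := sqint_shearlet_at hpsi Dp.
have SHD f h p : sqint leb setT f -> sqint leb setT h -> shear_domain R n p ->
    shearlet_transform psi (fun x => f x + h x) p =
    shearlet_transform psi f p + shearlet_transform psi h p.
  by move=> hf hh Dp; apply: (ipDl measurableT) => //; exact: hat.
have SHM q f p : sqint leb setT f -> shear_domain R n p ->
    shearlet_transform psi (fun x => q * f x) p = q * shearlet_transform psi f p.
  by move=> hf Dp; apply: (ipMl measurableT) => //; exact: hat.
have SHB f h p : sqint leb setT f -> sqint leb setT h -> shear_domain R n p ->
    shearlet_transform psi (fun x => f x - h x) p =
    shearlet_transform psi f p - shearlet_transform psi h p.
  move=> hf hh Dp; rewrite -[- shearlet_transform psi h p]mulN1r -SHM// -SHD//.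
    have -> : (fun x => f x - h x) = (fun x => f x + -1 * h x).
      by apply/funext => x; rewrite mulN1r.
    by [].
  exact: sqintMl.
pose c : quat R := C^-1 *: (1 : quat R).
have KE p q : shear_domain R n p -> shear_domain R n q ->
    shearlet_kernel psi p q = shearlet_transform psi (fun x => c * shearlet_at psi p x) q.
  by move=> Dp Dq; rewrite (SHM c _ q (hat p Dp) Dq) /c scaleqAl mul1r.
have hc p : shear_domain R n p -> sqint leb setT (fun x => c * shearlet_at psi p x).
  by move=> Dp; apply: sqintMl => //; exact: hat.
(* The bound on the kernel comes first, being independent of the isometry. *)
split; last first.
  move=> p q Dp Dq; rewrite /shearlet_kernel modqZ -/C ger0_norm ?invr_ge0 ?(ltW C0)//.
  rewrite mulrC ler_pM2r ?invr_gt0// (L2norm_sqN hpsi) /= sqr_sqrtr ?sqN_ge0//.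
  rewrite -(ler_pXn2r (n := 2)) ?nnegrE ?modq_ge0 ?sqN_ge0// modq_sqr.
  have [hp np] := sqint_shearlet_at hpsi Dp; have [hq nq] := sqint_shearlet_at hpsi Dq.
  by have := cauchy_schwarz measurableT hp hq; rewrite np nq -expr2.
split.
- split.
  + by move=> F [f /L2_quatP hf FE]; apply/L2_quatP; have [] := iso f F hf FE.
  + exists (fun=> 0); first by apply/L2_quatP; exact: sqint0.
    move=> p Dp; have e := SHM 0 (fun=> 0) p (sqint0 _ _) Dp.
    by rewrite !mul0r in e; rewrite e.
  + move=> F G [f /L2_quatP hf FE] [h /L2_quatP hh GE].
    exists (fun x => f x + h x); first by apply/L2_quatP; exact: sqintD.
    by move=> p Dp; rewrite SHD// FE// GE.
  + move=> q F [f /L2_quatP hf FE].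
    exists (fun x => q * f x); first by apply/L2_quatP; exact: sqintMl.
    by move=> p Dp; rewrite SHM// FE.
- move=> F_ VF cau.
  have /choice[f_ hf_] : forall k, exists f, sqint leb setT f /\
      forall p, shear_domain R n p -> F_ k p = shearlet_transform psi f p.
    by move=> k; have [f /L2_quatP hf FE] := VF k; exists f.
  have hfs k : sqint leb setT (f_ k) by have [] := hf_ k.
  have isoB k h H : sqint leb setT h ->
      (forall p, shear_domain R n p -> H p = shearlet_transform psi h p) ->
      sqint (shear_measure R n) (shear_domain R n) (fun p => F_ k p - H p) /\
      sqN (shear_measure R n) (shear_domain R n) (fun p => F_ k p - H p) =
        C * sqN leb setT (fun x => f_ k x - h x).
    move=> hh HE; apply: iso; first exact: sqintB.
    by move=> p Dp; have [h1 h2] := hf_ k; rewrite SHB// h2// HE.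
  have [f hf cf] : exists2 f, sqint leb setT f &
      sqN leb setT (fun x => f_ k x - f x) @[k --> \oo] --> (0 : R).
    apply: L2_complete => // e e0.
    (* The norm in the hypothesis is not squared. *)
    have Ce : 0 < C * e by rewrite mulr_gt0.
    have [N hN] := cau (Num.sqrt (C * e)) ltac:(by rewrite sqrtr_gt0).
    exists N => k l Nk Nl; have [h1 h2] := isoB k _ _ (hfs l) (proj2 (hf_ l)).
    have := hN k l Nk Nl; rewrite (L2norm_sqN h1) lte_fin ltr_sqrt// h2.
    by rewrite ltr_pM2l.
  exists (shearlet_transform psi f).
    by exists f; first exact/L2_quatP.
  apply/L2_convergesP => [k|]; first by have [] := isoB k f _ hf (fun _ _ => erefl).
  rewrite (_ : (fun k => _) = (fun k => C * sqN leb setT (fun x => f_ k x - f x))).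
    have h3 : C * sqN leb setT (fun x => f_ k x - f x) @[k --> \oo] --> (C * 0 : R).
      by apply: cvgM => //; exact: cvg_cst.
    by rewrite mulr0 in h3.
  by apply/funext => k; have [] := isoB k f _ hf (fun _ _ => erefl).
- move=> p Dp; exists (fun x => c * shearlet_at psi p x); first exact/L2_quatP/hc.
  by move=> q Dq; exact: KE.
- move=> F [f /L2_quatP hf FE] p Dp.
  have hcp := hc p Dp; have hp := hat p Dp.
  have [hF _] := iso f F hf FE.
  have [hK _] := iso _ _ hcp (fun q => KE p q Dp).
  (* The kernel at [p] is the transform of [c * psi_p], so both arguments of
     the inner product are transforms. *)
  have -> : inner_quat (shear_measure R n) (shear_domain R n) F (shearlet_kernel psi p) =
      C *: inner_quat leb setT f (fun x => c * shearlet_at psi p x).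
    apply: (polarization measurableT mD hf hcp hF hK) => u v.
    have [] // := iso (fun x => u * f x + v * (c * shearlet_at psi p x))
      (fun q => u * F q + v * shearlet_kernel psi p q).
      by apply: sqintD => //; exact: sqintMl.
    move=> q Dq; rewrite SHD ?(SHM v)// ?FE// ?KE// ?(SHM u)//; exact: sqintMl.
  rewrite FE// (ip_conj measurableT hcp hf) (ipMl measurableT c hp hf) conjqM.
  rewrite -(ip_conj measurableT hp hf) /c conjqZ scaleqAr scalerA mulfV ?gt_eqF//.
  rewrite scale1r (_ : conjq 1 = 1 :> quat R) ?mulr1//.
  by rewrite /conjq /= oppr0.
Qed.
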